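(* Let $d,n\ge1$ and let $\mathcal{F}$ be a $\mathbb{C}^{n\times n}$-valued function of $d$ complex variables (on $\mathbb{D}^d$). The following statements are equivalent: (1) $\mathcal{F}\in\mathcal{ISA}_d^{\rm rat}(\mathbb{C}^n)$. (2$'$) There exist rational $\mathbb{C}^{N_k\times n}$-valued functions $\theta_k$, with some $N_k\in\mathbb{N}$, $k=1,\dots,d$, which have no singularities on $\mathbb{D}^d$ and satisfy $$I_n-\mathcal{F}(\omega)^*\mathcal{F}(\zeta)=\sum_{k=1}^d(1-\overline{\omega}_k\zeta_k)\theta_k(\omega)^*\theta_k(\zeta),\qquad \omega,\zeta\in\mathbb{D}^d.$$ (3) $\mathcal{F}$ has a finite-dimensional Givone--Roesser unitary realization, i.e., there exist $m,m_1,\dots,m_d\in\mathbb{Z}_+$ with $m=m_1+\cdots+m_d$, and a unitary matrix $$U=\begin{bmatrix}A&B\\C&D\end{bmatrix}\in\mathbb{C}^{(m+n)\times(m+n)},$$ where $A\in\mathbb{C}^{m\times m}$, $B\in\mathbb{C}^{m\times n}$, $C\in\mathbb{C}^{n\times m}$, $D\in\mathbb{C}^{n\times n}$, such that $$\mathcal{F}(\zeta)=D+C(I_m-P(\zeta)A)^{-1}P(\zeta)B,\qquad \zeta\in\mathbb{D}^d,$$ where $P(\zeta)=\operatorname{Diag}[\zeta_1I_{m_1},\dots,\zeta_dI_{m_d}]$.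
   Context: $\mathbb{D}^d=\{\zeta\in\mathbb{C}^d:|\zeta_k|<1,\ k=1,\dots,d\}$, $\mathbb{T}^d=\{\zeta\in\mathbb{C}^d:|\zeta_k|=1,\ k=1,\dots,d\}$. A matrix-valued function is rational if all its entries are quotients of polynomials (rational functions agreeing on a nonempty open set are identified; a function on $\mathbb{D}^d$ is called rational if it is the restriction of a rational function without singularities on $\mathbb{D}^d$). The Schur--Agler class $\mathcal{SA}_d(\mathbb{C}^n)$ consists of the holomorphic functions $\mathcal{F}(\zeta)=\sum_{t\in\mathbb{Z}_+^d}\widehat{\mathcal{F}}_t\zeta^t$ from $\mathbb{D}^d$ to $\mathbb{C}^{n\times n}$ such that $\|\mathcal{F}(T)\|\le1$ for every $d$-tuple $T=(T_1,\dots,T_d)$ of commuting strict contractions ($\|T_k\|<1$) on a Hilbert space, where $\mathcal{F}(T)=\sum_t\widehat{\mathcal{F}}_t\otimes T^t$, $T^t=T_1^{t_1}\cdots T_d^{t_d}$. The class $\mathcal{ISA}_d^{\rm rat}(\mathbb{C}^n)$ consists of those $\mathcal{F}\in\mathcal{SA}_d(\mathbb{C}^n)$ that are rational and inner, i.e. $\mathcal{F}(\omega)$ is unitary at each point of analyticity $\omega\in\mathbb{T}^d$ of $\mathcal{F}$. *)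

(* Defs.v *)
From HB Require Import structures.
From mathcomp Require Import all_boot all_order all_algebra.
From mathcomp Require Import finmap complex.
From mathcomp Require Import all_classical all_reals all_analysis summability.
(* The notations of mpoly clash with those of mathcomp-analysis. *)
From mathcomp Require Import -(notations) mpoly.

Set Implicit Arguments.
Unset Strict Implicit.
Unset Printing Implicit Defensive.

Import Order.TTheory GRing.Theory Num.Theory numFieldNormedType.Exports.

Local Open Scope classical_set_scope.
Local Open Scope sesquilinear_scope.
Local Open Scope ring_scope.

(* In all that follows, a function on the polydisk is a total function on
   'I_d -> R[i] of which only the values on the polydisk are ever used. *)

Definition polydisk (R : realType) (d : nat) : set ('I_d -> R[i]) :=
  [set z | forall k, `|z k| < 1].

Definition torus (R : realType) (d : nat) : set ('I_d -> R[i]) :=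
  [set z | forall k, `|z k| = 1].

Definition ratfun (R : realType) (d : nat) := {fraction (mpoly d R[i])}.

(* f is regular (has no singularity) at z and takes the value w there: in a
   suitable representation p / q of f the denominator does not vanish at z. *)
Definition ratfun_value (R : realType) (d : nat)
    (f : ratfun R d) (z : 'I_d -> R[i]) (w : R[i]) : Prop :=
  exists p q : mpoly d R[i],
    [/\ f = tofrac p / tofrac q, meval z q != 0
      & w = meval z p / meval z q].

Definition ratmx_value (R : realType) (d p q : nat)
    (f : 'M[ratfun R d]_(p, q)) (z : 'I_d -> R[i]) (W : 'M[R[i]]_(p, q)) :
  Prop := forall i j, ratfun_value (f i j) z (W i j).

Definition restricts_ratmx (R : realType) (d p q : nat)
    (f : 'M[ratfun R d]_(p, q)) (F : ('I_d -> R[i]) -> 'M[R[i]]_(p, q)) :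
  Prop := forall z, polydisk z -> ratmx_value f z (F z).

Definition rational_on_polydisk (R : realType) (d p q : nat)
    (F : ('I_d -> R[i]) -> 'M[R[i]]_(p, q)) : Prop :=
  exists f : 'M[ratfun R d]_(p, q), restricts_ratmx f F.

(* By uniqueness of f, its points of regularity on the torus are the points
   of analyticity of F, and the values of f there are those of F. *)
Definition rational_inner (R : realType) (d n : nat)
    (F : ('I_d -> R[i]) -> 'M[R[i]]_n) : Prop :=
  exists2 f : 'M[ratfun R d]_n, restricts_ratmx f F &
    forall w W, torus w -> ratmx_value f w W -> W \is unitarymx.

(* A Hilbert space is a complete normed space over R[i] together with an inner
   product (linear in the first argument) that induces the norm. *)
Definition is_inner_product (R : realType) (H : completeNormedModType R[i])
    (ip : {dot H for Num.conj}) : Prop :=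
  forall x : H, `|x| ^+ 2 = ip x x.

(* The Hilbert space norm of the direct sum of n copies of H, that is, of the
   tensor product of R[i]^n with H. *)
Definition l2norm (R : realType) (H : normedModType R[i]) (n : nat)
    (x : {ffun 'I_n -> H}) : R[i] :=
  sqrtC (\sum_i `|x i| ^+ 2).

(* Norms of vectors are nonnegative reals, seen in R[i]. *)
Definition opnorm (R : realType) (U V : Type) (normU : U -> R[i])
    (normV : V -> R[i]) (f : U -> V) : \bar R :=
  ereal_sup [set (complex.Re (normV (f x)))%:E | x in [set x | normU x <= 1]].

Definition commuting_strict_contractions (R : realType) (d : nat)
    (H : normedModType R[i]) (T : 'I_d -> {linear H -> H}) : Prop :=
  (forall j k x, T j (T k x) = T k (T j x)) /\
  (forall k, (opnorm (fun x : H => `|x|%R) (fun x : H => `|x|%R) (T k) < 1)%E).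

Notation multiindex d := {ffun 'I_d -> nat}.

Definition monomial (R : realType) (d : nat) (z : 'I_d -> R[i])
    (t : multiindex d) : R[i] := \prod_k z k ^+ t k.

Definition op_monomial (V : Type) (d : nat) (T : 'I_d -> V -> V)
    (t : multiindex d) : V -> V :=
  \big[(fun f g => f \o g)/id]_(k < d) iter (t k) (T k).

Definition tensor_op (R : realType) (n : nat) (V : lmodType R[i])
    (M : 'M[R[i]]_n) (S : V -> V) (x : {ffun 'I_n -> V}) : {ffun 'I_n -> V} :=
  [ffun i => \sum_j M i j *: S (x j)].

(* Sums over multi-indices are unconditional, i.e. limits of the sums over
   finite sets of multi-indices directed by inclusion. *)
Definition power_series_expansion (R : realType) (d n : nat)
    (c : multiindex d -> 'M[R[i]]_n) (F : ('I_d -> R[i]) -> 'M[R[i]]_n) :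
  Prop :=
  forall z, polydisk z -> forall i j,
    partial_sum (fun t => c t i j * monomial z t) @ totally --> (F z i j : R[i]^o).

(* L = \sum_t c_t (x) T^t, with convergence in the operator norm. *)
Definition op_power_series (R : realType) (d n : nat)
    (c : multiindex d -> 'M[R[i]]_n) (H : normedModType R[i])
    (T : 'I_d -> {linear H -> H})
    (L : {linear {ffun 'I_n -> H} -> {ffun 'I_n -> H}}) : Prop :=
  opnorm (@l2norm R H n) (@l2norm R H n)
    (fun x => partial_sum (fun t => tensor_op (c t) (op_monomial T t) x) A
              - L x)
    @[A --> totally] --> 0%E.

(* Holomorphy on the polydisk is expressed by the existence of a power series
   expansion there; its coefficients c are unique. *)
Definition Schur_Agler (R : realType) (d n : nat)
    (F : ('I_d -> R[i]) -> 'M[R[i]]_n) : Prop :=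
  exists2 c : multiindex d -> 'M[R[i]]_n, power_series_expansion c F &
    forall (H : completeNormedModType R[i]) (ip : {dot H for Num.conj})
        (T : 'I_d -> {linear H -> H}),
      is_inner_product ip -> commuting_strict_contractions T ->
      exists2 L : {linear {ffun 'I_n -> H} -> {ffun 'I_n -> H}},
        op_power_series c T L &
        (opnorm (@l2norm R H n) (@l2norm R H n) L <= 1)%E.

Definition rational_inner_Schur_Agler (R : realType) (d n : nat)
    (F : ('I_d -> R[i]) -> 'M[R[i]]_n) : Prop :=
  Schur_Agler F /\ rational_inner F.

Definition rational_Agler_decomposition (R : realType) (d n : nat)
    (F : ('I_d -> R[i]) -> 'M[R[i]]_n) : Prop :=
  exists (N : 'I_d -> nat)
         (theta : forall k, ('I_d -> R[i]) -> 'M[R[i]]_(N k, n)),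
    [/\ forall k, (0 < N k)%N,
        forall k, rational_on_polydisk (theta k)
      & forall w z, polydisk w -> polydisk z ->
          1%:M - (F w)^t* *m F z =
          \sum_k (1 - (w k)^* * z k) *: ((theta k w)^t* *m theta k z)].

Definition block_scalar_mx (R : realType) (d : nat) (m : 'I_d -> nat)
    (z : 'I_d -> R[i]) : 'M[R[i]]_(\sum_k m k) :=
  \mxdiag_k (z k)%:M.

(* The unitmx condition is automatic, A being a contraction; it records that the
   inverse in the formula is a genuine one. *)
Definition Givone_Roesser_unitary_realization (R : realType) (d n : nat)
    (F : ('I_d -> R[i]) -> 'M[R[i]]_n) : Prop :=
  exists (m : 'I_d -> nat) (A : 'M[R[i]]_(\sum_k m k))
         (B : 'M[R[i]]_(\sum_k m k, n)) (C : 'M[R[i]]_(n, \sum_k m k))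
         (D : 'M[R[i]]_n),
    block_mx A B C D \is unitarymx /\
    forall z, polydisk z ->
      let P := block_scalar_mx m z in
      1%:M - P *m A \in unitmx /\
      F z = D + C *m invmx (1%:M - P *m A) *m P *m B.

(* Main.v *)
From HB Require Import structures.
Require Import Defs.
From mathcomp Require Import all_boot all_order all_algebra.
From mathcomp Require Import ring lra.
From mathcomp Require Import finmap complex.
From mathcomp Require Import all_classical all_reals all_analysis summability.
From mathcomp Require Import -(notations) mpoly.

(* (1) => (3).  Write F = Q / p with polynomials p and Q.  Modulo monomials of
   high degree, the coordinate multiplications become commuting nilpotent
   shifts S_k on a finite-dimensional space, and p F = Q there.  Let g be the
   difference of the Gram matrices of the coefficients of p I and of Q.  A closed
   cone separation gives either psd l_0, l_1, .., l_d with
     g = l_0 + \sum_k (l_k - S_k^* l_k S_k),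
   or some G > 0 with G - S_k G S_k^* > 0 for every k (after a perturbation) and
   tr (G g) < 0.  The latter turns the S_k into strict contractions for the inner
   product of G, at which F is not contractive.  As F is inner, Q^* Q = |p|^2 on
   the torus; hence tr g = 0, which forces l_0 = 0 and makes every l_k vanish on
   the monomials of top degree.  Only there do the shifts differ from the
   coordinate multiplications, so the certificate is a kernel identity for p and Q,
   and the lurking isometry argument yields a unitary realization.

   (3) => (2') => (3) is the usual computation and the lurking isometry again.
   In (3) => (1), unitarity of the colligation bounds both the solution of the
   state equation y = A P(T) y + B x and the output C P(T) y + D x. *)

Set Implicit Arguments.
Unset Strict Implicit.
Unset Printing Implicit Defensive.

Import Order.TTheory GRing.Theory Num.Theory numFieldNormedType.Exports.
Local Open Scope classical_set_scope.
Local Open Scope sesquilinear_scope.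
Local Open Scope ring_scope.

(** * Positive semidefinite matrices and unitary colligations *)

Section ComplexMatrices.
Variable C : numClosedFieldType.

(** Modulo high degree the separation takes place in finite dimension, but two obstacles remain: the
    cone of Stein sums has to be closed, and the separating functional satisfies only weak
    inequalities, whereas the Schur-Agler class is tested on strict contractions. One matrix removes
    both: the diagonal weight K with entries N - deg solves K - S_k K S_k^* = 1 for all k at once.
    Pairing with K bounds the traces of the l_k by their Stein sum, so that a nearest point exists
    by compactness; adding a small multiple of K to G makes the inequalities strict. The equality tr
    g = 0 is Parseval's identity for Q^* Q = |p|^2, read off as one coefficient of a polynomial
    identity in place of an integral over the torus. For (3) => (1) the partial sums of the state by
    total degree are Picard iterates of the state equation, while energy conservation bounds all
    coefficients of the transfer function, which controls the stray terms of an unconditional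
    sum. *)

Lemma adjmxM m n p (A : 'M[C]_(m, n)) (B : 'M[C]_(n, p)) :
  (A *m B)^t* = B^t* *m A^t*.
Proof. by rewrite trmx_mul map_mxM. Qed.

Lemma adjmxD m n (A B : 'M[C]_(m, n)) : (A + B)^t* = A^t* + B^t*.
Proof. by rewrite linearD /= map_mxD. Qed.

Lemma adjmxN m n (A : 'M[C]_(m, n)) : (- A)^t* = - A^t*.
Proof. by rewrite linearN /= map_mxN. Qed.

Lemma adjmxB m n (A B : 'M[C]_(m, n)) : (A - B)^t* = A^t* - B^t*.
Proof. by rewrite adjmxD adjmxN. Qed.

Lemma adjmxZ m n a (A : 'M[C]_(m, n)) : (a *: A)^t* = a^* *: A^t*.
Proof. by rewrite linearZ /= map_mxZ. Qed.

Lemma adjmx1 n : (1%:M : 'M[C]_n)^t* = 1%:M.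
Proof. by rewrite trmx1 map_mx1. Qed.

Lemma adjmx0 m n : (0 : 'M[C]_(m, n))^t* = 0.
Proof. by rewrite trmx0 map_mx0. Qed.

Lemma adjmx_sum m n I (r : seq I) (P : pred I) (A : I -> 'M[C]_(m, n)) :
  (\sum_(i <- r | P i) A i)^t* = \sum_(i <- r | P i) (A i)^t*.
Proof. by apply: (big_morph (fun A => A^t*)); [exact: adjmxD|exact: adjmx0]. Qed.

Lemma adjmx_col_mx m1 m2 n (A : 'M[C]_(m1, n)) (B : 'M[C]_(m2, n)) :
  (col_mx A B)^t* = row_mx (A^t*) (B^t*).
Proof. by rewrite tr_col_mx map_row_mx. Qed.

Lemma mxtr_adjM m n (A : 'M[C]_(m, n)) : \tr (A^t* *m A) = \sum_j \sum_i `|A i j| ^+ 2.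
Proof.
apply: eq_bigr => j _; rewrite mxE; apply: eq_bigr => i _.
by rewrite !mxE normCK mulrC.
Qed.

Lemma mxtr_adjM_ge0 m n (A : 'M[C]_(m, n)) : 0 <= \tr (A^t* *m A).
Proof. by rewrite mxtr_adjM; do 2!apply: sumr_ge0 => ? _; exact: exprn_ge0. Qed.

Lemma mxtr_adjM_eq0 m n (A : 'M[C]_(m, n)) : \tr (A^t* *m A) = 0 -> A = 0.
Proof.
rewrite mxtr_adjM => A0; apply/matrixP => i j; rewrite [RHS]mxE.
have := psumr_eq0P _ A0 => /(_ _ j isT) Aj.
have {Aj}/psumr_eq0P : \sum_i `|A i j| ^+ 2 = 0.
  by apply: Aj => k _; apply: sumr_ge0 => ? _; exact: exprn_ge0.
move=> /(_ _ i isT) Aij; apply/eqP; rewrite -normr_eq0 -sqrf_eq0; apply/eqP.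
by apply: Aij => k _; exact: exprn_ge0.
Qed.

Definition sqnorm n (h : 'rV[C]_n) : C := \sum_i `|h 0 i| ^+ 2.

Lemma sqnormE n (h : 'rV[C]_n) : sqnorm h = (h *m h^t*) 0 0.
Proof. by rewrite mxE; apply: eq_bigr => i _; rewrite !mxE normCK. Qed.

Lemma sqnorm_ge0 n (h : 'rV[C]_n) : 0 <= sqnorm h.
Proof. by apply: sumr_ge0 => ? _; exact: exprn_ge0. Qed.

Lemma sqnorm_eq0 n (h : 'rV[C]_n) : sqnorm h = 0 -> h = 0.
Proof.
move=> /psumr_eq0P h0; apply/rowP => i; rewrite mxE; apply/eqP.
rewrite -normr_eq0 -sqrf_eq0; apply/eqP/h0 => // j _; exact: exprn_ge0.
Qed.

Definition psdmx n (l : 'M[C]_n) :=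
  l^t* = l /\ forall h : 'rV[C]_n, 0 <= (h *m l *m h^t*) 0 0.

Lemma psdmx_adjM m n (A : 'M[C]_(m, n)) : psdmx (A^t* *m A).
Proof.
split=> [|h]; first by rewrite adjmxM trmxCK.
have := sqnorm_ge0 (h *m A^t*).
by rewrite sqnormE adjmxM trmxCK !mulmxA.
Qed.

Lemma psdmx0 n : psdmx (0 : 'M[C]_n).
Proof. by split=> [|h]; rewrite ?adjmx0// mulmx0 mul0mx mxE. Qed.

Lemma psdmx1 n : psdmx (1%:M : 'M[C]_n).
Proof. by have := psdmx_adjM (1%:M : 'M[C]_n); rewrite adjmx1 mulmx1. Qed.

Lemma psdmxD n (A B : 'M[C]_n) : psdmx A -> psdmx B -> psdmx (A + B).
Proof.
move=> [hA pA] [hB pB]; split=> [|h]; first by rewrite adjmxD hA hB.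
by rewrite mulmxDr mulmxDl mxE addr_ge0.
Qed.

Lemma psdmxZ n a (A : 'M[C]_n) : 0 <= a -> psdmx A -> psdmx (a *: A).
Proof.
move=> a0 [hA pA]; split=> [|h]; first by rewrite adjmxZ hA geC0_conj.
by rewrite -scalemxAr -scalemxAl mxE mulr_ge0.
Qed.

Lemma psdmx_conj m n (A : 'M[C]_n) (B : 'M[C]_(m, n)) :
  psdmx A -> psdmx (B *m A *m B^t*).
Proof.
move=> [hA pA]; split=> [|h]; first by rewrite !adjmxM trmxCK hA !mulmxA.
by have := pA (h *m B); rewrite adjmxM !mulmxA.
Qed.

Lemma psdmxP n (l : 'M[C]_n) : psdmx l -> exists V : 'M[C]_n, l = V^t* *m V.
Proof.
case=> hl pl; set P := spectralmx l; set s := spectral_diag l.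
have Pu : P \is unitarymx by exact: spectral_unitarymx.
have lE : l = P^t* *m diag_mx s *m P.
  rewrite -invmx_unitary//; apply/orthomx_spectralP.
  by apply/normalmxP; rewrite hl.
have s0 i : 0 <= s 0 i.
  have := pl ((delta_mx 0 i : 'rV_n) *m P).
  rewrite lE adjmxM !mulmxA.
  have PP : P *m P^t* = 1%:M by apply/unitarymxP.
  rewrite -(mulmxA _ P (P^t*)) PP mulmx1 -(mulmxA _ P (P^t*)) PP mulmx1.
  rewrite -rowE mxE (bigD1 i)//= big1 ?addr0 => [|j ji].
    by rewrite !mxE !eqxx/= mulr1n rmorph1 mulr1.
  by rewrite !mxE eq_sym (negPf ji) mulr0n mul0r.
exists (diag_mx (map_mx sqrtC s) *m P).
rewrite adjmxM {1}lE -!mulmxA; congr (_ *m _); rewrite !mulmxA; congr (_ *m _).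
apply/matrixP => i j; rewrite [RHS]mxE (bigD1 i)//= big1 ?addr0 => [|k ki].
  rewrite !mxE eqxx; case: eqVneq => [->|_]; last by rewrite !mulr0n mulr0.
  rewrite !mulr1n geC0_conj ?sqrtC_ge0// -expr2 sqrtCK//.
by rewrite !mxE (negPf ki) mulr0n rmorph0 mul0r.
Qed.

Lemma psdmx_tr_ge0 n (l : 'M[C]_n) : psdmx l -> 0 <= \tr l.
Proof. by move=> /psdmxP[V ->]; exact: mxtr_adjM_ge0. Qed.

Lemma psdmx_trM_ge0 n (A l : 'M[C]_n) : psdmx A -> psdmx l -> 0 <= \tr (A *m l).
Proof.
move=> pA /psdmxP[V ->]; rewrite mulmxA mxtrace_mulC mulmxA.
by apply/psdmx_tr_ge0/psdmx_conj.
Qed.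

(** In a factorization l = V^* V an entry is an inner product of two columns of [V], bounded by half
    the sum of their squared norms. The trace thus controls the whole matrix, which later gives
    compactness. *)
Lemma psdmx_norm_le_tr n (l : 'M[C]_n) a b : psdmx l -> `|l a b| <= \tr l.
Proof.
move=> /psdmxP[V ->]; rewrite mxtr_adjM mxE.
apply: le_trans (ler_norm_sum _ _ _) _.
have ns j : \sum_i `|V i j| ^+ 2 <= \sum_j \sum_i `|V i j| ^+ 2.
  rewrite [leRHS](bigD1 j)//= lerDl; apply: sumr_ge0 => k _.
  by apply: sumr_ge0 => i _; exact: exprn_ge0.
have h : (\sum_i `|V i a| ^+ 2 + \sum_i `|V i b| ^+ 2) / 2%:R <=
       \sum_j \sum_i `|V i j| ^+ 2.
  by rewrite ler_pdivrMr ?ltr0n// mulr_natr mulr2n lerD.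
apply: (le_trans _ h); rewrite ler_pdivlMr ?ltr0n// -big_split mulr_suml.
apply: ler_sum => i _.
rewrite !mxE normrM norm_conjC.
rewrite -subr_ge0 (_ : _ - _ = (`|V i a| - `|V i b|) ^+ 2); last by rewrite /=; ring.
by rewrite real_exprn_even_ge0 ?realB ?normr_real.
Qed.

End ComplexMatrices.

(** * Lurking isometry: unitary matrices from equal Gram matrices *)

Section Lurking.
Variable C : numClosedFieldType.

Lemma mulmx_adj_eq0 m n (A : 'M[C]_(m, n)) : A *m A^t* = 0 -> A = 0.
Proof.
move=> A0; rewrite -[A]trmxCK; have -> : A^t* = 0; last exact: adjmx0.
by apply: mxtr_adjM_eq0; rewrite trmxCK A0 mxtrace0.
Qed.

Lemma unitarymx_adjK p n (M : 'M[C]_(p, n)) :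
  p = n -> M \is unitarymx -> M^t* *m M = 1%:M.
Proof. by move=> pn; subst p => /unitarymxP /mulmx1C. Qed.

(** Gram-Schmidt in the orthogonal complement of the rows. The height [q] is a variable with an
    equation because it has to be replaced by the rank of that complement, which equals [n - k] only
    propositionally. *)
Lemma orthonormal_complete k n (A : 'M[C]_(k, n)) q :
  A *m A^t* = 1%:M -> q = (n - k)%N ->
  exists B : 'M[C]_(q, n),
    [/\ B *m B^t* = 1%:M, A *m B^t* = 0 & A^t* *m A + B^t* *m B = 1%:M].
Proof.
move=> AA qE; have uA : A \is unitarymx by apply/unitarymxP.
have rA := mxrank_unitary uA.
have kn : (k <= n)%N by rewrite -rA rank_leq_col.
set O := orthomx Num.conj (mx_of_hermitian (hermitian1mx _)) A.
have rO : q = \rank O by rewrite rank_ortho rA.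
clear qE; move: rO => qE; subst q.
have BB : schmidt (row_base O) \is unitarymx.
  by rewrite schmidt_unitarymx// rank_leq_col.
have BA : schmidt (row_base O) *m A^t* = 0.
  apply/orthomx1P; rewrite eqmx_schmidt_free ?row_base_free//.
  by rewrite eq_row_base.
have AB : A *m (schmidt (row_base O))^t* = 0.
  by rewrite -[LHS]trmxCK adjmxM trmxCK BA adjmx0.
exists (schmidt (row_base O)); split=> //; first exact/unitarymxP.
have U : col_mx A (schmidt (row_base O)) \is unitarymx.
  apply/unitarymxP; rewrite adjmx_col_mx mul_col_row AA AB (unitarymxP BB).
  by rewrite BA -scalar_mx_block.
have := unitarymx_adjK _ U; rewrite adjmx_col_mx mul_row_col; apply.
by rewrite rank_ortho rA subnKC.
Qed.

(** The same linear combinations reduce both families of rows to families with a common invertible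
    Gram matrix. Normalizing by a factor of it gives two orthonormal families; completing both to
    bases gives the unitary. *)
Lemma gram_unitary r n (A B : 'M[C]_(r, n)) :
  A *m A^t* = B *m B^t* -> exists2 U : 'M[C]_n, U \is unitarymx & A *m U = B.
Proof.
move=> AB.
have [k [A0 [freeA0 [L AE] [K A0E]]]] : exists k (A0 : 'M[C]_(k, n)),
    [/\ row_free A0, exists L, A = L *m A0 & exists K, A0 = K *m A].
  exists (\rank A), (row_base A); split; first exact: row_base_free.
    by apply/submxP; rewrite eq_row_base.
  by apply/submxP; rewrite eq_row_base.
pose B0 := K *m B.
(* [L *m K - 1%:M] annihilates [A]; equality of the Gram matrices makes it annihilate [B] as
   well. *)
have BE : B = L *m B0.
  apply/eqP; rewrite eq_sym -subr_eq0; apply/eqP/mulmx_adj_eq0.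
  have -> : L *m B0 - B = (L *m K - 1%:M) *m B.
    by rewrite mulmxBl mul1mx /B0 mulmxA.
  have LKA : (L *m K - 1%:M) *m A = 0.
    by rewrite mulmxBl mul1mx -mulmxA -A0E -AE subrr.
  by rewrite adjmxM !mulmxA -(mulmxA _ B) -AB !mulmxA LKA !mul0mx.
have G0 : A0 *m A0^t* = B0 *m B0^t*.
  by rewrite /B0 {1 2}A0E !adjmxM !mulmxA -(mulmxA K A) AB !mulmxA.
have [V VE] : exists V : 'M[C]_k, A0 *m A0^t* = V^t* *m V.
  by apply: psdmxP; have := psdmx_adjM (A0^t*); rewrite trmxCK.
have Vu : V^t* \in unitmx.
  suff : V^t* *m V \in unitmx by rewrite unitmx_mul => /andP[].
  rewrite -VE -row_free_unit -kermx_eq0; apply/eqP.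
  set u := kermx _.
  have uA : u *m A0 = 0.
    by apply: mulmx_adj_eq0; rewrite adjmxM mulmxA -(mulmxA u) mulmx_ker mul0mx.
  by apply/eqP; rewrite -(mulmx_free_eq0 _ freeA0) uA.
pose A1 := invmx (V^t*) *m A0; pose B1 := invmx (V^t*) *m B0.
have VV : V *m (invmx (V^t*))^t* = 1%:M.
  by rewrite -{1}[V]trmxCK -adjmxM mulVmx// adjmx1.
have A1A1 : A1 *m A1^t* = 1%:M.
  by rewrite adjmxM !mulmxA -(mulmxA _ A0) VE !mulmxA mulVmx// mul1mx VV.
have B1B1 : B1 *m B1^t* = 1%:M.
  by rewrite adjmxM !mulmxA -(mulmxA _ B0) -G0 VE !mulmxA mulVmx// mul1mx VV.
have A01 : A0 = V^t* *m A1 by rewrite mulmxA mulmxV// mul1mx.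
have B01 : B0 = V^t* *m B1 by rewrite [RHS]mulmxA mulmxV// mul1mx.
clearbody A1 B1.
have [A2 [A22 A12 AA]] := orthonormal_complete A1A1 erefl.
have [B2 [B22 B12 BB]] := orthonormal_complete B1B1 erefl.
exists (A1^t* *m B1 + A2^t* *m B2).
  apply/unitarymxP; rewrite adjmxD !adjmxM !trmxCK mulmxDl !mulmxDr !mulmxA.
  rewrite -!(mulmxA _ B1) -!(mulmxA _ B2) B1B1 B22 B12.
  have -> : B2 *m B1^t* = 0 by rewrite -[LHS]trmxCK adjmxM trmxCK B12 adjmx0.
  by rewrite !mulmx1 !mulmx0 !mul0mx addr0 add0r.
rewrite AE A01 BE B01 mulmxDr !mulmxA -!(mulmxA _ A1) A1A1 A12.
by rewrite mulmx1 mulmx0 mul0mx addr0.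
Qed.

Definition row_stack X n (a : X -> 'rV[C]_n) r (s : 'I_r -> X) : 'M[C]_(r, n) :=
  \matrix_(i < r) a (s i).

(* A finite stack of maximal rank determines the unitary, and equality of Gram
   matrices makes it work for all the other vectors. *)
Lemma lurking_unitary X n (a b : X -> 'rV[C]_n) :
  (forall x y, a x *m (a y)^t* = b x *m (b y)^t*) ->
  exists2 U : 'M[C]_n, U \is unitarymx & forall x, a x *m U = b x.
Proof.
move=> ab.
pose P k := `[< exists r (s : 'I_r -> X), \rank (row_stack a s) = k >].
have P0 : exists k, P k.
  by exists (\rank (@row_stack _ _ a 0 (fun i => match notF (ltn_ord i) with end)));
     apply/asboolP; do 2!eexists.
have Pn k : P k -> (k <= n)%N by move=> /asboolP[r [s <-]]; exact: rank_leq_col.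
case: (ex_maxnP P0 Pn) => k /asboolP[r [s rs]] kmax.
have mulE (c : X -> 'rV[C]_n) p (t : 'I_p -> X) q (u : 'I_q -> X) i j :
    (row_stack c t *m (row_stack c u)^t*) i j = (c (t i) *m (c (u j))^t*) 0 0.
  by rewrite !mxE; apply: eq_bigr => l _; rewrite !mxE.
have [|U uU UE] := @gram_unitary r n (row_stack a s) (row_stack b s).
  by apply/matrixP => i j; rewrite !mulE ab.
exists U => // x.
have rowE (c : X -> 'rV[C]_n) : row_stack c (fun _ : 'I_1 => x) = c x.
  by apply/rowP => j; rewrite !mxE.
(* Adding [x] cannot raise the maximal rank, so [a x] is a combination of the stack. *)
have : (a x <= row_stack a s)%MS.
  pose s' (i : 'I_(1 + r)) := match fintype.split i with inl _ => x | inr j => s j end.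
  have sE : row_stack a s' = col_mx (a x) (row_stack a s).
    apply/row_matrixP => i; rewrite rowK /s'.
    case: splitP => j ij; [rewrite (_ : i = lshift r j); last exact: val_inj|
      rewrite (_ : i = rshift 1 j); last exact: val_inj].
      by rewrite rowKu [j]ord1 row_id.
    by rewrite rowKd rowK.
  have : (\rank (row_stack a s') <= k)%N.
    by apply: kmax; apply/asboolP; exists (1 + r)%N, s'.
  rewrite sE -rs => rk.
  have sub : (row_stack a s <= col_mx (a x) (row_stack a s))%MS.
    by rewrite -addsmxE addsmxSr.
  have [_ rankE] := mxrank_leqif_sup sub.
  have : (col_mx (a x) (row_stack a s) <= row_stack a s)%MS.
    by rewrite -rankE eqn_leq rk mxrankS.
  by rewrite -addsmxE addsmx_sub => /andP[].
move=> /submxP[c ac].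
(* A second unitary, for the stack enlarged by [x], shows that [b x] is the same combination of the
   stack of [b]; hence the first one sends [a x] to [b x]. *)
have [|V _] := @gram_unitary _ n (col_mx (a x) (row_stack a s))
                                (col_mx (b x) (row_stack b s)).
  rewrite !adjmx_col_mx !mul_col_row -!rowE.
  by congr block_mx; apply/matrixP => i j; rewrite !mulE ab.
rewrite mul_col_mx => /eq_col_mx[<- VE].
by rewrite ac -!mulmxA UE VE.
Qed.

End Lurking.

Section Colligations.
Variable C : numClosedFieldType.

(** Points and column numbers together index the row vectors, and adjoints pass between rows and
    columns. *)
Lemma lurking_unitary_col X N n (a b : X -> 'M[C]_(N, n)) :
  (forall x y, (a x)^t* *m a y = (b x)^t* *m b y) ->
  exists2 U : 'M[C]_N, U \is unitarymx & forall x, U *m a x = b x.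
Proof.
move=> ab.
have [|U uU UE] := @lurking_unitary C (X * 'I_n) N
    (fun xi => row xi.2 ((a xi.1)^t*)) (fun xi => row xi.2 ((b xi.1)^t*)).
  move=> [x i] [y j] /=.
  have rE (c d : X -> 'M[C]_(N, n)) : row i ((c x)^t*) *m (row j ((d y)^t*))^t* =
      const_mx (((c x)^t* *m d y) i j).
    apply/matrixP => k l; rewrite !mxE; apply: eq_bigr => s _.
    by rewrite !mxE conjCK.
  by rewrite !rE ab.
exists (U^t*); first by rewrite trmxC_unitary.
move=> x; rewrite -[LHS]trmxCK adjmxM trmxCK.
rewrite -[RHS]trmxCK; congr (_^t*); apply/row_matrixP => i.
by rewrite -(UE (x, i)) /= row_mul.
Qed.

Section UnitaryBlocks.
Variables (m n : nat) (A : 'M[C]_m) (B : 'M[C]_(m, n)).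
Variables (C0 : 'M[C]_(n, m)) (D : 'M[C]_n).
Hypothesis unitaryU : block_mx A B C0 D \is unitarymx.

Lemma unitary_block_adj :
  (block_mx A B C0 D)^t* *m block_mx A B C0 D = 1%:M.
Proof. exact: unitarymx_adjK. Qed.

Lemma unitary_block_row : A *m A^t* + B *m B^t* = 1%:M.
Proof.
have := unitarymxP unitaryU.
rewrite tr_block_mx map_block_mx mulmx_block scalar_mx_block.
by move=> /eq_block_mx[-> _ _ _].
Qed.

(** A row [v] of the kernel satisfies v = v diag(s) A. Since A A^* = 1 - B B^*, the norm of [v] is
    at most that of v diag(s), which is strictly smaller unless [v] vanishes. *)
Lemma resolvent_unit (s : 'rV[C]_m) :
  (forall i, `|s 0 i| < 1) -> 1%:M - diag_mx s *m A \in unitmx.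
Proof.
move=> s1; rewrite -row_free_unit -kermx_eq0; apply/eqP.
set K := kermx _; apply/row_matrixP => r; rewrite row0.
have : row r K *m (1%:M - diag_mx s *m A) = 0 by rewrite -row_mul mulmx_ker row0.
move: (row r K) => v; rewrite mulmxBr mulmx1 => /eqP; rewrite subr_eq0 mulmxA.
move=> /eqP vE; have : sqnorm v <= sqnorm (v *m diag_mx s).
  rewrite {1}vE [leLHS]sqnormE adjmxM mulmxA -(mulmxA _ A).
  rewrite (_ : A *m A^t* = 1%:M - B *m B^t*); last first.
    by rewrite -unitary_block_row addrK.
  rewrite mulmxBr mulmx1 mulmxBl !mulmxA [leLHS]mxE -sqnormE gerDl mxE oppr_le0.
  rewrite -[_ *m B *m _ *m _]mulmxA -adjmxM -sqnormE; exact: sqnorm_ge0.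
move=> h; have {h} : \sum_i (1 - `|s 0 i| ^+ 2) * `|v 0 i| ^+ 2 <= 0.
  under eq_bigr do rewrite mulrBl mul1r; rewrite sumrB subr_le0.
  apply: le_trans h _; rewrite /sqnorm ler_sum// => i _.
  by rewrite mul_mx_diag mxE normrM exprMn mulrC.
have c0 i : 0 < 1 - `|s 0 i| ^+ 2 by rewrite subr_gt0 expr_lt1.
have t0 i : 0 <= (1 - `|s 0 i| ^+ 2) * `|v 0 i| ^+ 2.
  by rewrite mulr_ge0 ?exprn_ge0// ltW.
move=> le0; apply/rowP => i; rewrite mxE; apply/eqP.
have sum0 : \sum_i (1 - `|s 0 i| ^+ 2) * `|v 0 i| ^+ 2 = 0.
  by apply/eqP; rewrite eq_le le0 sumr_ge0.
have /eqP : (1 - `|s 0 i| ^+ 2) * `|v 0 i| ^+ 2 = 0.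
  exact: (psumr_eq0P _ sum0).
by rewrite mulf_eq0 gt_eqF//= sqrf_eq0 normr_eq0.
Qed.

End UnitaryBlocks.
End Colligations.

(** * Strict contractions from Stein inequalities *)

Section Contractions.
Variable C : numClosedFieldType.

Lemma dotmx_sumE m (x y : 'rV[C]_m) : dotmx x y = \sum_i x 0 i * (y 0 i)^*.
Proof. by rewrite dotmxE mxE; apply: eq_bigr => i _; rewrite !mxE. Qed.

Lemma sqnorm_dotmx m (x : 'rV[C]_m) : sqnorm x = dotmx x x.
Proof. by rewrite dotmxE sqnormE. Qed.

Lemma sqnormM_le m n (h : 'rV[C]_m) (W : 'M[C]_(m, n)) :
  sqnorm (h *m W) <= sqnorm h * \tr (W^t* *m W).
Proof.
rewrite mxtr_adjM mulr_sumr; apply: ler_sum => j _.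
set w : 'rV_m := (col j W)^t*.
have CS : `|dotmx h w| ^+ 2 <= dotmx h h * dotmx w w.
  exact: (CauchySchwarz (@dotmx C m) h w).1.
have -> : (h *m W) 0 j = dotmx h w.
  by rewrite dotmx_sumE mxE; apply: eq_bigr => i _; rewrite !mxE conjCK.
have -> : \sum_i `|W i j| ^+ 2 = dotmx w w.
  by rewrite -sqnorm_dotmx; apply: eq_bigr => i _; rewrite !mxE norm_conjC.
by rewrite sqnorm_dotmx.
Qed.

(** The Stein inequality gains e |h|^2, and |h W|^2 is at most |h|^2 times the squared Frobenius
    norm of [W]. Adding [e] to the denominator keeps it positive when [W] is zero. *)
Lemma stein_contraction m (S W : 'M[C]_m) (e : C) : 0 < e ->
  psdmx (W *m W^t* - S *m (W *m W^t*) *m S^t* - e%:M) ->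
  forall h : 'rV[C]_m, sqnorm (h *m S *m W) <=
    (1 - e / (\tr (W^t* *m W) + e)) * sqnorm (h *m W).
Proof.
move=> e0 [_ pd] h; set k := _ + e.
have tr0 : 0 <= \tr (W^t* *m W) by rewrite mxtr_adjM_ge0.
have k0 : 0 < k by rewrite ltr_wpDl.
have := pd h; rewrite !mulmxBr !mulmxBl mxE [X in X + _]mxE.
have -> : (h *m (W *m W^t*) *m h^t*) 0 0 = sqnorm (h *m W).
  by rewrite sqnormE adjmxM !mulmxA.
rewrite [X in _ + X + _]mxE [X in _ + X]mxE.
have -> : (h *m (S *m (W *m W^t*) *m S^t*) *m h^t*) 0 0 = sqnorm (h *m S *m W).
  by rewrite sqnormE !adjmxM !mulmxA.
rewrite mul_mx_scalar -scalemxAl mxE -sqnormE -addrA -opprD subr_ge0 => le1.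
rewrite mulrBl mul1r lerBrDr; apply: le_trans le1; rewrite lerD2l.
rewrite -mulrA ler_wpM2l ?(ltW e0)// [leLHS]mulrC ler_pdivrMr//.
apply: le_trans (sqnormM_le _ _) _.
by rewrite ler_wpM2l ?sqnorm_ge0// lerDl ltW.
Qed.

Lemma psdmx_shift_unit m (W : 'M[C]_m) (e : C) : 0 < e ->
  psdmx (W *m W^t* - e%:M) -> W \in unitmx.
Proof.
move=> e0 [_ pd]; rewrite -row_free_unit -kermx_eq0; apply/eqP/row_matrixP => i.
have := pd (row i (kermx W)); rewrite mulmxBr mulmxBl !mulmxA -row_mul mulmx_ker.
rewrite row0 !mul0mx sub0r mul_mx_scalar -scalemxAl mxE [X in - X]mxE -sqnormE.
rewrite oppr_ge0 pmulr_rle0// => le0; apply: sqnorm_eq0.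
by apply: le_anti; rewrite le0 sqnorm_ge0.
Qed.

Lemma psdmx_diag m (r : 'rV[C]_m) : (forall i, 0 <= r 0 i) -> psdmx (diag_mx r).
Proof.
move=> r0; split=> [|h].
  apply/matrixP => i j; rewrite !mxE eq_sym; case: eqVneq => [->|_].
    by rewrite !mulr1n geC0_conj.
  by rewrite !mulr0n rmorph0.
rewrite mul_mx_diag mxE; apply: sumr_ge0 => i _.
by rewrite !mxE mulrAC mulr_ge0// mul_conjC_ge0.
Qed.

Lemma sum_sqnorm_row m n p (P : 'M[C]_(n, m)) (W : 'M[C]_(m, p)) :
  \sum_i sqnorm (row i P *m W) = \tr (W *m W^t* *m (P^t* *m P)).
Proof.
rewrite mulmxA mxtrace_mulC !mulmxA -(mulmxA _ (W^t*)) -adjmxM.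
set B := P *m W.
rewrite -{1}(trmxCK B) mxtr_adjM; apply: eq_bigr => i _.
rewrite -row_mul; apply: eq_bigr => j _.
by rewrite !mxE norm_conjC.
Qed.

End Contractions.

(** * The dual functional as an inner product *)

Section DualFunctional.
Variable C : numClosedFieldType.

(** The hypothesis compares unit balls only, but for every multiple of the pair, so the scaling can
    be chosen to place 1 between the two sums. The sum for [P] may be zero, which excludes
    normalizing by it. *)
Lemma mxtr_gram_ge0 m n p (P Q : 'M[C]_(n, m)) (W : 'M[C]_(m, p)) :
  (forall a : C, \sum_i sqnorm (row i (a *: P) *m W) <= 1 ->
    \sum_i sqnorm (row i (a *: Q) *m W) <= 1) ->
  0 <= \tr (W *m W^t* *m (P^t* *m P - Q^t* *m Q)).
Proof.
move=> PQ; rewrite mulmxBr raddfB /= -!sum_sqnorm_row subr_ge0.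
set X := \sum_i sqnorm (row i P *m W); set Y := \sum_i _.
have X0 : 0 <= X by apply: sumr_ge0 => i _; exact: sqnorm_ge0.
have Y0 : 0 <= Y by apply: sumr_ge0 => i _; exact: sqnorm_ge0.
rewrite real_leNgt ?ger0_real//; apply/negP => XY.
have XY0 : 0 < X + Y by rewrite ltr_wpDl// (le_lt_trans X0).
(* As X < Y, this gives b X < 1 < b Y. *)
pose b := 2%:R / (X + Y); have b0 : 0 < b by rewrite divr_gt0// ltr0n.
pose a := sqrtC b; have a2 : `|a| ^+ 2 = b by rewrite ger0_norm ?sqrtC_ge0 ?(ltW b0)// sqrtCK.
have sqZ (B : 'M[C]_(n, m)) :
    \sum_i sqnorm (row i (a *: B) *m W) = b * \sum_i sqnorm (row i B *m W).
  rewrite mulr_sumr; apply: eq_bigr => i _; rewrite linearZ -scalemxAl.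
  by rewrite /sqnorm mulr_sumr; apply: eq_bigr => j _; rewrite mxE normrM exprMn a2.
have bXE Z : (b * Z <= 1) = (Z + Z <= X + Y).
  by rewrite /b mulrAC ler_pdivrMr// mul1r mulr_natl mulr2n.
have := PQ a; rewrite !sqZ -/X -/Y !bXE lerD2l lerD2r.
by move=> /(_ (ltW XY)) /(lt_le_trans XY); rewrite ltxx.
Qed.

Lemma mxtr_herm_real n (A B : 'M[C]_n) :
  A^t* = A -> B^t* = B -> \tr (A *m B) \is Num.real.
Proof.
move=> hA hB; rewrite CrealE; apply/eqP.
rewrite -[in RHS]hA -[in RHS]hB -adjmxM mxtrace_mulC /mxtrace rmorph_sum.
by apply: eq_bigr => i _; rewrite [RHS]mxE [in RHS]mxE.
Qed.

(** [S i0 = 0] turns the conditions at [i0] into K >= 1 and G >= 0. Adding a small multiple of [K]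
    to [G] makes all inequalities strict without losing the sign of the trace. *)
Lemma dual_perturbation m (I : Type) (S : I -> 'M[C]_m) (i0 : I) (K G g : 'M[C]_m) :
  S i0 = 0 -> g^t* = g ->
  (forall i, psdmx (K - S i *m K *m (S i)^t* - 1%:M)) ->
  (forall i, psdmx (G - S i *m G *m (S i)^t*)) -> \tr (G *m g) < 0 ->
  exists W e, [/\ 0 < e, W \in unitmx,
    forall i, psdmx (W *m W^t* - S i *m (W *m W^t*) *m (S i)^t* - e%:M) &
    \tr (W *m W^t* *m g) < 0].
Proof.
move=> S0 gh Kpsd Gpsd Gg.
pose t0 := `|\tr (K *m g)|.
(* This keeps e |tr (K g)| below half of - tr (G g); the summand 1 excludes a division by zero. *)
pose e := - \tr (G *m g) / (2%:R * (t0 + 1)).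
have t1 : 0 < t0 + 1 by rewrite ltr_wpDl// normr_ge0.
have e0 : 0 < e by rewrite divr_gt0 ?oppr_gt0// mulr_gt0// ltr0n.
pose G' := G + e *: K.
have G'psd i : psdmx (G' - S i *m G' *m (S i)^t* - e%:M).
  have -> : G' - S i *m G' *m (S i)^t* - e%:M =
     (G - S i *m G *m (S i)^t*) + e *: (K - S i *m K *m (S i)^t* - 1%:M).
    rewrite /G' mulmxDr mulmxDl -scalemxAr -scalemxAl !scalerBr scalemx1.
    by rewrite opprD addrACA !addrA.
  apply: psdmxD; first exact: Gpsd.
  by apply: psdmxZ; [exact: ltW|exact: Kpsd].
have G'e : psdmx (G' - e%:M) by have := G'psd i0; rewrite S0 !mul0mx subr0.
have [V VE] : exists V : 'M[C]_m, G' = V^t* *m V.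
  apply: psdmxP; rewrite -[G'](subrK e%:M); apply: psdmxD => //.
  by rewrite -scalemx1; apply: psdmxZ; [exact: ltW|exact: psdmx1].
have WE : V^t* *m (V^t*)^t* = G' by rewrite trmxCK VE.
exists (V^t*), e; rewrite WE; split=> //.
  by apply: (psdmx_shift_unit e0); rewrite WE.
rewrite mulmxDl -scalemxAl raddfD /= linearZ /=.
set tg := \tr (G *m g); set x := e * _.
have tg0 : 0 < - tg by rewrite oppr_gt0.
have : `|x| < - tg.
  rewrite normrM (gtr0_norm e0) -/t0 /e mulrAC ltr_pdivrMr ?mulr_gt0 ?ltr0n//.
  rewrite ltr_pM2l// mulr_natl mulr2n (@lt_le_trans _ _ (t0 + 1)) ?ltrDl//.
  by rewrite lerDl ltW.
have xreal : x \is Num.real.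
  apply: realM; first exact: gtr0_real.
  apply: mxtr_herm_real => //.
  have [+ _] := Kpsd i0; rewrite S0 !mul0mx subr0 adjmxB adjmx1.
  by move=> /(congr1 (+%R^~ 1%:M)); rewrite !subrK.
move=> /(le_lt_trans (real_ler_norm xreal)).
by rewrite -subr_gt0 -opprD oppr_gt0.
Qed.

End DualFunctional.

Section RationalGram.
Variable C : numClosedFieldType.

Lemma gram_rescale n (a b : C) (Q T : 'M[C]_n) : b != 0 ->
  (forall i j, Q i j * b = T i j * a) -> T^t* *m T = (b^* * b)%:M ->
  Q^t* *m Q = (a^* * a)%:M.
Proof.
move=> b0 QT TT; have -> : Q = (a / b) *: T.
  by apply/matrixP => i j; rewrite mxE mulrAC [a * _]mulrC -QT mulfK.
rewrite adjmxZ -scalemxAl -scalemxAr scalerA TT scale_scalar_mx; congr (_%:M).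
by rewrite rmorphM fmorphV; field; rewrite b0 conjC_eq0.
Qed.

Lemma unit_gram_unitary n (c : C) (Q W : 'M[C]_n) : c != 0 ->
  (forall i j, c * W i j = Q i j) -> Q^t* *m Q = (c^* * c)%:M -> W \is unitarymx.
Proof.
move=> c0 WQ QQ; apply/unitarymxP/mulmx1C.
have := @gram_rescale n 1 c W Q c0 _ QQ; rewrite conjC1 mulr1; apply=> i j.
by rewrite mulr1 mulrC WQ.
Qed.

Lemma unitary_gram n (c : C) (Q W : 'M[C]_n) :
  (forall i j, c * W i j = Q i j) -> W \is unitarymx -> Q^t* *m Q = (c^* * c)%:M.
Proof.
move=> WQ /unitarymxP/mulmx1C WW.
apply: (@gram_rescale n c 1 Q W (oner_neq0 _)); last by rewrite WW conjC1 mulr1.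
by move=> i j; rewrite mulr1 mulrC WQ.
Qed.

Lemma normalized_kernel n (a b : C) (T T' : 'M[C]_n) : a != 0 -> b != 0 ->
  1%:M - (a^-1 *: T)^t* *m (b^-1 *: T') =
  (a^* * b)^-1 *: ((a^* * b)%:M - T^t* *m T').
Proof.
move=> a0 b0; have a'0 : a^* != 0 by rewrite conjC_eq0.
rewrite scalerBr scale_scalar_mx mulVf ?mulf_neq0//; congr (_ - _).
by rewrite adjmxZ -scalemxAl -scalemxAr scalerA fmorphV invfM.
Qed.

End RationalGram.

(** * Separation of closed cones *)

Section ConeSeparation.
Variable R : realType.

Lemma linear_form_continuous k (f : {linear 'rV[R]_k -> R}) : continuous f.
Proof.
have fE : f = (fun x => \sum_i x 0 i * f (delta_mx 0 i)) :> (_ -> R).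
  apply/funext => x; rewrite {1}[x]row_sum_delta linear_sum.
  by apply: eq_bigr => i _; rewrite linearZ.
rewrite fE; apply: continuous_big => [|i _ x]; first exact: add_continuous.
apply: (@continuousM R _ (fun y : 'rV[R]_k => y 0 i) (fun=> f (delta_mx 0 i)) x).
  exact: coord_continuous.
exact: cst_continuous.
Qed.

Lemma le_mx_norm k (x : 'rV[R]_k) j : `|x 0 j| <= `|x|.
Proof.
rewrite [leRHS]/Num.norm /= mx_normrE; apply/bigmax_geP; right => /=.
by exists (0, j).
Qed.

Lemma mx_norm_le k (x : 'rV[R]_k) c :
  0 <= c -> (forall j, `|x 0 j| <= c) -> `|x| <= c.
Proof.
move=> c0 xc; rewrite [leLHS]/Num.norm /= mx_normrE; apply/bigmax_leP; split=> //=.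
by move=> [i j] _ /=; rewrite (ord1 i).
Qed.

(** A point of [K] whose image is nearest to [b] exists, since the bound of |x| by |f x| makes
    sublevel sets of the distance compact. The residual f x0 - b is nonnegative on f(K) and
    orthogonal to f x0, so it separates unless it is zero. *)
Lemma closed_cone_separation k l (f : {linear 'rV[R]_k -> 'rV[R]_l})
    (K : set 'rV[R]_k) (b : 'rV[R]_l) (c : R) :
    closed K -> K 0 ->
    (forall x y, K x -> K y -> K (x + y)) ->
    (forall a x, 0 <= a -> K x -> K (a *: x)) ->
    (forall x, K x -> `|x| <= c * `|f x|) ->
  (exists2 x, K x & f x = b) \/
  (exists y : 'I_l -> R, (forall x, K x -> 0 <= \sum_j y j * f x 0 j) /\
     \sum_j y j * b 0 j < 0).
Proof.
move=> Kcl K0 KD KZ Kc.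
pose h x := \sum_j (f x 0 j - b 0 j) ^+ 2.
have fj_cont j : continuous (fun x => f x 0 j).
  have fjl : linear (fun x => f x 0 j : R).
    by move=> a x y; rewrite linearP !mxE.
  pose g : {linear 'rV[R]_k -> R} := HB.pack (fun x => f x 0 j)
    (GRing.isLinear.Build _ _ _ _ _ fjl).
  exact: (@linear_form_continuous _ g).
have h_cont : continuous h.
  apply: continuous_big => [|j _ x]; first exact: add_continuous.
  pose u x := f x 0 j - b 0 j; have u_cont : {for x, continuous u}.
    by apply: continuousB; [exact: fj_cont|exact: cst_continuous].
  exact: (continuousM u_cont u_cont).
have h_ge0 x : 0 <= h x by apply: sumr_ge0 => j _; exact: sqr_ge0.
pose S := K `&` [set x | h x <= h 0].
have S0 : S !=set0 by exists 0; split => /=.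
have Scl : closed S.
  apply: closedI => //; apply: (closed_comp (f := h) (D := [set y | y <= h 0])).
    by move=> x _; exact: h_cont.
  exact: closed_le.
have Sbd : bounded_set S.
  (* On [S] every entry u of f x - b has u^2 <= h 0, and |u| <= 1 + u^2 gives |f x| <= |b| + 1 + h
     0. *)
  pose M := `|c| * (`|b| + 1 + h 0).
  exists M; split; first exact: num_real.
  move=> M' MM' x [Kx /= hx]; apply: le_trans (ltW MM').
  apply: (le_trans (Kc x Kx)); apply: (@le_trans _ _ (`|c| * `|f x|)).
    by rewrite ler_wpM2r// ler_norm.
  rewrite ler_wpM2l//; apply: mx_norm_le => [|j].
    by rewrite !addr_ge0.
  have -> : f x 0 j = b 0 j + (f x 0 j - b 0 j) by rewrite addrCA subrr addr0.
  apply: (le_trans (ler_normD _ _)); rewrite -addrA lerD ?le_mx_norm//.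
  have : (f x 0 j - b 0 j) ^+ 2 <= h 0.
    apply: le_trans hx; rewrite /h (bigD1 j)//= lerDl.
    by apply: sumr_ge0 => i _; exact: sqr_ge0.
  move: (f x 0 j - b 0 j) => u; rewrite -real_normK ?num_real//.
  have := normr_ge0 u; move: `|u| => v v0 vh.
  have [v1|v1] := lerP v 1; first by rewrite (le_trans v1)// lerDl.
  by rewrite (@le_trans _ _ (v ^+ 2)) ?lerDr ?expr2 ?ler_peMr ?(ltW v1)//; nra.
have [x0 /set_mem [Kx0 hx0] xmin] := compact_EVT_min S0
  (bounded_closed_compact Sbd Scl) (continuous_subspaceT h_cont).
have {}xmin x : K x -> h x0 <= h x.
  move=> Kx; have [hx|hx] := lerP (h x) (h 0).
    by apply: xmin; rewrite inE; split.
  by rewrite (le_trans hx0)// ltW.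
pose y j := f x0 0 j - b 0 j.
have dirE x t : h (x0 + t *: x) = h x0 + t * (2 * \sum_j y j * f x 0 j) +
     t ^+ 2 * \sum_j (f x 0 j) ^+ 2.
  rewrite /h !mulr_sumr -!big_split; apply: eq_bigr => j _ /=.
  by rewrite /y linearD linearZ/= !mxE; ring.
(* First-order condition at the minimum, from the right. *)
have quad (A B : R) (e : R) : 0 < e ->
    (forall t, 0 < t -> t <= e -> 0 <= t * A + t ^+ 2 * B) -> 0 <= A.
  move=> e0 AB; rewrite leNgt; apply/negP => A0.
  pose t := Num.min e (- A / (2 * (`|B| + 1))).
  have B1 : 0 < `|B| + 1 by rewrite ltr_wpDl.
  have t0 : 0 < t by rewrite lt_min e0/= divr_gt0// ?oppr_gt0// mulr_gt0.
  have te : t <= e by rewrite ge_min lexx.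
  have := AB t t0 te; rewrite expr2 -mulrA -mulrDr pmulr_rge0//.
  have : t * (2 * (`|B| + 1)) <= - A.
    by rewrite -ler_pdivlMr ?mulr_gt0// ge_min lexx orbT.
  have : t * B <= t * `|B| by rewrite ler_pM2l// ler_norm.
  nra.
have yK x : K x -> 0 <= \sum_j y j * f x 0 j.
  move=> Kx.
  suff : 0 <= 2 * \sum_j y j * f x 0 j by rewrite pmulr_rge0.
  apply: (quad _ (\sum_j (f x 0 j) ^+ 2) 1 ltr01) => t t0 _.
  rewrite -subr_ge0 subr0 -(subr0 (t * _ + _)) -[X in _ - X](subrr (h x0)).
  rewrite opprB addrCA addrA -addrA.
  have := xmin (x0 + t *: x) (KD _ _ Kx0 (KZ _ _ (ltW t0) Kx)).
  rewrite dirE; lra.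
(* The direction - x0 is admissible too: for t <= 1 the point (1 - t) x0 stays in the cone. *)
have yx0 : \sum_j y j * f x0 0 j = 0.
  apply: le_anti; rewrite yK// andbT.
  suff : 0 <= - (2 * \sum_j y j * f x0 0 j) by lra.
  apply: (quad _ (\sum_j (f x0 0 j) ^+ 2) 1 ltr01) => t t0 t1.
  have := xmin (x0 + (- t) *: x0).
  have -> : x0 + (- t) *: x0 = (1 - t) *: x0 by rewrite scalerBl scale1r scaleNr.
  move=> /(_ (KZ _ _ _ Kx0)); rewrite subr_ge0 => /(_ t1).
  have -> : (1 - t) *: x0 = x0 + (- t) *: x0 by rewrite scalerBl scale1r scaleNr.
  rewrite dirE; lra.
have yb : \sum_j y j * b 0 j = - h x0.
  rewrite -[RHS]add0r -[X in _ = X + _]yx0 -sumrB; apply: eq_bigr => j _.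
  by rewrite /y; ring.
have [hx00|hx00] := eqVneq (h x0) 0.
  left; exists x0 => //; apply/rowP => j; apply/eqP; rewrite -subr_eq0 -sqrf_eq0.
  by apply/eqP/(psumr_eq0P _ hx00) => // i _; exact: sqr_ge0.
right; exists y; split=> //.
by rewrite yb oppr_lt0 lt_neqAle eq_sym hx00 h_ge0.
Qed.

End ConeSeparation.

Section ComplexParts.
Variable R : realType.
Implicit Types z w : R[i].

Lemma complexReD z w : complex.Re (z + w) = complex.Re z + complex.Re w.
Proof. by case: z w => [a b] [c d]. Qed.

Lemma complexImD z w : complex.Im (z + w) = complex.Im z + complex.Im w.
Proof. by case: z w => [a b] [c d]. Qed.

Lemma complexReM (a : R) z : complex.Re (a%:C%C * z) = a * complex.Re z.
Proof. by case: z => [b c] /=; rewrite mul0r subr0. Qed.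

Lemma complexImM (a : R) z : complex.Im (a%:C%C * z) = a * complex.Im z.
Proof. by case: z => [b c] /=; rewrite mul0r addr0. Qed.

Lemma complex_ge0E z : (0 <= z) = (complex.Im z == 0) && (0 <= complex.Re z).
Proof. by rewrite lecE. Qed.

Lemma normc_Re_Im z : `|z| <= (`|complex.Re z| + `|complex.Im z|)%:C%C.
Proof.
rewrite {1}[z]complexE (le_trans (ler_normD _ _))// normrM normc_def/=.
rewrite expr0n/= addr0 sqrtr_sqr normc_def/= expr0n/= expr1n add0r sqrtr1 mul1r.
by rewrite normc_def/= expr0n/= addr0 sqrtr_sqr -rmorphD.
Qed.

Lemma normr_Re_le z : (`|complex.Re z|)%:C%C <= `|z|.
Proof.
rewrite normc_def lecR -[ `|_| ]sqrtr_sqr ler_wsqrtr// lerDl sqr_ge0//.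
Qed.

Lemma normr_Im_le z : (`|complex.Im z|)%:C%C <= `|z|.
Proof.
rewrite normc_def lecR -[ `|_| ]sqrtr_sqr ler_wsqrtr// lerDr sqr_ge0//.
Qed.

End ComplexParts.

(** * Separation from the cone of Stein sums *)

Section PsdConeSeparation.
Variables (R : realType) (M : nat) (I : finType) (S : I -> 'M[R[i]]_M).
Local Notation C := R[i].

Definition stein (l : I -> 'M[C]_M) : 'M[C]_M :=
  \sum_i (l i - (S i)^t* *m l i *m S i).

Lemma stein_adj (l : I -> 'M[C]_M) :
  (forall i, (l i)^t* = l i) -> (stein l)^t* = stein l.
Proof.
move=> hl; rewrite adjmx_sum; apply: eq_bigr => i _.
by rewrite adjmxB !adjmxM trmxCK hl mulmxA.
Qed.

(** For the trace pairing, the adjoint of the Stein sum is G |-> G - S_i G S_i^*. *)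
Lemma trM_stein (G : 'M[C]_M) l : \tr (G *m stein l) =
  \sum_i \tr ((G - S i *m G *m (S i)^t*) *m l i).
Proof.
rewrite mulmx_sumr raddf_sum; apply: eq_bigr => i _ /=.
rewrite mulmxBr mulmxBl !raddfB /=; congr (_ - _).
by rewrite !mulmxA mxtrace_mulC !mulmxA.
Qed.

(** Real coordinates of families of arbitrary complex matrices. Hermitian symmetry is left to the
    cone [K], so that both spaces are plain row spaces. *)
Let dom := (I * 'I_M * 'I_M * bool)%type.
Let cod := ('I_M * 'I_M * bool)%type.

Let dec (x : 'rV[R]_#|{: dom}|) (i : I) : 'M[C]_M := \matrix_(a, b)
  (x 0 (enum_rank (i, a, b, true)) +i* x 0 (enum_rank (i, a, b, false)))%C.

Let enc (l : 'M[C]_M) : 'rV[R]_#|{: cod}| := \row_j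
  let: (a, b, c) := enum_val j in
  if c then complex.Re (l a b) else complex.Im (l a b).

Let decP a x y i : dec (a *: x + y) i = a%:C%C *: dec x i + dec y i.
Proof.
by apply/matrixP => s t; rewrite !mxE; apply/eqP; rewrite eq_complex /= !mul0r !subr0 !addr0 !eqxx.
Qed.

Let encP a l l' : enc (a%:C%C *: l + l') = a *: enc l + enc l'.
Proof.
apply/rowP => j; rewrite !mxE; case: (enum_val j) => [[s t] []].
  by rewrite !mxE complexReD complexReM.
by rewrite !mxE complexImD complexImM.
Qed.

Let dec_onto l : exists x, dec x = l.
Proof.
exists (\row_j let: (i, a, b, c) := enum_val j in
  if c then complex.Re (l i a b) else complex.Im (l i a b)).
apply/funext => i; apply/matrixP => a b; rewrite !mxE !enum_rankK.
by case: (l i a b).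
Qed.

(** In the order of the complex numbers 0 <= z means that z is real with nonnegative real part: one
    closed equation and one closed inequality. *)
Lemma complex_linear_form_closed (k : nat) (g : 'rV[R]_k -> C) :
  (forall a x y, g (a *: x + y) = a%:C%C * g x + g y) ->
  closed [set x | 0 <= g x].
Proof.
move=> gP.
have reP : linear (fun x => complex.Re (g x) : R).
  by move=> a x y; rewrite gP complexReD complexReM.
have imP : linear (fun x => complex.Im (g x) : R).
  by move=> a x y; rewrite gP complexImD complexImM.
pose re : {linear 'rV[R]_k -> R} := HB.pack (fun x => complex.Re (g x))
  (GRing.isLinear.Build _ _ _ _ _ reP).
pose im : {linear 'rV[R]_k -> R} := HB.pack (fun x => complex.Im (g x))
  (GRing.isLinear.Build _ _ _ _ _ imP).
rewrite (_ : mkset _ = [set x | im x = 0] `&` [set x | 0 <= re x]); last first.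
  apply/seteqP; split=> x /=; first by rewrite complex_ge0E => /andP[/eqP].
  by move=> [i0 r0]; rewrite complex_ge0E -/(im x) i0 eqxx.
apply: closedI.
  apply: (closed_comp (f := im) (D := [set y | y = 0])); last exact: closed_eq.
  by move=> x _; exact: linear_form_continuous.
apply: (closed_comp (f := re) (D := [set y | 0 <= y])); last exact: closed_ge.
by move=> x _; exact: linear_form_continuous.
Qed.

Let K := [set x | forall i, psdmx (dec x i)].

Let K_closed : closed K.
Proof.
have mxP i (h h' : 'rV[C]_M) a x y :
    (h *m dec (a *: x + y) i *m h'^t*) 0 0 =
    a%:C%C * (h *m dec x i *m h'^t*) 0 0 + (h *m dec y i *m h'^t*) 0 0.
  by rewrite decP mulmxDr mulmxDl -scalemxAr -scalemxAl !mxE.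
pose q i s t x : C := ((dec x i) s t)^* - dec x i t s.
have qP i s t a x y : q i s t (a *: x + y) = a%:C%C * q i s t x + q i s t y.
  rewrite /q decP !mxE rmorphD rmorphM/= (_ : (a%:C%C)^* = a%:C%C); first by ring.
  by apply/eqP; rewrite eq_complex /= oppr0 !eqxx.
(* Symmetry is written as [q] and [- q] both nonnegative, so that [K] is an intersection of closed
   sets of a single kind. *)
have -> : K = (\bigcap_(ih in [set: I * 'rV[C]_M])
                [set x | 0 <= (ih.2 *m dec x ih.1 *m ih.2^t*) 0 0]) `&`
   (\bigcap_(ist in [set: I * 'I_M * 'I_M])
      ([set x | 0 <= q ist.1.1 ist.1.2 ist.2 x] `&`
       [set x | 0 <= - q ist.1.1 ist.1.2 ist.2 x])).
  apply/seteqP; split=> x /=.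
    move=> Kx; split=> [[i h] _ /=|[[i s] t] _ /=]; first by have [_ ->] := Kx i.
    have -> : q i s t x = 0; last by rewrite oppr0.
    have [/(congr1 (fun A : 'M[C]_M => A t s))] := Kx i.
    rewrite [LHS]mxE [X in X^*]mxE /q => -> _; exact: subrr.
  move=> [pos herm] i; split=> [|h]; last exact: (pos (i, h)).
  apply/matrixP => s t; rewrite [LHS]mxE [X in X^*]mxE.
  apply/eqP; rewrite -subr_eq0.
  have /= [q0 q1] := herm (i, t, s) Logic.I; rewrite -/(q i t s x) eq_le q0 andbT.
  by rewrite -oppr_ge0.
apply: closedI; apply: closed_bigI.
  by move=> [i h] _; apply: complex_linear_form_closed => a x y; exact: mxP.
move=> [[i s] t] _ /=; apply: closedI; apply: complex_linear_form_closed => a x y.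
  exact: qP.
by rewrite qP; ring.
Qed.

Variables (G0 g : 'M[C]_M).
Hypothesis G0psd : forall i, psdmx (G0 - S i *m G0 *m (S i)^t* - 1%:M).
Hypothesis g_herm : g^t* = g.

(** [G0psd] supplies the bound needed for separation: the pairing of a Stein sum with [G0] is at
    least the sum of the traces of the family, and these traces bound all entries. *)
Lemma stein_separation :
  (exists2 l, (forall i, psdmx (l i)) & g = stein l) \/
  (exists G : 'M[C]_M, [/\ G^t* = G,
     forall i, psdmx (G - S i *m G *m (S i)^t*) & \tr (G *m g) < 0]).
Proof.
have fP : linear (fun x => enc (stein (dec x))).
  move=> a x y; rewrite -encP; congr enc; rewrite /stein scaler_sumr -big_split.
  apply: eq_bigr => i _ /=; rewrite decP mulmxDr mulmxDl scalerBr.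
  by rewrite -scalemxAr -scalemxAl opprD addrACA.
pose f : {linear 'rV[R]_#|{: dom}| -> 'rV[R]_#|{: cod}|} :=
  HB.pack (fun x => enc (stein (dec x))) (GRing.isLinear.Build _ _ _ _ _ fP).
have enc_le (l : 'M[C]_M) a b : `|l a b| <= (2 * `|enc l|)%:C%C.
  apply: (le_trans (normc_Re_Im _)); rewrite lecR mulr_natl mulr2n lerD//.
    have := le_mx_norm (enc l) (enum_rank (a, b, true)).
    by rewrite mxE enum_rankK.
  have := le_mx_norm (enc l) (enum_rank (a, b, false)).
  by rewrite mxE enum_rankK.
have K0 : K 0.
  move=> i; rewrite (_ : dec 0 i = 0); first exact: psdmx0.
  by apply/matrixP => a b; rewrite !mxE.
have KD x y : K x -> K y -> K (x + y).
  move=> Kx Ky i; have := decP 1 x y i; rewrite !scale1r => ->.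
  exact: psdmxD.
have KZ a x : 0 <= a -> K x -> K (a *: x).
  move=> a0 Kx i; have := decP a x 0 i; rewrite addr0 => ->.
  apply: psdmxD; first by apply: psdmxZ => //; rewrite ler0c.
  exact: K0.
have [|[x Kx fx]|[y [yK yg]]] := @closed_cone_separation R _ _ f K (enc g)
    (complex.Re (\sum_a \sum_b `|G0 a b| * 2%:R)) K_closed K0 KD KZ.
- move=> x Kx.
  set L := stein (dec x).
  have trL : \sum_i \tr (dec x i) <= \tr (G0 *m L).
    rewrite -subr_ge0 trM_stein -sumrB; apply: sumr_ge0 => i _.
    by rewrite -raddfB/= -{2}[dec x i]mul1mx -mulmxBl; apply: psdmx_trM_ge0.
  have L_le : \tr (G0 *m L) <= (\sum_a \sum_b `|G0 a b| * 2%:R) * (`|f x|)%:C%C.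
    have tr0 : 0 <= \tr (G0 *m L).
      by apply: le_trans trL; apply: sumr_ge0 => i _; exact: psdmx_tr_ge0.
    rewrite -(ger0_norm tr0) (le_trans (ler_norm_sum _ _ _))// mulr_suml.
    apply: ler_sum => a _; rewrite mxE (le_trans (ler_norm_sum _ _ _))// mulr_suml.
    apply: ler_sum => b _; rewrite normrM -mulrA ler_wpM2l//.
    by rewrite (le_trans (enc_le _ _ _))// rmorphM/= rmorph_nat.
  have sumE : \sum_a \sum_b `|G0 a b| * 2%:R =
     (complex.Re (\sum_a \sum_b `|G0 a b| * 2%:R))%:C%C.
    rewrite RRe_real// ger0_real//; do 2!apply: sumr_ge0 => ? _.
    by rewrite mulr_ge0.
  rewrite -lecR rmorphM/= -sumE; apply: le_trans L_le; apply: le_trans trL.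
  have tr0 i : 0 <= \tr (dec x i) by exact: psdmx_tr_ge0.
  have sumE' : \sum_i \tr (dec x i) = (complex.Re (\sum_i \tr (dec x i)))%:C%C.
    by rewrite RRe_real// ger0_real// sumr_ge0.
  rewrite sumE' lecR; apply: mx_norm_le.
    by rewrite -ler0c -sumE' sumr_ge0.
  move=> j; rewrite -lecR -sumE'.
  have tri i : \tr (dec x i) <= \sum_i \tr (dec x i).
    by rewrite (bigD1 i)//= lerDl sumr_ge0.
  have [[[[i a] b] c] ->] : exists t, j = enum_rank t by exists (enum_val j); rewrite enum_valK.
  apply: le_trans (tri i); apply: le_trans (psdmx_norm_le_tr a b (Kx i)).
  rewrite mxE; case: c.
    exact: (normr_Re_le (x 0 (enum_rank (i, a, b, true)) +i* x 0 (enum_rank (i, a, b, false)))%C).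
  exact: (normr_Im_le (x 0 (enum_rank (i, a, b, true)) +i* x 0 (enum_rank (i, a, b, false)))%C).
- left; exists (dec x) => //.
  apply/matrixP => a b; apply/eqP; rewrite eq_complex.
  have /rowP fxj := fx; have := fxj (enum_rank (a, b, true)).
  have := fxj (enum_rank (a, b, false)); rewrite !mxE !enum_rankK => -> ->.
  by rewrite !eqxx.
- right.
  pose E := \matrix_(b, a) (y (enum_rank (a, b, true)) -i*
     y (enum_rank (a, b, false)))%C.
  have trE (l : 'M[C]_M) : complex.Re (\tr (E *m l)) = \sum_j y j * enc l 0 j.
    have ReS (J : finType) (h : J -> C) :
        complex.Re (\sum_i h i) = \sum_i complex.Re (h i).
      by apply: (big_morph _ (@complexReD R)).
    rewrite ReS; under eq_bigr do rewrite mxE ReS.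
    rewrite exchange_big /=.
    rewrite [RHS](reindex (enum_rank : cod -> _))/=; last exact/onW_bij/enum_rank_bij.
    transitivity (\sum_(p : 'I_M * 'I_M) \sum_(c : bool)
        y (enum_rank (p, c)) * enc l 0 (enum_rank (p, c))).
      rewrite pair_bigA /=; apply: eq_bigr => -[a b] _ /=.
      rewrite big_bool !mxE !enum_rankK /=.
      by case: (l a b) => u v /=; ring.
    by rewrite pair_bigA; apply: eq_bigr => -[[a b] c].
  (* The hermitian part of [E] has a real pairing with hermitian matrices, equal to the given
     functional. *)
  pose G := 2%:R^-1 *: (E + E^t*).
  have Gh : G^t* = G.
    rewrite adjmxZ adjmxD trmxCK addrC; congr (_ *: _).
    by rewrite geC0_conj.
  have trG (l : 'M[C]_M) : l^t* = l -> \tr (G *m l) = (\sum_j y j * enc l 0 j)%:C%C.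
    move=> lh; rewrite -trE -scalemxAl mulmxDl linearZ linearD /=.
    have -> : \tr (E^t* *m l) = (\tr (E *m l))^*.
      rewrite -{1}lh -adjmxM mxtrace_mulC /mxtrace rmorph_sum.
      by apply: eq_bigr => a _; rewrite [LHS]mxE mxE.
    by rewrite addcJ mulrA mulVf ?mul1r.
  exists G; split; [exact: Gh| |by rewrite (trG _ g_herm) ltcR].
  move=> i; split=> [|h]; first by rewrite adjmxB !adjmxM trmxCK Gh mulmxA.
  (* Testing the functional on the family with the single member h^* h at index [i] yields the
     quadratic form at [h]. *)
  pose l j : 'M[C]_M := if j == i then h^t* *m h else 0.
  have [x xl] := dec_onto l.
  have Kx : K x by move=> j; rewrite xl /l; case: ifP => _; [exact: psdmx_adjM|exact: psdmx0].
  have := yK _ Kx; rewrite -ler0c -trG; last by apply: stein_adj => j; have [] := Kx j.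
  rewrite trM_stein (bigD1 i)//= big1 ?addr0 => [|j ji]; last first.
    by rewrite xl /l (negPf ji) mulmx0 mxtrace0.
  by rewrite xl /l eqxx mulmxA mxtrace_mulC mulmxA trace_mx11.
Qed.

End PsdConeSeparation.

(** * Finite-dimensional Hilbert spaces and operator norms *)

(** A separate name for row vectors, which already carry the supremum norm. *)
Definition l2space (R : realType) (m : nat) := 'rV[R[i]]_m.

HB.instance Definition _ (R : realType) (m : nat) :=
  GRing.Lmodule.copy (l2space R m) 'rV[R[i]]_m.

Section L2Space.
Variables (R : realType) (m : nat).
Local Notation C := R[i].
Local Notation H := (l2space R m).

Definition l2 (x : H) : C := sqrtC (sqnorm (x : 'rV[C]_m)).

Lemma l2_sqr x : l2 x ^+ 2 = sqnorm (x : 'rV[C]_m).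
Proof. by rewrite sqrtCK. Qed.

Lemma l2D (x y : H) : l2 (x + y) <= l2 x + l2 y.
Proof.
rewrite /l2 !sqnorm_dotmx.
exact: (@triangle_lerif C _ (@dotmx C m) x y).
Qed.

Lemma l2Z (a : C) (x : H) : l2 (a *: x) = `|a| * l2 x.
Proof.
rewrite /l2 -[ `|a| ](@sqrCK C)// -rootCMl ?exprn_ge0//; congr sqrtC.
by rewrite /sqnorm mulr_sumr; apply: eq_bigr => i _; rewrite mxE normrM exprMn.
Qed.

Lemma l2_eq0 (x : H) : l2 x = 0 -> x = 0.
Proof. by move=> /eqP; rewrite sqrtC_eq0 => /eqP/sqnorm_eq0. Qed.

End L2Space.

HB.instance Definition _ (R : realType) (m : nat) :=
  Lmodule_isNormed.Build R[i] (l2space R m) (@l2D R m) (@l2Z R m) (@l2_eq0 R m).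

Section L2Complete.
Variables (R : realType) (m : nat).
Local Notation H := (l2space R m).

Lemma l2_norm_sqr (x : H) : `|x| ^+ 2 = \sum_i `|(x : 'rV_m) 0 i| ^+ 2.
Proof. exact: l2_sqr. Qed.

Lemma l2_coord_le (x : H) i : `|(x : 'rV_m) 0 i| <= `|x|.
Proof.
rewrite -(@ler_pXn2r _ 2)// ?nnegrE// l2_norm_sqr (bigD1 i)//= lerDl.
by apply: sumr_ge0 => j _; exact: exprn_ge0.
Qed.

Lemma l2_le_sum (x : H) : `|x| <= \sum_i `|(x : 'rV_m) 0 i|.
Proof.
have sum0 : 0 <= \sum_i `|(x : 'rV_m) 0 i| by apply: sumr_ge0.
rewrite -(@ler_pXn2r _ 2)// ?nnegrE// l2_norm_sqr expr2 mulr_suml ler_sum// => i _.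
rewrite expr2 ler_wpM2l// (bigD1 i)//= lerDl; exact: sumr_ge0.
Qed.

Lemma l2_complete (F : set_system H) : ProperFilter F -> cauchy F -> cvg F.
Proof.
move=> FF /cauchyP Fc.
have part_cvg (r : R[i] -> R) i :
    (forall z w, `|r z - r w|%:C%C <= `|z - w|) ->
    cvg ((fun x : H => r ((x : 'rV_m) 0 i)) @ F).
  move=> r_le; apply/cauchy_cvgP/cauchy_exP => e e0.
  have [|x Fx] := Fc (e%:C%C); first by rewrite ltcR.
  exists (r ((x : 'rV_m) 0 i)).
  change (F ((fun y : H => r ((y : 'rV_m) 0 i)) @^-1` ball (r ((x : 'rV_m) 0 i)) e)).
  apply: filterS Fx => y; rewrite -ball_normE /= => xy.
  suff : `|r ((x : 'rV_m) 0 i) - r ((y : 'rV_m) 0 i)| < e by [].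
  rewrite -ltcR.
  apply: le_lt_trans (r_le _ _) _; apply: le_lt_trans xy.
  by have := l2_coord_le (x - y) i; rewrite !mxE.
have reB (z w : R[i]) : complex.Re z - complex.Re w = complex.Re (z - w).
  by case: z w => [a b] [c e].
have imB (z w : R[i]) : complex.Im z - complex.Im w = complex.Im (z - w).
  by case: z w => [a b] [c e].
have re_cvg i : cvg ((fun x : H => complex.Re ((x : 'rV_m) 0 i)) @ F).
  by apply: part_cvg => z w; rewrite reB normr_Re_le.
have im_cvg i : cvg ((fun x : H => complex.Im ((x : 'rV_m) 0 i)) @ F).
  by apply: part_cvg => z w; rewrite imB normr_Im_le.
pose re i := lim ((fun x : H => complex.Re ((x : 'rV_m) 0 i)) @ F).
pose im i := lim ((fun x : H => complex.Im ((x : 'rV_m) 0 i)) @ F).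
pose l : H := \row_i (re i +i* im i)%C.
apply/cvg_ex; exists l; apply/cvgrPdist_lt => e e0.
have [e' eE] : exists e', e = e'%:C%C.
  by exists (complex.Re e); rewrite RRe_real// gtr0_real.
move: e0; rewrite eE ltcR => e0.
(* The 2 accounts for real and imaginary parts; [m.+1] instead of [m] makes the total strictly less
   than [e'] and covers dimension 0. *)
pose d := e' / (2 * m.+1%:R).
have d0 : 0 < d by rewrite divr_gt0// mulr_gt0// ltr0n.
have near_i i : \forall x \near F,
    `|re i - complex.Re ((x : 'rV_m) 0 i)| < d /\
    `|im i - complex.Im ((x : 'rV_m) 0 i)| < d.
  apply: filterI.
    by have /cvgrPdist_lt h : (fun x : H => complex.Re ((x : 'rV_m) 0 i)) @ F --> re i;
      [exact: re_cvg|exact: h].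
  by have /cvgrPdist_lt h : (fun x : H => complex.Im ((x : 'rV_m) 0 i)) @ F --> im i;
    [exact: im_cvg|exact: h].
have near_all := filter_forall FF near_i; apply: filterS near_all => x nx.
rewrite /=; apply: (le_lt_trans (l2_le_sum _)).
apply: (@le_lt_trans _ _ (\sum_(i < m) (2 * d)%:C%C)); last first.
  rewrite sumr_const card_ord -rmorphMn ltcR -mulr_natr.
  have -> : 2 * d * m%:R = e' * (m%:R / m.+1%:R).
    have : (m.+1%:R : R) != 0 by rewrite pnatr_eq0.
    by rewrite /d; move: (m.+1%:R) => k k0; field.
  by rewrite gtr_pMr// ltr_pdivrMr ?ltr0n// mul1r ltr_nat.
apply: ler_sum => i _; apply: le_trans (normc_Re_Im _) _.
rewrite lecR !mxE -reB -imB mulr_natl mulr2n /=.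
by have [h1 h2] := nx i; rewrite lerD// ltW.
Qed.
End L2Complete.
HB.instance Definition _ (R : realType) (m : nat) :=
  Uniform_isComplete.Build (l2space R m) (@l2_complete R m).

Section OperatorNorm.
Variable R : realType.
Local Notation C := R[i].

Lemma opnorm_le (U V : Type) (nU : U -> C) (nV : V -> C) (f : U -> V) (r : R) :
  (forall x, nU x <= 1 -> nV (f x) <= r%:C%C) -> (opnorm nU nV f <= r%:E)%E.
Proof.
move=> fr; apply: ub_ereal_sup => _ [x x1 <-]; rewrite lee_fin.
by have := fr x x1; rewrite lecE => /andP[].
Qed.

Lemma le_opnorm (U V : Type) (nU : U -> C) (nV : V -> C) (f : U -> V) x :
  nU x <= 1 -> ((complex.Re (nV (f x)))%:E <= opnorm nU nV f)%E.
Proof. by move=> x1; apply: ereal_sup_ubound; exists x. Qed.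

Lemma op_monomial_intertwine (V V' : Type) d (T : 'I_d -> V -> V)
    (T' : 'I_d -> V' -> V') (phi : V -> V') (t : multiindex d) v :
  (forall k u, T' k (phi u) = phi (T k u)) ->
  op_monomial T' t (phi v) = phi (op_monomial T t v).
Proof.
move=> TT; rewrite /op_monomial; elim/big_rec2: _ => [//|k f g _ fg] /=.
rewrite fg; elim: (t k) => [//|j IHj] /=.
by rewrite IHj TT.
Qed.

Lemma opnorm_lt1 (U V : Type) (nU : U -> C) (nV : V -> C) (f : U -> V) (c : C) :
  0 <= c -> c < 1 -> (forall x, 0 <= nU x) -> (forall x, 0 <= nV x) ->
  (forall x, nV (f x) ^+ 2 <= c * nU x ^+ 2) -> (opnorm nU nV f < 1)%E.
Proof.
move=> c0 c1 nU0 nV0 fc.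
have cE : c = (complex.Re c)%:C%C by rewrite RRe_real// ger0_real.
have r0 : 0 <= complex.Re c by rewrite -ler0c -cE.
apply: (@le_lt_trans _ _ (Num.sqrt (complex.Re c))%:E); last first.
  by rewrite lte_fin -[ltRHS]sqrtr1 ltr_sqrt ?ltr01// -ltcR -cE.
apply: opnorm_le => x x1.
rewrite -(@ler_pXn2r _ 2)// ?nnegrE// ?ler0c ?sqrtr_ge0// -rmorphXn/= sqr_sqrtr//.
rewrite -cE (le_trans (fc x))// ler_piMr// -[leRHS](expr1n _ 2) ler_pXn2r ?nnegrE//.
Qed.

(** The substitution x = h W turns the norm |h W|, which comes from the inner product of W W^*, into
    the standard norm, and [S] into its conjugate. *)
Lemma stein_strict_contraction m (S W : 'M[C]_m) (e : C) : 0 < e ->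
  W \in unitmx -> psdmx (W *m W^t* - S *m (W *m W^t*) *m S^t* - e%:M) ->
  (opnorm (fun x : l2space R m => `|x|%R) (fun x : l2space R m => `|x|%R)
    (fun x : l2space R m => (x *m (invmx W *m S *m W))%R) < 1)%E.
Proof.
move=> e0 Wu /(stein_contraction e0) sc.
set c := 1 - _ in sc.
have tr0 := mxtr_adjM_ge0 W.
apply: (@opnorm_lt1 _ _ _ _ _ c) => //.
- by rewrite subr_ge0 ler_pdivrMr ?ltr_wpDl// mul1r lerDr.
- by rewrite gtrBl divr_gt0// ltr_wpDl.
move=> x; rewrite !l2_norm_sqr.
have := sc ((x : 'rV_m) *m invmx W).
by rewrite mulmxKV// !mulmxA.
Qed.

End OperatorNorm.

(** * Power series and polynomials *)

Section MultiIndex.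
Variables (R : realType) (d : nat).
Local Notation C := R[i].

Definition mnm_of (t : multiindex d) : multinom d := Multinom [tuple t i | i < d].

Definition mabs (t : multiindex d) : nat := (\sum_k t k)%N.

Lemma mnm_ofE t i : mnm_of t i = t i.
Proof. by rewrite /fun_of_multinom tnth_mktuple. Qed.

Lemma mnm_of_inj : injective mnm_of.
Proof.
move=> s t st; apply/ffunP => i.
by rewrite -mnm_ofE st mnm_ofE.
Qed.

Lemma mnm_of_onto (m : multinom d) : mnm_of [ffun i => m i] = m.
Proof. by apply/mnmP => i; rewrite mnm_ofE ffunE. Qed.

Lemma mdeg_mnm_of t : mdeg (mnm_of t) = mabs t.
Proof. by rewrite mdegE; apply: eq_bigr => i _; rewrite mnm_ofE. Qed.

Lemma meval_mnm_of (z : 'I_d -> C) t : meval z (mpolyX C (mnm_of t)) = monomial z t.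
Proof. by rewrite mevalX; apply: eq_bigr => i _; rewrite mnm_ofE. Qed.

Lemma monomial_scale (a : C) (z : 'I_d -> C) t :
  monomial (fun k => a * z k) t = a ^+ mabs t * monomial z t.
Proof.
rewrite /monomial /mabs; under eq_bigr do rewrite exprMn.
by rewrite big_split /= -expr_sum.
Qed.

Lemma monomial_le (s : C) (z : 'I_d -> C) t :
  (forall k, `|z k| <= s) -> `|monomial z t| <= s ^+ mabs t.
Proof.
move=> zs; rewrite normr_prod /mabs expr_sum; apply: ler_prod => k _.
by rewrite normrX exprn_ge0//= lerXn2r// ?nnegrE// (le_trans _ (zs k)).
Qed.

End MultiIndex.

(* A finite set of multi-indices lies in a box, where the sum factors. *)
Lemma sum_geometric_le (C : numFieldType) d (s : C) (A : {fset multiindex d}) :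
  0 <= s -> s < 1 -> \sum_(t <- A) s ^+ mabs t <= (1 - s)^-1 ^+ d.
Proof.
move=> s0 s1; pose b := (\max_(t <- A) mabs t).+1.
have tb (t : A) k : (val t k < b)%N.
  rewrite ltnS; apply: (@leq_trans (mabs (val t))).
    by rewrite /mabs (bigD1 k)//= leq_addr.
  exact: leq_bigmax_seq (fsvalP t) _.
pose phi (t : A) : {ffun 'I_d -> 'I_b} := [ffun k => Ordinal (tb t k)].
have phi_inj : injective phi.
  move=> t u tu; apply/val_inj/ffunP => k.
  by have /ffunP/(_ k)/(congr1 val) := tu; rewrite !ffunE.
pose g (f : {ffun 'I_d -> 'I_b}) : C := \prod_k s ^+ f k.
have gphi t : s ^+ mabs (val t) = g (phi t).
  by rewrite /g /mabs expr_sum; apply: eq_bigr => k _; rewrite ffunE.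
rewrite big_seq_fsetE/=.
under eq_bigr do rewrite gphi.
have -> : \sum_(t : A) g (phi t) = \sum_(f in imset phi (mem predT)) g f.
  rewrite big_imset /=; first by apply: eq_bigl.
  by move=> t u _ _; exact: phi_inj.
apply: (@le_trans _ _ (\sum_f g f)).
  rewrite [leRHS](bigID (mem (imset phi (mem predT))))/= lerDl.
  by apply: sumr_ge0 => f _; apply: prodr_ge0 => k _; exact: exprn_ge0.
rewrite -(bigA_distr_bigA (fun (_ : 'I_d) (j : 'I_b) => s ^+ j))/= -[X in _ ^+ X]card_ord.
rewrite -prodr_const; apply: ler_prod => k _.
rewrite sumr_ge0/=; last by move=> j _; exact: exprn_ge0.
have s1' : 0 < 1 - s by rewrite subr_gt0.
rewrite -(ler_pM2l s1') divff ?gt_eqF//.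
rewrite -[1 - s]opprB mulNr -subrX1 opprB gerBl exprn_ge0//.
Qed.

(** * Remainders of unconditionally convergent power series *)

Section PowerSeriesTruncation.
Variables (R : realType) (d n : nat).
Local Notation C := R[i].
Variables (c : multiindex d -> 'M[C]_n) (F : ('I_d -> C) -> 'M[C]_n).
Hypothesis cF : power_series_expansion c F.

Lemma partial_sumE (I : choiceType) (V : zmodType) (x : I -> V) (A : {fset I}) :
  partial_sum x A = \sum_(t <- A) x t.
Proof. by rewrite /partial_sum big_seq_fsetE. Qed.

Lemma power_series_near z i j (e : C) : polydisk z -> 0 < e ->
  exists A0 : {fset multiindex d}, forall A : {fset multiindex d}, (A0 `<=` A)%fset ->
    `|F z i j - \sum_(t <- A) c t i j * monomial z t| < e.
Proof.
move=> zD e0; have tf := @totally_filter (multiindex d).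
have [A0 _ A0P] := (@cvgrPdist_lt C C^o _ _ tf _ (F z i j)).1 (@cF z zD i j) e e0.
by exists A0 => A A0A; have := A0P A A0A; rewrite /= partial_sumE.
Qed.

(** At the point with all coordinates [s], the sum over [A0] changes by less than 2 when one more
    index joins it. Hence all terms outside the finite set [A0] are bounded by 2. *)
Lemma power_series_coef_bound (s : C) i j : 0 <= s -> s < 1 ->
  exists2 B : C, 0 <= B & forall t, `|c t i j| * s ^+ mabs t <= B.
Proof.
move=> s0 s1; have sD : polydisk (fun _ : 'I_d => s) by move=> k; rewrite ger0_norm.
have [A0 A0P] := power_series_near i j sD ltr01.
exists (2%:R + \sum_(t <- A0) `|c t i j * monomial (fun _ => s) t|).
  by rewrite addr_ge0// sumr_ge0.
move=> t; have mE : monomial (fun _ : 'I_d => s) t = s ^+ mabs t.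
  by rewrite /monomial /mabs expr_sum.
have -> : `|c t i j| * s ^+ mabs t = `|c t i j * monomial (fun _ => s) t|.
  by rewrite mE normrM (ger0_norm (exprn_ge0 _ s0)).
have [tA|tA] := boolP (t \in A0).
  by rewrite (big_fsetD1 t)//= addrCA lerDl addr_ge0// sumr_ge0.
have h0 := A0P A0 (fsubset_refl _); have h1 := A0P (t |` A0)%fset (fsubsetUr _ _).
rewrite big_fsetU1//= in h1.
set x := c t i j * _ in h1 *; set S := \sum_(_ <- _) _ in h0 h1.
apply: (@le_trans _ _ 2%:R); last by rewrite lerDl sumr_ge0.
have -> : x = (F (fun=> s) i j - S) - (F (fun=> s) i j - (x + S)) by ring.
by rewrite (le_trans (ler_normB _ _))// ltW// -[2%:R](natrD _ 1 1) ltrD.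
Qed.

(** Every omitted index has degree at least [N], whence the factor a^N. The radius splits as 1/3 =
    2/3 * 1/2: coefficients are controlled at radius 2/3, and 1/2 leaves a summable geometric
    series. *)
Lemma power_series_tail (u : 'I_d -> C) i j : (forall k, `|u k| <= 3%:R^-1) ->
  exists2 K : C, 0 <= K & forall N (A : {fset multiindex d}) (a : C),
    (forall t, (mabs t < N)%N -> t \in A) -> 0 < a -> a <= 1 ->
    `|F (fun k => a * u k) i j -
      \sum_(t <- A) c t i j * monomial (fun k => a * u k) t| <= K * a ^+ N.
Proof.
move=> u3; have s01 : 0 <= (2%:R / 3%:R : C) by rewrite divr_ge0.
have s1 : (2%:R / 3%:R : C) < 1 by rewrite ltr_pdivrMr ?ltr0n// mul1r ltr_nat.
have [B B0 cB] := power_series_coef_bound i j s01 s1.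
have h0 : 0 <= (2%:R^-1 : C) by rewrite invr_ge0.
have h1 : (2%:R^-1 : C) < 1 by rewrite invf_lt1 ?ltr0n// ltr1n.
have K0 : 0 <= B * (1 - 2%:R^-1)^-1 ^+ d.
  by rewrite mulr_ge0// exprn_ge0// invr_ge0 subr_ge0 ltW.
exists (B * (1 - 2%:R^-1)^-1 ^+ d) => // N A a AN a0 a1.
have uD : polydisk (fun k => a * u k).
  move=> k; rewrite normrM (ger0_norm (ltW a0)).
  apply: (@le_lt_trans _ _ (3%:R^-1)); last by rewrite invf_lt1 ?ltr0n// ltr1n.
  by rewrite -[leRHS]mul1r ler_pM// ltW.
have tailE (A' : {fset multiindex d}) : (A `<=` A')%fset ->
    `|\sum_(t <- A') c t i j * monomial (fun k => a * u k) t -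
      \sum_(t <- A) c t i j * monomial (fun k => a * u k) t| <=
    B * (1 - 2%:R^-1)^-1 ^+ d * a ^+ N.
  move=> AA'; pose f t := c t i j * monomial (fun k => a * u k) t.
  rewrite -[leLHS]/(`|\sum_(t <- A') f t - \sum_(t <- A) f t|).
  pose g t := if t \in A then f t else 0.
  have -> : \sum_(t <- A) f t = \sum_(t <- A') g t.
    rewrite -(big_fset_incl _ AA') => [|t _ tA]; last by rewrite /g (negPf tA).
    by rewrite [LHS]big_seq [RHS]big_seq; apply: eq_bigr => t tA; rewrite /g tA.
  rewrite -sumrB (le_trans (ler_norm_sum _ _ _))//.
  apply: (@le_trans _ _ (\sum_(t <- A') B * a ^+ N * (2%:R^-1) ^+ mabs t)); last first.
    rewrite -mulr_sumr mulrAC ler_wpM2r ?exprn_ge0 ?(ltW a0)// ler_wpM2l//.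
    exact: sum_geometric_le.
  apply: ler_sum => t _; rewrite /g; case: ifPn => tA.
    by rewrite subrr normr0 !mulr_ge0// exprn_ge0// ltW.
  rewrite subr0 /f normrM monomial_scale normrM.
  rewrite (ger0_norm (exprn_ge0 _ (ltW a0))).
  have Nt : (N <= mabs t)%N by rewrite leqNgt; apply: contra tA => /AN.
  apply: (@le_trans _ _ (`|c t i j| * (a ^+ N * (3%:R^-1) ^+ mabs t))).
    rewrite ler_wpM2l// ler_pM ?exprn_ge0 ?(ltW a0) ?normr_ge0//.
      by rewrite ler_wiXn2l// ltW.
    exact: monomial_le.
  have -> : (3%:R^-1 : C) = 2%:R / 3%:R * 2%:R^-1.
    by rewrite mulrAC divff ?mul1r// pnatr_eq0.
  rewrite exprMn; have := cB t; set q := (_ / _) ^+ _; set h := _ ^-1 ^+ _ => cq.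
  have -> : `|c t i j| * (a ^+ N * (q * h)) = a ^+ N * h * (`|c t i j| * q) by ring.
  have -> : B * a ^+ N * h = a ^+ N * h * B by ring.
  by rewrite ler_wpM2l// mulr_ge0// exprn_ge0// ltW.
(* [tailE] compares finite sums only; a larger set that approximates [F] within [e] gives the bound
   for the limit. *)
apply/ler_addgt0Pl => e e0.
have [A0 A0P] := power_series_near i j uD e0.
have := A0P (A0 `|` A)%fset (fsubsetUl _ _).
have := tailE (A0 `|` A)%fset (fsubsetUr _ _).
set S' := \sum_(_ <- (_ `|` _)%fset) _; set S := \sum_(_ <- A) _ => le1 lt2.
have -> : F (fun k => a * u k) i j - S = (F (fun k => a * u k) i j - S') + (S' - S).
  by rewrite addrA subrK.
by rewrite (le_trans (ler_normD _ _))// lerD// ltW.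
Qed.

End PowerSeriesTruncation.

(** * Criteria for the vanishing of polynomials and of their low coefficients *)

Section PolynomialVanishing.
Variable C : numClosedFieldType.

(** Induction on [N]: the bound forces the constant coefficient below a fixed multiple of [a], hence
    to zero, and dividing by ['X] lowers the order by one. *)
Lemma horner_small_coef0 (q : {poly C}) (K : C) N :
  (forall a : C, 0 < a -> a <= 1 -> `|q.[a]| <= K * a ^+ N) ->
  forall j, (j < N)%N -> q`_j = 0.
Proof.
elim: N q => [//|N IHN] q; elim/poly_ind: q => [|q c _] qK j; first by rewrite coef0.
have K0 : 0 <= K.
  by have := le_trans (normr_ge0 _) (qK 1 ltr01 (lexx _)); rewrite expr1n mulr1.
have c0 : c = 0.
  pose B := \sum_(i < size q) `|q`_i|.
  have qB a : 0 < a -> a <= 1 -> `|q.[a]| <= B.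
    move=> a0 a1; rewrite horner_coef (le_trans (ler_norm_sum _ _ _))//.
    apply: ler_sum => i _; rewrite normrM ler_piMr// normrX.
    by rewrite exprn_ile1// ger0_norm ?(ltW a0).
  have B0 : 0 <= B by apply: sumr_ge0.
  have cK a : 0 < a -> a <= 1 -> `|c| <= (K + B) * a.
    move=> a0 a1; have := qK a a0 a1; rewrite hornerMXaddC => le1.
    have -> : c = (q.[a] * a + c) - q.[a] * a by ring.
    rewrite (le_trans (ler_normB _ _))// mulrDl lerD//.
      apply: (le_trans le1); rewrite ler_wpM2l// exprS ler_piMr ?(ltW a0)//.
      by rewrite exprn_ile1// ltW.
    by rewrite normrM (ger0_norm (ltW a0)) ler_wpM2r ?(ltW a0)// qB.
  apply/eqP; rewrite -normr_le0 real_leNgt ?normr_real//; apply/negP => c0.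
  have KB : 0 < K + B + `|c| by rewrite ltr_wpDl ?addr_ge0.
  pose a := `|c| / (2%:R * (K + B + `|c|)).
  have a0 : 0 < a by rewrite divr_gt0// mulr_gt0// ltr0n.
  have a1 : a <= 1.
    rewrite ler_pdivrMr ?mulr_gt0 ?ltr0n// mul1r mulr_natl mulr2n.
    by rewrite addrACA addrC -addrA lerDl !addr_ge0.
  have : `|c| < `|c|; last by rewrite ltxx.
  apply: (le_lt_trans (cK a a0 a1)).
  rewrite /a mulrA ltr_pdivrMr ?mulr_gt0 ?ltr0n// mulrC ltr_pM2l//.
  rewrite mulr_natl mulr2n; apply: (@lt_le_trans _ _ (K + B + `|c|)).
    by rewrite ltrDl.
  by rewrite lerDl ltW.
rewrite c0 addr0 in qK *; case: j => [|j] jN; first by rewrite coefMX.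
rewrite coefMX/=; apply: IHN => // a a0 a1.
have := qK a a0 a1; rewrite hornerMX normrM (gtr0_norm a0) exprSr mulrA.
by rewrite ler_pM2r.
Qed.

Variable d : nat.

(** The first hypothesis says that [E] is infinite. In each variable an inverse Vandermonde matrix
    isolates the exponent of [m0]; the product of these weights isolates its coefficient from the
    values on a grid. *)
Lemma mpoly_vanish (E : C -> Prop) (h : mpoly d C) :
  (forall N, exists2 s : 'I_N -> C, injective s & forall i, E (s i)) ->
  (forall z, (forall k, E (z k)) -> meval z h = 0) -> h = 0.
Proof.
move=> Einf h0; apply/mpolyP => m0; rewrite mcoeff0.
have [m0h|] := boolP (m0 \in msupp h); last exact: memN_msupp_eq0.
pose N := msize h; have [s s_inj sE] := Einf N.
have mN m k : m \in msupp h -> (m k < N)%N.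
  move=> mh; apply: leq_ltn_trans (msize_mdeg_lt mh).
  by rewrite mdegE (bigD1 k)//= leq_addr.
pose V := Vandermonde N (\row_j s j).
have Vu : V \in unitmx.
  rewrite unitmxE det_Vandermonde unitfE; apply/prodf_neq0 => i _.
  apply/prodf_neq0 => j ij.
  by rewrite !mxE subr_eq0 (inj_eq s_inj) gt_eqF.
pose e k : 'I_N := Ordinal (mN m0 k m0h).
have VE m k (mh : m \in msupp h) :
    \sum_i invmx V i (e k) * s i ^+ m k = (m k == m0 k)%:R.
  have /matrixP/(_ (Ordinal (mN m k mh)) (e k)) := mulmxV Vu.
  rewrite !mxE -val_eqE /= => <-; apply: eq_bigr => i _.
  by rewrite !mxE mulrC.
have : \sum_(f : {ffun 'I_d -> 'I_N}) (\prod_k invmx V (f k) (e k)) *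
    meval (fun k => s (f k)) h = 0.
  by apply: big1 => f _; rewrite h0 ?mulr0// => k; exact: sE.
under eq_bigr do rewrite mevalE mulr_sumr.
rewrite exchange_big /= (bigD1_seq m0)//= ?msupp_uniq//.
have termE m : m \in msupp h -> \sum_(f : {ffun 'I_d -> 'I_N})
    (\prod_k invmx V (f k) (e k)) * (mcoeff m h * \prod_k s (f k) ^+ m k) =
    mcoeff m h * \prod_k (m k == m0 k)%:R.
  move=> mh; rewrite (eq_bigr (fun f : {ffun _} => mcoeff m h *
    \prod_k (invmx V (f k) (e k) * s (f k) ^+ m k))); last first.
    by move=> f _; rewrite mulrCA -big_split.
  rewrite -mulr_sumr -(bigA_distr_bigA (fun k i => invmx V i (e k) * s i ^+ m k))/=.
  by congr (_ * _); apply: eq_bigr => k _; exact: VE.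
rewrite termE// [X in _ * X]big1 => [|k _]; last by rewrite eqxx.
rewrite mulr1 big_seq_cond big1 ?addr0// => m /andP[mh mm0].
rewrite termE//; suff [k mk] : exists k, m k != m0 k.
  by rewrite (bigD1 k)//= (negPf mk) mul0r mulr0.
apply/existsP; apply: contraR mm0; rewrite negb_exists => /forallP mE.
by apply/eqP/mnmP => k; apply/eqP; have := mE k; rewrite negbK.
Qed.

Lemma small_disk_infinite N : exists2 s : 'I_N -> C, injective s &
  forall i, 0 <= s i /\ s i <= 3%:R^-1.
Proof.
exists (fun i => (i + 3)%:R^-1) => [i j /invr_inj/eqP|i].
  by rewrite eqr_nat eqn_add2r => /eqP/val_inj.
rewrite invr_ge0 ler0n; split=> //.
have i3 : (0 < i + 3)%N by rewrite addnS.
by rewrite lef_pV2 ?posrE ?ltr0n// ler_nat leq_addl.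
Qed.

(** On the ray through [u] the homogeneous part of degree j becomes the coefficient of a^j. For j <
    N it vanishes at every small [u], so it is the zero polynomial. *)
Lemma mpoly_small_coef0 (h : mpoly d C) N :
  (forall u : 'I_d -> C, (forall k, `|u k| <= 3%:R^-1) -> exists K : C,
    forall a : C, 0 < a -> a <= 1 -> `|meval (fun k => a * u k) h| <= K * a ^+ N) ->
  forall m, (mdeg m < N)%N -> mcoeff m h = 0.
Proof.
move=> hK m mN.
pose hj := \sum_(m' <- msupp h | mdeg m' == mdeg m) mcoeff m' h *: mpolyX C m'.
have hjm : mcoeff m hj = mcoeff m h.
  rewrite raddf_sum /=; under eq_bigr do rewrite mcoeffZ mcoeffX.
  have [mh|mh] := boolP (m \in msupp h).
    rewrite big_mkcond (bigD1_seq m) ?msupp_uniq//= !eqxx mulr1 big1 ?addr0//.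
    by move=> m' /negPf ->; rewrite mulr0 if_same.
  rewrite (memN_msupp_eq0 mh) big_seq_cond big1// => m' /andP[m'h _].
  by case: eqP => [mE|]; rewrite ?mulr0// mE in m'h mh *; rewrite m'h in mh.
rewrite -hjm (_ : hj = 0) ?mcoeff0//.
apply: (@mpoly_vanish (fun z => `|z| <= 3%:R^-1)) => [M|u uE].
  have [s si sE] := small_disk_infinite M; exists s => // i.
  by have [s0 s1] := sE i; rewrite ger0_norm.
have [K uK] := hK u uE.
pose q := \sum_(m' <- msupp h) (mcoeff m' h * \prod_k u k ^+ m' k) *: 'X^(mdeg m').
have qE a : q.[a] = meval (fun k => a * u k) h.
  rewrite horner_sum mevalE; apply: eq_bigr => m' _.
  rewrite hornerZ hornerXn -mulrA; congr (_ * _).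
  by rewrite mdegE expr_sum mulrC -big_split; apply: eq_bigr => k _; rewrite exprMn.
have := @horner_small_coef0 q K N _ (mdeg m) mN.
rewrite coef_sum => q0; rewrite -[RHS]q0; last by move=> a a0 a1; rewrite qE uK.
rewrite [RHS](bigID (fun m' => mdeg m' == mdeg m))/= [X in _ + X]big1 ?addr0.
  rewrite raddf_sum /=; apply: eq_bigr => m' /eqP mm'.
  by rewrite mevalZ mevalX coefZ coefXn mm' eqxx mulr1.
by move=> m' mm'; rewrite coefZ coefXn eq_sym (negPf mm') mulr0.
Qed.

End PolynomialVanishing.

(** * Truncated shifts and the Agler certificate *)

Section TruncatedShift.
Variables (C : numClosedFieldType) (d n N : nat).
Local Notation mon := (bmultinom d N).
Local Notation idx := (mon * 'I_n)%type.
Local Notation M := #|{: idx}|.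

Definition imon (a : 'I_M) : multinom d := bmnm (enum_val a).1.
Definition icol (a : 'I_M) : 'I_n := (enum_val a).2.

Lemma imon_lt a : (mdeg (imon a) < N)%N.
Proof. exact: bmdeg. Qed.

Lemma idx_eq a b : imon a = imon b -> icol a = icol b -> a = b.
Proof.
move=> ab1 ab2; apply: enum_val_inj; rewrite [LHS]surjective_pairing [RHS]surjective_pairing.
by congr pair => //; exact: val_inj.
Qed.

Lemma idx_onto m j : (mdeg m < N)%N -> exists2 a : 'I_M, imon a = m & icol a = j.
Proof.
move=> mN; exists (enum_rank ((BMultinom mN : mon), j)).
  by rewrite /imon enum_rankK.
by rewrite /icol enum_rankK.
Qed.

Definition coef_row (v : 'I_n -> mpoly d C) : 'rV[C]_M :=
  \row_a mcoeff (imon a) (v (icol a)).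

(** Multiplication by the k-th variable modulo degree [N], acting on coefficient rows from the
    right. *)
Definition shiftmx (k : 'I_d) : 'M[C]_M := \matrix_(a, b)
  ((imon b == mnm_add (imon a) (mnm1 k)) && (icol b == icol a))%:R.

(** The sum over j of S_k^j times its adjoint, where S_k is the k-th shift. It does not depend on k,
    hence solves all the Stein equations K - S_k K S_k^* = 1 together. *)
Definition weightmx : 'M[C]_M := diag_mx (\row_a (N - mdeg (imon a))%:R).

Definition topmx : 'M[C]_M := diag_mx (\row_a ((mdeg (imon a)).+1 == N)%:R).

Lemma coef_row_onto (h : 'rV[C]_M) : exists v, coef_row v = h.
Proof.
exists (fun j => \sum_(a : 'I_M | icol a == j) h 0 a *: mpolyX C (imon a)).
apply/rowP => b; rewrite mxE raddf_sum /= (bigD1 b)//= mcoeffZ mcoeffX eqxx mulr1.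
rewrite big1 ?addr0// => a /andP[/eqP ab1 ab].
rewrite mcoeffZ mcoeffX; case: eqP => [ab2|_]; rewrite ?mulr0//.
by rewrite (idx_eq ab2 ab1) eqxx in ab.
Qed.

Lemma coef_rowP v w : (forall j m, (mdeg m < N)%N -> mcoeff m (v j) = mcoeff m (w j)) ->
  coef_row v = coef_row w.
Proof. by move=> vw; apply/rowP => a; rewrite !mxE vw ?imon_lt. Qed.

Lemma mcoeff_mul_var k (m : multinom d) (p : mpoly d C) : mcoeff m (mpolyX C (mnm1 k) * p) =
  if lem (mnm1 k) m then mcoeff (mnm_sub m (mnm1 k)) p else 0.
Proof.
case: ifPn => km.
  by rewrite mulrC -[in LHS](submK km) addmC mcoeffMX.
rewrite mcoeffM big1// => -[m1 m2] /= /eqP mE; rewrite mcoeffX.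
case: eqP => [k1|_]; last by rewrite mul0r.
by case/negP: km; rewrite mE -k1 lem_addr.
Qed.

Lemma coef_row_shift v k :
  coef_row v *m shiftmx k = coef_row (fun j => mpolyX C (mnm1 k) * v j).
Proof.
apply/rowP => b; rewrite mxE [RHS]mxE mcoeff_mul_var; case: ifPn => kb.
  have [|a a1 a2] := @idx_onto (mnm_sub (imon b) (mnm1 k)) (icol b).
    by apply: leq_ltn_trans (imon_lt b); exact: mdegB.
  rewrite (bigD1 a)//= !mxE a1 a2 submK// !eqxx mulr1 big1 ?addr0// => c ca.
  rewrite !mxE; case: andP => [[/eqP c1 /eqP c2]|_]; last by rewrite mulr0.
  by move: ca; rewrite (@idx_eq c a) ?eqxx ?a2// a1 c1 addmK.
apply: big1 => a _; rewrite !mxE.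
case: andP => [[/eqP a1 _]|_]; last by rewrite mulr0.
by move: kb; rewrite a1 lem_addl.
Qed.

Lemma shiftmx_comm j k : shiftmx j *m shiftmx k = shiftmx k *m shiftmx j.
Proof.
apply/row_matrixP => i; rewrite !rowE !mulmxA.
have [v <-] := coef_row_onto (delta_mx 0 i); rewrite !coef_row_shift.
by apply: coef_rowP => l m _; rewrite mulrCA.
Qed.

Lemma shift_case k a :
  (exists b, [/\ imon b = mnm_add (imon a) (mnm1 k), icol b = icol a,
     ((mdeg (imon a)).+1 < N)%N & forall c, shiftmx k a c = (c == b)%:R]) \/
  (mdeg (imon a)).+1 = N /\ forall c, shiftmx k a c = 0.
Proof.
have dE : mdeg (mnm_add (imon a) (mnm1 k)) = (mdeg (imon a)).+1.
  by rewrite mdegD mdeg1 addn1.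
have [aN|] := ltnP (mdeg (imon a)).+1 N.
  left; have [|b b1 b2] := @idx_onto (mnm_add (imon a) (mnm1 k)) (icol a).
    by rewrite dE.
  exists b; split=> // c; rewrite mxE -b1 -b2.
  have [->|cb] := eqVneq c b; first by rewrite !eqxx.
  by case: andP => // -[/eqP c1 /eqP c2]; rewrite (idx_eq c1 c2) eqxx in cb.
move=> Na; right; split=> [|c]; first by apply/eqP; rewrite eqn_leq Na imon_lt.
rewrite mxE; case: andP => // -[/eqP c1 _].
by have := imon_lt c; rewrite c1 dE ltnNge Na.
Qed.

(** A shift lowers the weight by one; in top degree the weight is 1 and the shift is zero. *)
Lemma weight_stein k :
  weightmx - shiftmx k *m weightmx *m (shiftmx k)^t* - 1%:M = 0.
Proof.
have Sc := shift_case k; have Sa a b : shiftmx k a b =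
  ((imon b == mnm_add (imon a) (mnm1 k)) && (icol b == icol a))%:R by rewrite mxE.
move: (shiftmx k) Sc Sa => S Sc SE; apply/matrixP => a b.
have SSE : (S *m weightmx *m S^t*) a b =
    \sum_c S a c * (N - mdeg (imon c))%:R * (S b c)^*.
  by rewrite mul_mx_diag mxE; apply: eq_bigr => c _; rewrite !mxE.
rewrite mxE [X in X + _]mxE [X in _ + X + _]mxE SSE !mxE.
have [[a' [a1 a2 aN Sa]]|[aN Sa]] := Sc a; last first.
  rewrite big1 => [|c _]; last by rewrite Sa !mul0r.
  have -> : (N - mdeg (imon a))%N = 1%N.
    by apply/eqP; rewrite -(eqn_add2r (mdeg (imon a))) subnK ?add1n ?aN// ltnW ?imon_lt.
  by rewrite subr0 subrr.
rewrite (bigD1 a')//= big1 ?addr0 => [|c ca]; last by rewrite Sa (negPf ca) !mul0r.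
rewrite Sa eqxx mul1r SE a1 a2 rmorph_nat.
have -> : (mnm_add (imon a) (mnm1 k) == mnm_add (imon b) (mnm1 k)) && (icol a == icol b) = (a == b).
  rewrite eqm_add2r; apply/andP/eqP => [[/eqP ab1 /eqP ab2]|->//].
  exact: idx_eq.
case: eqP => [_|_]; last by rewrite !mulr0n mulr0 !subr0.
rewrite !mulr1n mulr1 mdegD mdeg1 addn1 -(subnSK (ltnW aN)) -natr1.
by rewrite addrAC addrK subrr.
Qed.

Lemma weight_ge1 : psdmx (weightmx - 1%:M).
Proof.
have -> : weightmx - 1%:M = diag_mx (\row_a (N - mdeg (imon a) - 1)%:R).
  apply/matrixP => a b; rewrite !mxE; case: eqVneq => [_|_]; last by rewrite subr0.
  by rewrite !mulr1n [in RHS]natrB// subn_gt0 imon_lt.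
by apply: psdmx_diag => a; rewrite mxE ler0n.
Qed.

Lemma shift_adj k : shiftmx k *m (shiftmx k)^t* = 1%:M - topmx.
Proof.
have Sc := shift_case k; have Sa a b : shiftmx k a b =
  ((imon b == mnm_add (imon a) (mnm1 k)) && (icol b == icol a))%:R by rewrite mxE.
move: (shiftmx k) Sc Sa => S Sc SE; apply/matrixP => a b.
have SSE : (S *m S^t*) a b = \sum_c S a c * (S b c)^*.
  by rewrite mxE; apply: eq_bigr => c _; rewrite !mxE.
rewrite SSE !mxE.
have [[a' [a1 a2 aN Sa]]|[aN Sa]] := Sc a; last first.
  rewrite big1 => [|c _]; last by rewrite Sa !mul0r.
  by rewrite aN eqxx subrr.
rewrite (bigD1 a')//= big1 ?addr0 => [|c ca]; last by rewrite Sa (negPf ca) !mul0r.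
rewrite Sa eqxx mul1r SE a1 a2 rmorph_nat.
have -> : (mnm_add (imon a) (mnm1 k) == mnm_add (imon b) (mnm1 k)) && (icol a == icol b) = (a == b).
  rewrite eqm_add2r; apply/andP/eqP => [[/eqP ab1 /eqP ab2]|->//].
  exact: idx_eq.
by rewrite (ltn_eqF aN) mul0rn subr0.
Qed.

Definition evalmx (z : 'I_d -> C) : 'M[C]_(M, n) := \matrix_(a, j)
  (meval z (mpolyX C (imon a)) * (icol a == j)%:R).

(** Truncation is felt only in the rows of top degree, where the shift is zero; in all others it
    acts on values as multiplication by [z k]. *)
Lemma shift_evalmx k z :
  shiftmx k *m evalmx z = z k *: ((1%:M - topmx) *m evalmx z).
Proof.
have Sc := shift_case k.
move: (shiftmx k) Sc => S Sc; apply/matrixP => a j.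
rewrite mulmxBl mul1mx mul_diag_mx mxE [RHS]mxE [X in _ = _ * X]mxE [X in _ = _ * (_ + X)]mxE.
rewrite [X in _ = _ * (_ - X)]mxE [X in _ = _ * (_ - X * _)]mxE.
have [[a' [a1 a2 aN Sa]]|[aN Sa]] := Sc a; last first.
  by rewrite big1 => [|c _]; rewrite ?Sa ?mul0r// aN eqxx mul1r subrr mulr0.
rewrite (bigD1 a')//= big1 ?addr0 => [|c ca]; last by rewrite Sa (negPf ca) !mul0r.
rewrite Sa eqxx mul1r (ltn_eqF aN) mul0r subr0 !mxE a1 a2 mpolyXD mevalM mevalXU.
by rewrite mulrA [z k * _]mulrC.
Qed.

Lemma coef_row_evalmx v z j : (forall j, (msize (v j) <= N)%N) ->
  (coef_row v *m evalmx z) 0 j = meval z (v j).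
Proof.
move=> vN; rewrite mxE [in RHS](mpolywE (vN j)) raddf_sum /=.
rewrite (bigID (fun a => icol a == j))/= [X in _ + X]big1 ?addr0 => [|a /negPf aj].
  rewrite (reindex_onto (fun m : mon => enum_rank (m, j)) (fun a => (enum_val a).1))/=.
    rewrite (eq_bigl xpredT) => [|m]; last by rewrite /icol enum_rankK !eqxx.
    by apply: eq_bigr => m _; rewrite !mxE /icol /imon enum_rankK eqxx mulr1 mevalZ.
  move=> a /eqP <-; apply: enum_val_inj; rewrite enum_rankK /icol.
  by case: (enum_val a).
by rewrite !mxE aj !mulr0.
Qed.

(** The index [None] carries the zero shift: its Stein term is the matrix itself, which provides the
    slack l_0, and its dual condition is G >= 0. *)
Definition shift_option (o : option 'I_d) : 'M[C]_M :=
  if o is Some k then shiftmx k else 0.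

Definition scalar_rows (p : mpoly d C) : 'M[C]_(n, M) :=
  \matrix_i coef_row (fun j => if i == j then p else 0).

Definition poly_rows (Q : 'M[mpoly d C]_n) : 'M[C]_(n, M) :=
  \matrix_i coef_row (Q i).

Lemma sum_idx (f : 'I_n -> multinom d -> C) :
  \sum_(a : 'I_M) f (icol a) (imon a) = \sum_j \sum_(m : mon) f j m.
Proof.
rewrite exchange_big pair_big /= (reindex (enum_rank : idx -> 'I_M))/=.
  by apply: eq_bigr => -[m j] _; rewrite /icol /imon enum_rankK.
exact/onW_bij/enum_rank_bij.
Qed.

Lemma trace_rows (p : mpoly d C) (Q : 'M[mpoly d C]_n) :
  (forall i j, \sum_k \sum_(m : mon) (mcoeff m (Q k i))^* * mcoeff m (Q k j) =
    \sum_(m : mon) (mcoeff m p)^* * mcoeff m p *+ (i == j)) ->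
  \tr ((scalar_rows p)^t* *m scalar_rows p - (poly_rows Q)^t* *m poly_rows Q) = 0.
Proof.
move=> pQ; rewrite raddfB /= !mxtr_adjM; apply/eqP; rewrite subr_eq0; apply/eqP.
transitivity (\sum_(j < n) \sum_(m : mon) (mcoeff m p)^* * mcoeff m p).
  rewrite -(sum_idx (fun j m => (mcoeff m p)^* * mcoeff m p)); apply: eq_bigr => a _.
  rewrite (bigD1 (icol a))//= big1 ?addr0 => [|i ia].
    by rewrite !mxE eqxx normCK mulrC.
  by rewrite !mxE (negPf ia) mcoeff0 normr0 expr0n.
transitivity (\sum_(j < n) \sum_(k < n) \sum_(m : mon) (mcoeff m (Q k j))^* * mcoeff m (Q k j)).
  by apply: eq_bigr => j _; rewrite pQ; apply: eq_bigr => m _; rewrite eqxx mulr1n.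
rewrite (eq_bigr (fun j => \sum_(m : mon) \sum_(k < n) (mcoeff m (Q k j))^* * mcoeff m (Q k j))).
  rewrite -(sum_idx (fun j m => \sum_(k < n) (mcoeff m (Q k j))^* * mcoeff m (Q k j))).
  apply: eq_bigr => a _; apply: eq_bigr => k _.
  by rewrite !mxE normCK mulrC.
by move=> j _; exact: exchange_big.
Qed.

End TruncatedShift.

Section RightMultiplication.
Variables (R : realType) (m : nat) (B : 'M[R[i]]_m).

Definition mulr_op (x : l2space R m) : l2space R m := (x : 'rV_m) *m B.

Lemma mulr_op_linear : linear mulr_op.
Proof. by move=> a x y; rewrite /mulr_op mulmxDl -scalemxAl. Qed.

HB.instance Definition _ := GRing.isLinear.Build R[i] (l2space R m) (l2space R m) _
  mulr_op mulr_op_linear.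

End RightMultiplication.

Lemma conjmx_comm (K : fieldType) m (W A B : 'M[K]_m) (x : 'rV[K]_m) :
  W \in unitmx -> A *m B = B *m A ->
  x *m (invmx W *m A *m W) *m (invmx W *m B *m W) =
  x *m (invmx W *m B *m W) *m (invmx W *m A *m W).
Proof.
move=> Wu AB; rewrite -!mulmxA; do 2!congr (_ *m _).
by rewrite !(mulKVmx Wu) !mulmxA AB.
Qed.

Lemma op_monomial_mul (A : comNzRingType) (V : Type) d (a : 'I_d -> A)
    (t : multiindex d) (v : V -> A) :
  op_monomial (fun k (v : V -> A) j => a k * v j) t v =
  (fun j => (\prod_k a k ^+ t k) * v j).
Proof.
rewrite /op_monomial; elim/big_rec2: _ => [|k f g _ fg] /=.
  by apply/funext => j; rewrite mul1r.
rewrite fg; elim: (t k) => [|m IHm] /=; first by apply/funext => j; rewrite mul1r.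
by rewrite IHm; apply/funext => j; rewrite exprS !mulrA.
Qed.

Lemma low_degree_fset d N : exists A0 : {fset multiindex d},
  forall t, (mabs t < N)%N -> t \in A0.
Proof.
exists [fset x in [seq [ffun k => bmnm m k] | m <- enum {: bmultinom d N}]]%fset.
move=> t tN; have mN : (mdeg (mnm_of t) < N)%N by rewrite mdeg_mnm_of.
rewrite inE; apply/mapP; exists (BMultinom mN); first by rewrite mem_enum.
by apply/ffunP => k; rewrite ffunE /= mnm_ofE.
Qed.

Lemma mcoeff_mul_sum (K : comNzRingType) d (I : Type) (r : seq I) (a : I -> K)
    (q : I -> mpoly d K) p m :
  mcoeff m (p * \sum_(t <- r) a t *: q t) = \sum_(t <- r) a t * mcoeff m (q t * p).
Proof.
rewrite mulr_sumr raddf_sum /=; apply: eq_bigr => t _.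
by rewrite -scalerAr mcoeffZ mulrC [p * _]mulrC mulrC.
Qed.

Lemma meval_sum_scale (K : comNzRingType) d (I : Type) (r : seq I) (a : I -> K)
    (q : I -> mpoly d K) z :
  meval z (\sum_(t <- r) a t *: q t) = \sum_(t <- r) a t * meval z (q t).
Proof. by rewrite raddf_sum /=; apply: eq_bigr => t _; rewrite mevalZ. Qed.

(** * The Schur-Agler inequality at the truncated shifts *)

Section AglerCertificate.
Variables (R : realType) (d n : nat).
Local Notation C := R[i].
Variables (c : multiindex d -> 'M[C]_n) (F : ('I_d -> C) -> 'M[C]_n).
Hypothesis cF : power_series_expansion c F.
Hypothesis contractive : forall (H : completeNormedModType C)
    (ip : {dot H for Num.conj}) (T : 'I_d -> {linear H -> H}),
  is_inner_product ip -> commuting_strict_contractions T ->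
  exists2 L : {linear {ffun 'I_n -> H} -> {ffun 'I_n -> H}},
    op_power_series c T L & (opnorm (@l2norm R H n) (@l2norm R H n) L <= 1)%E.

Definition quotient_on (p : mpoly d C) (Q : 'M[mpoly d C]_n) :=
  forall z i j, polydisk z -> meval z p * F z i j = meval z (Q i j).

Definition partial_poly (A : {fset multiindex d}) i j : mpoly d C :=
  \sum_(t <- A) c t i j *: mpolyX C (mnm_of t).

Lemma meval_partial_poly A i j z : meval z (partial_poly A i j) =
  \sum_(t <- A) c t i j * monomial z t.
Proof.
rewrite /partial_poly meval_sum_scale; apply: eq_bigr => t _.
by rewrite meval_mnm_of.
Qed.

(** At a point a u the two sides differ by [p] times the remainder of the power series of [F], which
    is O(a^N). The order of vanishing at the origin thus replaces a multiplication of power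
    series. *)
Lemma quotient_truncation p Q N (A : {fset multiindex d}) i j (m : multinom d) :
  quotient_on p Q -> (forall t, (mabs t < N)%N -> t \in A) -> (mdeg m < N)%N ->
  mcoeff m (p * partial_poly A i j) = mcoeff m (Q i j).
Proof.
move=> pQ AN mN; apply/eqP; rewrite -subr_eq0 -mcoeffB; apply/eqP.
apply: (mpoly_small_coef0 _ mN) => u u3.
have [K K0 FK] := power_series_tail cF i j u3.
pose B := \sum_(m <- msupp p) `|mcoeff m p|.
exists (B * K) => a a0 a1.
have aD : polydisk (fun k => a * u k).
  move=> k; rewrite normrM (ger0_norm (ltW a0)).
  apply: (@le_lt_trans _ _ (3%:R^-1)); last by rewrite invf_lt1 ?ltr0n// ltr1n.
  by rewrite -[leRHS]mul1r ler_pM// ltW.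
rewrite mevalB mevalM -(pQ _ _ _ aD) -mulrBr normrM -mulrA.
apply: ler_pM => //.
  rewrite mevalE (le_trans (ler_norm_sum _ _ _))//; apply: ler_sum => m' _.
  rewrite normrM ler_piMr// normr_prod.
  by apply: prodr_ile1 => k _; rewrite normr_ge0/= normrX exprn_ile1// ltW// aD.
rewrite distrC meval_partial_poly; exact: FK.
Qed.

Section Contractive.
Variable N : nat.
Local Notation M := #|{: bmultinom d N * 'I_n}|.

Variables (W : 'M[C]_M) (e : C).
Hypothesis (e0 : 0 < e) (Wu : W \in unitmx).
Hypothesis Wpsd : forall k : 'I_d, psdmx (W *m W^t* -
  shiftmx C n N k *m (W *m W^t*) *m (shiftmx C n N k)^t* - e%:M).

Let T (k : 'I_d) : {linear l2space R M -> l2space R M} :=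
  mulr_op (invmx W *m shiftmx C n N k *m W).

Let T_strict : commuting_strict_contractions T.
Proof.
split=> [j k x|k]; last exact: stein_strict_contraction e0 Wu (Wpsd k).
rewrite /T /= /mulr_op.
apply: conjmx_comm => //; exact: shiftmx_comm.
Qed.

Let phi (v : 'I_n -> mpoly d C) : l2space R M := coef_row N v *m W.

Let T_phi t v : op_monomial (fun k => T k) t (phi v) =
  phi (fun j => mpolyX C (mnm_of t) * v j).
Proof.
rewrite (@op_monomial_intertwine _ _ _ (fun k v j => mpolyX C (mnm1 k) * v j)).
  congr phi; rewrite op_monomial_mul; apply/funext => j; congr (_ * _).
  rewrite [RHS]mpolyXE_id; apply: eq_bigr => k _; by rewrite mnm_ofE.
move=> k u; rewrite /T /= /mulr_op /phi -coef_row_shift.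
by rewrite !mulmxA mulmxK.
Qed.

(** The i-th component of the input is p times the i-th unit row. The operator F(T) turns it into
    row i of p F, that is, of Q. The truncation makes this exact as soon as [A] contains all degrees
    below [N]. *)
Let partial_sum_phi A p Q i : quotient_on p Q ->
  (forall t, (mabs t < N)%N -> t \in A) ->
  partial_sum (fun t => tensor_op (c t) (op_monomial (fun k => T k) t)
    [ffun i => phi (fun j => if i == j then p else 0)]) A i = phi (Q i).
Proof.
move=> pQ AN; rewrite partial_sumE sum_ffunE.
pose v t (j : 'I_n) l := mpolyX C (mnm_of t) * (if j == l then p else 0).
transitivity ((\sum_(t <- A) \sum_j c t i j *: coef_row N (v t j)) *m W).
  rewrite mulmx_suml; apply: eq_bigr => t _; rewrite ffunE mulmx_suml.
  by apply: eq_bigr => j _; rewrite ffunE T_phi -scalemxAl.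
congr (_ *m _); apply/rowP => a; rewrite [RHS]mxE.
rewrite -(quotient_truncation _ _ pQ AN (imon_lt a)) summxE.
rewrite /partial_poly mcoeff_mul_sum; apply: eq_bigr => t _; rewrite summxE.
rewrite (eq_bigr (fun j => c t i j * mcoeff (imon a) (v t j (icol a)))); last first.
  by move=> j _; rewrite [LHS]mxE; congr (_ * _); rewrite mxE.
rewrite (bigD1 (icol a))//= big1 ?addr0 => [|j ja].
  by rewrite /v eqxx.
by rewrite /v (negPf ja) mulr0 mcoeff0 mulr0.
Qed.

Lemma tuple_rows_contractive p Q : quotient_on p Q ->
  \sum_i sqnorm (row i (scalar_rows n N p) *m W) <= 1 ->
  \sum_i sqnorm (row i (poly_rows N Q) *m W) <= 1.
Proof.
move=> pQ x1.
pose x : {ffun 'I_n -> l2space R M} :=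
  [ffun i => phi (fun j => if i == j then p else 0)].
pose y : {ffun 'I_n -> l2space R M} := [ffun i => phi (Q i)].
have xE : \sum_i sqnorm (row i (scalar_rows n N p) *m W) = \sum_i `|x i| ^+ 2.
  apply: eq_bigr => i _; rewrite l2_norm_sqr rowK /x ffunE; exact: erefl.
have yE : \sum_i sqnorm (row i (poly_rows N Q) *m W) = \sum_i `|y i| ^+ 2.
  apply: eq_bigr => i _; rewrite l2_norm_sqr rowK /y ffunE; exact: erefl.
have ip : is_inner_product (@dotmx C M : {dot l2space R M for Num.conj}).
  by move=> z; rewrite l2_norm_sqr; exact: (sqnorm_dotmx (z : 'rV_M)).
have [L TL L1] := contractive ip T_strict.
have sum0 (z : {ffun 'I_n -> l2space R M}) : 0 <= \sum_i `|z i| ^+ 2.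
  by apply: sumr_ge0 => i _; rewrite exprn_ge0.
have nx1 : l2norm x <= 1.
  by rewrite /l2norm -sqrtC1 ler_sqrtC ?nnegrE ?ler01 ?sum0// -xE.
have ny0 (z : {ffun 'I_n -> l2space R M}) : 0 <= l2norm z.
  by rewrite sqrtC_ge0 sum0.
have nyE (z : {ffun 'I_n -> l2space R M}) : l2norm z = (complex.Re (l2norm z))%:C%C.
  by rewrite RRe_real// ger0_real.
(* The partial sums at [x] are eventually constant, equal to [y], so norm convergence identifies the
   limit exactly. *)
have Lx : L x = y.
  have [A0 A0N] := low_degree_fset d N.
  have le_e (e' : R) : 0 < e' -> complex.Re (l2norm (y - L x)) <= e'.
    move=> e'0.
    have /TL[A1 _ A1P] : nbhs 0%E [set z | (z < e'%:E)%E].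
      apply: open_nbhs_nbhs; split; last by rewrite /= lte_fin.
      exact: open_ereal_lt_ereal.
    have /= := A1P (A0 `|` A1)%fset (fsubsetUr _ _).
    move=> /(le_lt_trans (le_opnorm _ _ nx1)); rewrite lte_fin => /ltW.
    rewrite (_ : partial_sum _ _ = y)//; apply/ffunP => i.
    rewrite [RHS]ffunE /x; apply: partial_sum_phi => // t tN.
    by rewrite inE A0N.
  have /eqP : l2norm (y - L x) = 0.
    apply: le_anti; rewrite ny0 andbT nyE -(rmorph0 (real_complex R)) lecR.
    by apply/ler_addgt0Pl => e' e'0; rewrite addr0 le_e.
  rewrite sqrtC_eq0 => /eqP/psumr_eq0P yL0; apply/ffunP => i; apply/eqP.
  rewrite eq_sym -subr_eq0 -normr_eq0 -sqrf_eq0; apply/eqP.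
  have := yL0 _ i isT; rewrite !ffunE => -> // j _; rewrite exprn_ge0.
have := le_trans (le_opnorm _ L nx1) L1.
rewrite Lx lee_fin -lecR -nyE => y1.
rewrite yE -[leLHS]sqrtCK -[leRHS](expr1n _ 2).
by rewrite ler_pXn2r ?nnegrE ?ny0.
Qed.

End Contractive.
End AglerCertificate.

Section AglerDecomposition.
Variables (R : realType) (d n : nat).
Local Notation C := R[i].
Variables (c : multiindex d -> 'M[C]_n) (F : ('I_d -> C) -> 'M[C]_n).
Hypothesis cF : power_series_expansion c F.
Hypothesis contractive : forall (H : completeNormedModType C)
    (ip : {dot H for Num.conj}) (T : 'I_d -> {linear H -> H}),
  is_inner_product ip -> commuting_strict_contractions T ->
  exists2 L : {linear {ffun 'I_n -> H} -> {ffun 'I_n -> H}},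
    op_power_series c T L & (opnorm (@l2norm R H n) (@l2norm R H n) L <= 1)%E.
Variables (p : mpoly d C) (Q : 'M[mpoly d C]_n) (N : nat).
Hypothesis pQ : quotient_on F p Q.
Local Notation M := #|{: bmultinom d N * 'I_n}|.

Let P0 := scalar_rows n N p.
Let Q0 := poly_rows N Q.
Let g : 'M[C]_M := P0^t* *m P0 - Q0^t* *m Q0.

Let weight_psd o : psdmx (weightmx C d n N -
  shift_option C n N o *m weightmx C d n N *m (shift_option C n N o)^t* - 1%:M).
Proof.
case: o => [k|] /=; first by rewrite weight_stein; exact: psdmx0.
by rewrite !mul0mx subr0; exact: weight_ge1.
Qed.

(** All multiples of the pair are needed for the scaling argument on unit balls. *)
Lemma scaled_quotient (a : C) : quotient_on F (a *: p) (map_mx (fun q => a *: q) Q).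
Proof.
move=> z i j zD; rewrite mxE.
rewrite -[RHS]/(meval z (a *: Q i j)) (_ : meval z (a *: Q i j) = a * meval z (Q i j)).
  rewrite (_ : meval z (a *: p) = a * meval z p); last exact: mevalZ.
  by rewrite -(pQ i j zD) mulrA.
exact: mevalZ.
Qed.

Let coef_rowZ (a : C) v :
  coef_row N (fun j => a *: v j : mpoly d C) = a *: coef_row N v :> 'rV[C]_M.
Proof.
by apply/rowP => b; rewrite mxE [RHS]mxE [X in _ = _ * X]mxE; exact: mcoeffZ.
Qed.

Lemma Agler_certificate : exists2 l : option 'I_d -> 'M[C]_M,
  forall o, psdmx (l o) & g = stein (shift_option C n N) l.
Proof.
have g_herm : g^t* = g by rewrite adjmxB !adjmxM !trmxCK.
have [[l lpsd gE]|[G [Gh Gpsd Gg]]] := stein_separation weight_psd g_herm.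
  by exists l.
have [W [e [e0 Wu Wpsd Wg]]] :=
  dual_perturbation (i0 := None) erefl g_herm weight_psd Gpsd Gg.
suff : 0 <= \tr (W *m W^t* *m g) by rewrite (lt_geF Wg).
apply: mxtr_gram_ge0 => a.
have := tuple_rows_contractive cF contractive e0 Wu (fun k => Wpsd (Some k))
  (scaled_quotient a).
rewrite (_ : scalar_rows n N (a *: p) = a *: P0).
  rewrite (_ : poly_rows N (map_mx (fun q => a *: q) Q) = a *: Q0) //.
  apply/row_matrixP => i; rewrite rowK [RHS]linearZ /= rowK -coef_rowZ.
  by congr coef_row; apply/funext => j; rewrite mxE.
apply/row_matrixP => i; rewrite rowK [RHS]linearZ /= rowK -coef_rowZ.
by congr coef_row; apply/funext => j; case: ifP => // _; rewrite scaler0.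
Qed.

End AglerDecomposition.

(** * Inner functions and the polynomial decomposition *)

Section ReversePolynomials.
Variables (C : numClosedFieldType) (d N : nat).

Definition top_mnm : multinom d := Multinom [tuple N | _ < d].

Lemma top_mnmE k : top_mnm k = N.
Proof. by rewrite /fun_of_multinom tnth_mktuple. Qed.

Lemma lem_top_mnm (m : bmultinom d N) : lem m top_mnm.
Proof.
apply/mnm_lepP => k; rewrite top_mnmE; apply: leq_trans (ltnW (bmdeg m)).
by rewrite mdegE (bigD1 k)//= leq_addr.
Qed.

(* On the torus, where the conjugate of w is its inverse, this polynomial is
   the conjugate of q times the monomial of exponent top_mnm. *)
Definition reverse_mpoly (q : mpoly d C) : mpoly d C :=
  \sum_(m : bmultinom d N) (mcoeff m q)^* *: mpolyX C (mnm_sub top_mnm m).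

Lemma mpoly_bounded_sum (q : mpoly d C) : (msize q <= N)%N ->
  q = \sum_(m : bmultinom d N) mcoeff m q *: mpolyX C m.
Proof. by move=> qN; rewrite {1}(mpolywE qN). Qed.

Lemma meval_reverse q w : (msize q <= N)%N -> (forall k, `|w k| = 1) ->
  meval w (reverse_mpoly q) = meval w (mpolyX C top_mnm) * (meval w q)^*.
Proof.
move=> qN w1.
have -> : meval w q = \sum_(m : bmultinom d N) mcoeff m q * meval w (mpolyX C m).
  rewrite {1}(mpoly_bounded_sum qN) (raddf_sum (meval w)).
  by apply: eq_bigr => m _; exact: mevalZ.
rewrite [in RHS]rmorph_sum mulr_sumr /reverse_mpoly (raddf_sum (meval w)) /=.
apply: eq_bigr => m _; rewrite mevalZ rmorphM mulrCA; congr (_ * _).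
rewrite -{2}(submK (lem_top_mnm m)) mpolyXD mevalM -mulrA -normCK.
suff -> : `|meval w (mpolyX C m)| = 1 by rewrite expr1n mulr1.
by rewrite mevalX normr_prod big1// => k _; rewrite normrX w1 expr1n.
Qed.

(** The inner product of the coefficient vectors, algebraic form of the integral of conj(p) q over
    the torus. *)
Lemma mcoeff_reverseM p q : mcoeff top_mnm (reverse_mpoly p * q) =
  \sum_(m : bmultinom d N) (mcoeff m p)^* * mcoeff m q.
Proof.
rewrite mulr_suml raddf_sum /=; apply: eq_bigr => m _.
rewrite -scalerAl mcoeffZ mulrC [in RHS]mulrC; congr (_ * _).
by rewrite -{1}(submK (lem_top_mnm m)) mulrC mcoeffMX.
Qed.

(** Cayley transforms of the natural numbers. *)
Lemma circle_infinite K : exists2 s : 'I_K -> C, injective s & forall i, `|s i| = 1.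
Proof.
have cj (t : nat) : (1 - t%:R * 'i : C)^* = 1 + t%:R * 'i.
  by rewrite rmorphB rmorph1 rmorphM rmorph_nat /= conjCi mulrN opprK.
have nz (t : nat) : 1 - t%:R * 'i != 0 :> C.
  apply/eqP => e0; have : (1 - t%:R * 'i) * (1 + t%:R * 'i) = 1 + t%:R ^+ 2 :> C.
    by rewrite -subr_sqr expr1n exprMn sqrCi mulrN1 opprK.
  rewrite e0 mul0r => h; have : 0 < 1 + t%:R ^+ 2 :> C.
    by rewrite ltr_wpDr// -natrX ler0n.
  by rewrite -h ltxx.
exists (fun t => (1 + t%:R * 'i) / (1 - t%:R * 'i)) => [t u|t]; last first.
  by rewrite normrM normfV -cj norm_conjC divff// normr_eq0.
move=> /eqP; rewrite eqr_div// -subr_eq0.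
have -> : (1 + t%:R * 'i) * (1 - u%:R * 'i) - (1 + u%:R * 'i) * (1 - t%:R * 'i) =
    2%:R * 'i * (t%:R - u%:R) :> C by ring.
rewrite !mulf_eq0 pnatr_eq0 (negPf (neq0Ci C))/= subr_eq0 eqr_nat.
by move=> /eqP/val_inj.
Qed.

(** On the torus [H i j] is a monomial times an entry of the defect of the identity. The defect is
    known to vanish only off the zeros of [D], so [H i j * D] vanishes on the torus and is zero as a
    polynomial. Evaluating [H i j = 0] gives the identity on the whole torus; its coefficient at
    [top_mnm] gives Parseval's identity. *)
Lemma torus_identity n (p D : mpoly d C) (Q : 'M[mpoly d C]_n) :
  (msize p <= N)%N -> (forall i j, (msize (Q i j) <= N)%N) -> D != 0 ->
  (forall w : 'I_d -> C, (forall k, `|w k| = 1) -> meval w D != 0 ->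
     (map_mx (meval w) Q)^t* *m map_mx (meval w) Q =
     ((meval w p)^* * meval w p)%:M) ->
  (forall w : 'I_d -> C, (forall k, `|w k| = 1) ->
     (map_mx (meval w) Q)^t* *m map_mx (meval w) Q =
     ((meval w p)^* * meval w p)%:M) /\
  (forall i j, \sum_k \sum_(m : bmultinom d N)
      (mcoeff m (Q k i))^* * mcoeff m (Q k j) =
    \sum_(m : bmultinom d N) (mcoeff m p)^* * mcoeff m p *+ (i == j)).
Proof.
move=> pN QN D0 pQ.
pose H i j := \sum_k reverse_mpoly (Q k i) * Q k j - reverse_mpoly p * p *+ (i == j).
have HE w i j : (forall k, `|w k| = 1) -> meval w (H i j) = meval w (mpolyX C top_mnm) *
    ((map_mx (meval w) Q)^t* *m map_mx (meval w) Q -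
     ((meval w p)^* * meval w p)%:M) i j.
  move=> w1; rewrite /H mevalB [in RHS]mxE [X in _ = _ * (_ + X)]mxE mulrBr mevalMn mevalM meval_reverse//.
  congr (_ - _); last by rewrite !mxE mulrnAr mulrA.
  rewrite (raddf_sum (meval w)) [in RHS]mxE mulr_sumr; apply: eq_bigr => k _ /=.
  by rewrite mevalM meval_reverse// !mxE mulrA.
have H0 i j : H i j = 0.
  suff /eqP : H i j * D = 0 by rewrite mulf_eq0 (negPf D0) orbF => /eqP.
  apply: (@mpoly_vanish C d (fun z => `|z| = 1)) => [K|w w1].
    exact: circle_infinite.
  rewrite mevalM HE//; have [->|Dw] := eqVneq (meval w D) 0; first by rewrite mulr0.
  by rewrite pQ// subrr mxE mulr0 mul0r.
split=> [w w1|i j].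
  apply/eqP; rewrite -subr_eq0; apply/eqP/matrixP => i j; rewrite [RHS]mxE.
  have /eqP := HE w i j w1; rewrite H0 meval0 eq_sym mulf_eq0.
  case/orP => [|/eqP//]; rewrite mevalX prodf_seq_eq0 => /hasP[k _ /=].
  by rewrite expf_eq0 -normr_eq0 w1 oner_eq0 andbF.
apply/eqP; rewrite -subr_eq0 sumrMnl -mcoeff_reverseM.
rewrite -[X in _ == X](mcoeff0 _ top_mnm) -(H0 i j) /H mcoeffB (raddf_sum (mcoeff top_mnm)) mcoeffMn.
by apply/eqP; congr (_ - _); apply: eq_bigr => k _ /=; rewrite mcoeff_reverseM.
Qed.

End ReversePolynomials.

Section FiniteDecomposition.
Variables (C : numClosedFieldType) (d n N : nat).
Local Notation M := #|{: bmultinom d N * 'I_n}|.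
Local Notation top := (topmx C d n N).
Local Notation Z := (evalmx n N).

Lemma topmx_psd : psdmx top.
Proof. by apply: psdmx_diag => a; rewrite mxE ler0n. Qed.

Lemma topmx_idem : top *m top = top.
Proof.
apply/matrixP => a b; rewrite mul_diag_mx !mxE; case: (eqVneq a b) => [->|_].
  by rewrite !mulr1n -natrM mulnb andbb.
by rewrite !mulr0n mulr0.
Qed.

Variables (p : mpoly d C) (Q : 'M[mpoly d C]_n) (l : option 'I_d -> 'M[C]_M).

Local Notation prows := (scalar_rows n N p).
Local Notation Qrows := (poly_rows N Q).
Local Notation opt_shift := (shift_option C n N).

Hypothesis l_psd : forall o, psdmx (l o).
Hypothesis certificate : prows^t* *m prows - Qrows^t* *m Qrows =
  \sum_o (l o - (opt_shift o)^t* *m l o *m opt_shift o).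
Hypothesis trace0 : \tr (prows^t* *m prows - Qrows^t* *m Qrows) = 0.
Hypothesis (pN : (msize p <= N)%N) (QN : forall i j, (msize (Q i j) <= N)%N).

(** In the trace of the certificate each Stein term contributes the pairing of [l o] with 1 - S S^*,
    which is 1 for [None] and [topmx] for a shift. These nonnegative numbers add up to zero. *)
Lemma certificate_top0 : l None = 0 /\ forall k, \tr (top *m l (Some k)) = 0.
Proof.
have t0 o : 0 <= \tr ((1%:M - opt_shift o *m (opt_shift o)^t*) *m l o).
  apply: psdmx_trM_ge0 => //; case: o => [k|] /=.
    by rewrite shift_adj opprB addrC subrK; exact: topmx_psd.
  by rewrite mul0mx subr0; exact: psdmx1.
have /psumr_eq0P h0 : \sum_o \tr ((1%:M - opt_shift o *m (opt_shift o)^t*) *m l o) = 0.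
  rewrite -[RHS]trace0 certificate [RHS](raddf_sum (@mxtrace _ _)).
  apply: eq_bigr => o _ /=.
  rewrite mulmxBl mul1mx !raddfB /=; congr (_ - _).
  by rewrite mxtrace_mulC mulmxA mxtrace_mulC mulmxA.
have {}h0 o : \tr ((1%:M - opt_shift o *m (opt_shift o)^t*) *m l o) = 0.
  by apply: h0.
split=> [|k]; last first.
  have := h0 (Some k); rewrite /= shift_adj (_ : 1%:M - (1%:M - top) = top)//.
  by rewrite opprB addrC subrK.
have := h0 None; rewrite /= mul0mx subr0 mul1mx.
by have /psdmxP[V ->] := l_psd None => /mxtr_adjM_eq0 ->; rewrite mulmx0.
Qed.

Lemma prows_evalmx z : prows *m Z z = (meval z p)%:M.
Proof.
apply/row_matrixP => i; rewrite row_mul rowK; apply/rowP => j.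
rewrite coef_row_evalmx => [|k]; last by case: eqP; rewrite ?msize0.
rewrite !mxE eq_sym; case: eqP => _; first by rewrite mulr1n.
by rewrite meval0.
Qed.

Lemma Qrows_evalmx z : Qrows *m Z z = map_mx (meval z) Q.
Proof.
apply/row_matrixP => i; rewrite row_mul rowK; apply/rowP => j.
by rewrite coef_row_evalmx// !mxE.
Qed.

(** A factor [V k] of [l (Some k)] kills the top degree, so behind it the truncated shift acts on
    values exactly as multiplication by [z k]. Sandwiching the certificate between evaluation
    matrices gives the kernel. *)
Lemma polynomial_decomposition : exists V : 'I_d -> 'M[C]_M, forall w z,
  ((meval w p)^* * meval z p)%:M - (map_mx (meval w) Q)^t* *m map_mx (meval z) Q =
  \sum_k (1 - (w k)^* * z k) *: ((V k *m Z w)^t* *m (V k *m Z z)).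
Proof.
have [lN lS] := certificate_top0.
have /fin_all_exists[V VP] : forall k, exists V : 'M[C]_M,
    l (Some k) = V^t* *m V /\ V *m top = 0.
  move=> k; have /psdmxP[V VE] := l_psd (Some k); exists V; split=> //.
  have toph : top^t* = top by have [] := topmx_psd.
  apply: mxtr_adjM_eq0; rewrite adjmxM toph !mulmxA mxtrace_mulC !mulmxA.
  by rewrite topmx_idem -mulmxA -VE.
exists V => w z.
have VS k y : V k *m (shiftmx C n N k *m Z y) = y k *: (V k *m Z y).
  rewrite shift_evalmx -scalemxAr mulmxBl mul1mx mulmxBr !mulmxA (VP k).2.
  by rewrite mul0mx subr0.
have -> : ((meval w p)^* * meval z p)%:M - (map_mx (meval w) Q)^t* *m map_mx (meval z) Q
    = (Z w)^t* *m (prows^t* *m prows - Qrows^t* *m Qrows) *m Z z.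
  rewrite -Qrows_evalmx -[map_mx _ Q]Qrows_evalmx adjmxM.
  rewrite scalar_mxM -(prows_evalmx z).
  have -> : ((meval w p)^*)%:M = (prows *m Z w)^t*.
    by rewrite prows_evalmx tr_scalar_mx map_scalar_mx.
  by rewrite adjmxM mulmxBr mulmxBl !mulmxA.
rewrite certificate mulmx_sumr mulmx_suml.
rewrite (bigD1 None)//= lN !mulmx0 subr0 mulmx0 mul0mx add0r.
rewrite (reindex_omap Some id)/=; last by case.
rewrite (eq_bigl xpredT) => [|k]; last by rewrite /= eqxx.
apply: eq_bigr => k _; rewrite (VP k).1.
rewrite mulmxBr mulmxBl scalerBl scale1r; congr (_ - _).
  by rewrite adjmxM !mulmxA.
rewrite -scalerA [in RHS]scalemxAr -VS.
rewrite scalemxAl -adjmxZ -VS !adjmxM !mulmxA//.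
Qed.

End FiniteDecomposition.

Lemma mxdiag_scalarE (K : pzRingType) d (m : 'I_d -> nat) (z : 'I_d -> K) :
  \mxdiag_k ((z k)%:M : 'M[K]_(m k)) = diag_mx (\row_i z (tagnat.sig1 i)).
Proof.
rewrite -[LHS]mulmx1 -[1%:M]submxcolK mul_mxdiag_mxcol; apply/matrixP => i j.
rewrite mxE mul_scalar_mx !mxE tagnat.sig2K.
by rewrite mulr_natr.
Qed.

Section LurkingRealization.
Variables (C : numClosedFieldType) (d n : nat).

Lemma adj_mxcol (m : 'I_d -> nat) q (B : forall k, 'M[C]_(m k, q)) :
  (\mxcol_k B k)^t* = \mxrow_k ((B k)^t*).
Proof. by apply/matrixP => i j; rewrite !mxE. Qed.

Lemma mxdiag_scalar_mul (m : 'I_d -> nat) q (z : 'I_d -> C)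
    (B : forall k, 'M[C]_(m k, q)) :
  \mxdiag_k ((z k)%:M : 'M[C]_(m k)) *m \mxcol_k B k = \mxcol_k (z k *: B k).
Proof.
by rewrite mul_mxdiag_mxcol; apply: eq_mxcol => k; rewrite mul_scalar_mx.
Qed.

Variables (m : 'I_d -> nat) (X : ('I_d -> C) -> Prop).
Variables (theta : forall k, ('I_d -> C) -> 'M[C]_(m k, n)).
Variables (p : ('I_d -> C) -> C) (Q : ('I_d -> C) -> 'M[C]_n).
Hypothesis X_disk : forall z, X z -> forall k, `|z k| < 1.
Hypothesis pQ_theta : forall w z, X w -> X z ->
  ((p w)^* * p z)%:M - (Q w)^t* *m Q z =
  \sum_k (1 - (w k)^* * z k) *: ((theta k w)^t* *m theta k z).

(* Lurking isometry: moving the negative terms to the other side turns the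
   hypothesis into an equality of Gram matrices. *)
Lemma lurking_realization : exists (A : 'M[C]_(\sum_k m k))
    (B : 'M[C]_(\sum_k m k, n)) (C0 : 'M[C]_(n, \sum_k m k)) (D : 'M[C]_n),
  block_mx A B C0 D \is unitarymx /\
  forall z, X z -> let P := \mxdiag_k ((z k)%:M : 'M[C]_(m k)) in
    1%:M - P *m A \in unitmx /\
    Q z = p z *: (D + C0 *m invmx (1%:M - P *m A) *m P *m B).
Proof.
pose Th z := \mxcol_k theta k z.
pose PTh z := \mxcol_k (z k *: theta k z).
have [|U uU UE] := @lurking_unitary_col C {z | X z} (\sum_k m k + n) n
    (fun z => col_mx (PTh (sval z)) (p (sval z))%:M)
    (fun z => col_mx (Th (sval z)) (Q (sval z))).
  move=> [w Xw] [z Xz] /=.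
  rewrite !adjmx_col_mx !mul_row_col !adj_mxcol !mul_mxrow_mxcol.
  have := pQ_theta Xw Xz; move/(congr1 (+%R^~ ((Q w)^t* *m Q z))); rewrite subrK.
  rewrite tr_scalar_mx map_scalar_mx -scalar_mxM => ->.
  rewrite addrA -big_split /=; congr (_ + _); apply: eq_bigr => k _.
  rewrite adjmxZ -scalemxAl -scalemxAr scalerA scalerBl scale1r addrC subrK//.
move: uU UE; rewrite -[U]submxK.
set A := ulsubmx U; set B := ursubmx U; set C0 := dlsubmx U; set D := drsubmx U.
move=> uU UE; exists A, B, C0, D; split=> // z Xz P.
have Pu : 1%:M - P *m A \in unitmx.
  rewrite /P mxdiag_scalarE; apply: (resolvent_unit uU) => i.
  by rewrite mxE X_disk.
split=> //; have := UE (exist _ z Xz); rewrite mul_block_col /=.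
move=> /eq_col_mx[ThE QE].
have PE : P *m Th z = PTh z by rewrite mxdiag_scalar_mul.
(* Eliminating [Th z] from the upper block equation leaves a linear equation for [PTh z], solved by
   the resolvent. *)
have PThE : PTh z = p z *: (invmx (1%:M - P *m A) *m P *m B).
  have : (1%:M - P *m A) *m PTh z = p z *: (P *m B).
    have E : PTh z = P *m A *m PTh z + p z *: (P *m B).
      by rewrite -[LHS]PE -ThE mulmxDr mul_mx_scalar -scalemxAr mulmxA.
    by rewrite mulmxBl mul1mx {1}E addrAC subrr add0r.
  move=> /(congr1 (mulmx (invmx (1%:M - P *m A)))).
  by rewrite mulKmx// -scalemxAr mulmxA.
rewrite -QE PThE mul_mx_scalar -scalemxAr scalerDr addrC !mulmxA//.
Qed.

End LurkingRealization.

(** * Realizations as rational functions *)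

Section RealizationAlgebra.
Variables (C : numClosedFieldType) (d n : nat) (m : 'I_d -> nat).
Local Notation S := (\sum_k m k)%N.
Variables (A : 'M[C]_S) (B : 'M[C]_(S, n)) (C0 : 'M[C]_(n, S)) (D : 'M[C]_n).
Hypothesis unitaryU : block_mx A B C0 D \is unitarymx.

(** Over any ring, so that it also gives the diagonal matrix of the variables over polynomials. *)
Definition structmx (K : pzRingType) (z : 'I_d -> K) : 'M[K]_S :=
  \mxdiag_k ((z k)%:M : 'M[K]_(m k)).

(** Cramer's rule: the adjugate replaces the resolvent and the determinant is carried along, so the
    identities below are polynomial and keep their meaning on the torus, where the resolvent may not
    exist. *)
Definition state_num (z : 'I_d -> C) : 'M[C]_(S, n) :=
  \adj (1%:M - structmx z *m A) *m structmx z *m B.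

Definition state_den (z : 'I_d -> C) : C := \det (1%:M - structmx z *m A).

Definition out_num (z : 'I_d -> C) : 'M[C]_(S, n) :=
  A *m state_num z + state_den z *: B.

Definition tf_num (z : 'I_d -> C) : 'M[C]_n :=
  C0 *m state_num z + state_den z *: D.

Lemma state_numE z : state_num z = structmx z *m out_num z.
Proof.
have E : (1%:M - structmx z *m A) *m state_num z =
    state_den z *: (structmx z *m B).
  by rewrite /state_num !mulmxA mul_mx_adj mul_scalar_mx scalemxAl.
rewrite mulmxDr mulmxA -scalemxAr -E mulmxBl mul1mx addrC subrK//.
Qed.

(** The colligation maps the state together with the input, scaled by the determinant, to the next
    state and the output; being unitary, it preserves Gram matrices. *)
Lemma realization_gram w z :
  (tf_num w)^t* *m tf_num z + (out_num w)^t* *m out_num z =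
  (state_num w)^t* *m state_num z + ((state_den w)^* * state_den z)%:M.
Proof.
have UE y : block_mx A B C0 D *m col_mx (state_num y) (state_den y)%:M =
    col_mx (out_num y) (tf_num y).
  by rewrite mul_block_col !mul_mx_scalar.
have := congr2 (fun a b => a^t* *m b) (UE w) (UE z).
rewrite adjmxM mulmxA -(mulmxA _ (_^t*)) unitary_block_adj// mulmx1.
rewrite !adjmx_col_mx !mul_row_col tr_scalar_mx map_scalar_mx -scalar_mxM => ->.
by rewrite addrC.
Qed.

Lemma gram_submxcol w z : (out_num w)^t* *m out_num z =
  \sum_k (submxcol (out_num w) k)^t* *m submxcol (out_num z) k.
Proof.
by rewrite -{1}[out_num w]submxcolK -{1}[out_num z]submxcolK adj_mxcol mul_mxrow_mxcol.
Qed.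

Lemma gram_state_num w z : (state_num w)^t* *m state_num z =
  \sum_k ((w k)^* * z k) *:
    ((submxcol (out_num w) k)^t* *m submxcol (out_num z) k).
Proof.
have SE y : state_num y = \mxcol_k (y k *: submxcol (out_num y) k).
  by rewrite state_numE /structmx -{1}[out_num y]submxcolK mxdiag_scalar_mul.
rewrite !SE adj_mxcol mul_mxrow_mxcol; apply: eq_bigr => k _.
by rewrite adjmxZ -scalemxAl -scalemxAr scalerA.
Qed.

Lemma tf_num_kernel w z :
  ((state_den w)^* * state_den z)%:M - (tf_num w)^t* *m tf_num z =
  \sum_k (1 - (w k)^* * z k) *:
    ((submxcol (out_num w) k)^t* *m submxcol (out_num z) k).
Proof.
have := realization_gram w z; rewrite gram_submxcol gram_state_num => E.
under eq_bigr do rewrite scalerBl scale1r.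
rewrite sumrB; set Y := \sum_k _ in E *; set X := \sum_k _ in E *.
have -> : ((state_den w)^* * state_den z)%:M = (tf_num w)^t* *m tf_num z + Y - X.
  by rewrite E addrAC subrr add0r.
by rewrite [_ + Y]addrC addrAC addrK.
Qed.

Lemma tf_num_torus w : (forall k, `|w k| = 1) ->
  (tf_num w)^t* *m tf_num w = ((state_den w)^* * state_den w)%:M.
Proof.
move=> w1; apply/esym/eqP; rewrite -subr_eq0 tf_num_kernel big1// => k _.
by rewrite mulrC -normCK w1 expr1n subrr scale0r.
Qed.

Lemma state_den_neq0 z : (forall k, `|z k| < 1) -> state_den z != 0.
Proof.
move=> z1; rewrite -unitfE -unitmxE /structmx mxdiag_scalarE.
by apply: (resolvent_unit unitaryU) => i; rewrite mxE.
Qed.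

Lemma tf_numE z : 1%:M - structmx z *m A \in unitmx ->
  tf_num z = state_den z *:
    (D + C0 *m invmx (1%:M - structmx z *m A) *m structmx z *m B).
Proof.
move=> u; have d0 : state_den z != 0 by move: u; rewrite unitmxE unitfE.
rewrite /tf_num addrC scalerDr; congr (_ + _).
rewrite /state_num /invmx u -/(state_den z) -!scalemxAr -!scalemxAl scalerA.
by rewrite divff// scale1r !mulmxA.
Qed.

Lemma structmx_map (K L : pzRingType) (f : {rmorphism K -> L}) (z : 'I_d -> K) :
  map_mx f (structmx z) = structmx (fun k => f (z k)).
Proof.
rewrite /structmx !mxdiag_scalarE; apply/matrixP => i j.
by rewrite !mxE rmorphMn.
Qed.

Let X k : mpoly d C := mpolyX C (mnm1 k).
Let lift p q (E : 'M[C]_(p, q)) : 'M[mpoly d C]_(p, q) := map_mx (@mpolyC d C) E.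

Definition den_poly : mpoly d C := \det (1%:M - structmx X *m lift A).

Definition state_poly : 'M[mpoly d C]_(S, n) :=
  \adj (1%:M - structmx X *m lift A) *m structmx X *m lift B.

Definition out_poly : 'M[mpoly d C]_(S, n) :=
  lift A *m state_poly + den_poly *: lift B.

Definition tf_poly : 'M[mpoly d C]_n :=
  lift C0 *m state_poly + den_poly *: lift D.

Let meval_lift z p q (E : 'M[C]_(p, q)) : map_mx (meval z) (lift E) = E.
Proof. by apply/matrixP => i j; rewrite !mxE mevalC. Qed.

Let meval_struct z : map_mx (meval z) (structmx X) = structmx z.
Proof.
rewrite structmx_map; congr structmx; apply/funext => k; exact: mevalXU.
Qed.

Let meval_pencil z :
  map_mx (meval z) (1%:M - structmx X *m lift A) = 1%:M - structmx z *m A.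
Proof. by rewrite map_mxB map_mx1 map_mxM meval_struct meval_lift. Qed.

Lemma meval_den_poly z : meval z den_poly = state_den z.
Proof. by rewrite -det_map_mx meval_pencil. Qed.

Lemma meval_state_poly z : map_mx (meval z) state_poly = state_num z.
Proof. by rewrite !map_mxM map_mx_adj meval_pencil meval_struct meval_lift. Qed.

Lemma meval_out_poly z : map_mx (meval z) out_poly = out_num z.
Proof.
rewrite map_mxD map_mxM map_mxZ meval_state_poly !meval_lift.
by rewrite /= meval_den_poly.
Qed.

Lemma meval_submxcol_out_poly z k i j :
  meval z (submxcol out_poly k i j) = submxcol (out_num z) k i j.
Proof. by rewrite -meval_out_poly [RHS]mxE [RHS]mxE [in LHS]mxE. Qed.

Lemma meval_tf_poly z : map_mx (meval z) tf_poly = tf_num z.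
Proof.
rewrite map_mxD map_mxM map_mxZ meval_state_poly !meval_lift.
by rewrite /= meval_den_poly.
Qed.

End RealizationAlgebra.

(** * Rational functions and their values *)

Section RationalFunctions.
Variables (K : fieldType) (d : nat).
Implicit Types p q : mpoly d K.

Lemma meval_neq0 z q : meval z q != 0 -> q != 0.
Proof. by apply: contraNneq => ->; rewrite meval0. Qed.

Lemma tofrac_div_eq p q p' q' : q != 0 -> q' != 0 ->
  tofrac p / tofrac q = tofrac p' / tofrac q' <-> p * q' = p' * q.
Proof.
move=> q0 q'0; split=> [/eqP|E].
  by rewrite eqr_div ?tofrac_eq0// -!tofracM tofrac_eq => /eqP.
by apply/eqP; rewrite eqr_div ?tofrac_eq0// -!tofracM tofrac_eq E.
Qed.

Lemma common_denominator n (p q : 'I_n -> 'I_n -> mpoly d K) :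
  exists (q0 : mpoly d K) (P : 'M[mpoly d K]_n),
    (forall i j, P i j * q i j = p i j * q0) /\
    (forall z, (forall i j, meval z (q i j) != 0) -> meval z q0 != 0).
Proof.
pose q0 := \prod_(ij : 'I_n * 'I_n) q ij.1 ij.2.
exists q0, (\matrix_(i, j) (p i j * \prod_(kl : 'I_n * 'I_n | kl != (i, j)) q kl.1 kl.2)).
split=> [i j|z zq]; last first.
  by rewrite rmorph_prod; apply/prodf_neq0 => ij _; exact: zq.
by rewrite mxE /q0 [in RHS](bigD1 (i, j))//= -mulrA; congr (_ * _); rewrite mulrC.
Qed.

End RationalFunctions.

Section RationalMatrices.
Variables (R : realType) (d n : nat).
Local Notation C := R[i].

Lemma ratmx_common_denominator (f : 'M[ratfun R d]_n) z W :
  ratmx_value f z W -> exists (q0 : mpoly d C) (P : 'M[mpoly d C]_n),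
    [/\ meval z q0 != 0, forall i j, f i j = tofrac (P i j) / tofrac q0 &
      forall i j, meval z q0 * W i j = meval z (P i j)].
Proof.
move=> fW.
have /choice[p /choice[q pq]] : forall ij : 'I_n * 'I_n, exists p, exists q : mpoly d C,
    [/\ f ij.1 ij.2 = tofrac p / tofrac q, meval z q != 0
      & W ij.1 ij.2 = meval z p / meval z q].
  by move=> ij; exact: fW.
have [q0 [P [PE qn0]]] := common_denominator (fun i j => p (i, j)) (fun i j => q (i, j)).
have q00 : meval z q0 != 0 by apply: qn0 => i j; have [] := pq (i, j).
exists q0, P; split=> // i j; have /= [fE qz WE] := pq (i, j).
  by rewrite fE; apply/tofrac_div_eq; rewrite ?PE// (meval_neq0 qz, meval_neq0 q00).
rewrite WE mulrA [_ * meval z (p _)]mulrC -mevalM -PE mevalM mulfK//.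
Qed.

(** Independence of the representation, including one whose denominator vanishes at [z]. *)
Lemma ratfun_value_num (f : ratfun R d) z w p q : q != 0 ->
  f = tofrac p / tofrac q -> ratfun_value f z w -> meval z q * w = meval z p.
Proof.
move=> q0 fE [p' [q' [fE' q'z ->]]].
have : p * q' = p' * q.
  by apply/(tofrac_div_eq p p' q0 (meval_neq0 q'z)); rewrite -fE -fE'.
move=> /(congr1 (meval z)); rewrite !mevalM => E.
by rewrite mulrA [_ * meval z p']mulrC -E mulfK.
Qed.

Lemma disk_infinite N : exists2 s : 'I_N -> C, injective s & forall i, `|s i| < 1.
Proof.
have [s si sE] := small_disk_infinite C N; exists s => // i.
have [s0 s1] := sE i; rewrite ger0_norm// (le_lt_trans s1)//.
by rewrite invf_lt1 ?ltr0n// ltr1n.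
Qed.

(** At zeros of [r] the pointwise equations say nothing about [F]. They are turned into a polynomial
    identity with the factor [r], which is cancelled before evaluating. *)
Lemma ratfun_value_eq_on_polydisk (f : ratfun R d) (F : ('I_d -> C) -> C) p q z :
  (forall z, polydisk z -> ratfun_value f z (F z)) ->
  (exists2 r : mpoly d C, r != 0 & forall z, polydisk z -> exists w,
     meval z r * w = meval z r * F z /\ meval z q * w = meval z p) ->
  polydisk z -> meval z q * F z = meval z p.
Proof.
move=> fF [r r0 rF] zD.
have [p1 [q1 [fE q1z FE]]] := fF z zD.
suff E : q * p1 = p * q1.
  have := congr1 (meval z) E; rewrite !mevalM FE mulrA => ->.
  by rewrite mulfK.
apply: (mulfI r0); apply/eqP; rewrite -subr_eq0; apply/eqP.
apply: (@mpoly_vanish C d (fun z => `|z| < 1)) => [N|y yD].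
  exact: disk_infinite.
have [w [rw qw]] := rF y yD.
have := ratfun_value_num (meval_neq0 q1z) fE (fF y yD) => p1y.
rewrite mevalB !mevalM -p1y -qw; apply/eqP; rewrite subr_eq0; apply/eqP.
transitivity (meval y q * meval y q1 * (meval y r * F y)); first by ring.
by rewrite -rw; ring.
Qed.

End RationalMatrices.

(** * The implications, apart from the Schur-Agler property of a realization *)

Section Implications.
Variables (R : realType) (d n : nat).
Local Notation C := R[i].
Variable F : ('I_d -> C) -> 'M[C]_n.

Lemma decomposition_realization :
  rational_Agler_decomposition F -> Givone_Roesser_unitary_realization F.
Proof.
move=> [N [theta [_ _ FE]]].
have [||A [B [C0 [D [U AB]]]]] := @lurking_realization C d n N (@polydisk R d)
  theta (fun=> 1) F.
- by move=> z zD k; exact: zD.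
- by move=> w z wD zD; rewrite rmorph1 mulr1; exact: FE.
exists N, A, B, C0, D; split=> // z zD P.
by have [Pu ->] := AB z zD; rewrite scale1r.
Qed.

Lemma realization_rational_inner :
  Givone_Roesser_unitary_realization F -> rational_inner F.
Proof.
move=> [m [A [B [C0 [D [U FE]]]]]].
pose q := den_poly A; pose P := tf_poly A B C0 D.
have qz z : polydisk z -> meval z q != 0.
  by move=> zD; rewrite meval_den_poly; apply: (state_den_neq0 U) => k; exact: zD.
have q0 : q != 0.
  by apply: (@meval_neq0 _ _ (fun=> 0)); apply: qz => k; rewrite normr0 ltr01.
have FzE z : polydisk z -> forall i j, meval z q * F z i j = meval z (P i j).
  move=> zD i j; have [Pu ->] := FE z zD.
  have := tf_numE B C0 D Pu; rewrite -meval_tf_poly -meval_den_poly => /matrixP/(_ i j).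
  by rewrite [LHS]mxE [RHS]mxE => <-.
exists (\matrix_(i, j) (tofrac (P i j) / tofrac q)).
  move=> z zD i j; exists (P i j), q; split; [by rewrite mxE|exact: qz|].
  by rewrite -(FzE z zD) mulrC mulKf// qz.
move=> w W wT fW.
have [p0 [Q [p0w fQ WQ]]] := ratmx_common_denominator fW.
have p00 : p0 != 0 := meval_neq0 p0w.
have QP i j : Q i j * q = P i j * p0.
  by apply/(tofrac_div_eq (Q i j) (P i j) p00 q0); rewrite -fQ mxE.
pose N := maxn (msize p0) (\max_i \max_j msize (Q i j)).
have QN i j : (msize (Q i j) <= N)%N.
  rewrite leq_max; apply/orP; right.
  by apply: leq_trans (leq_bigmax i); exact: leq_bigmax.
(* [q] may vanish at [w], unlike the common denominator [p0]. The Gram identity for [Q] is carried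
   from the points where [q] is nonzero to the whole torus. *)
have [|QQ _] := torus_identity (leq_maxl _ _ : (msize p0 <= N)%N) QN q0.
  move=> v vT qv; apply: (gram_rescale (T := map_mx (meval v) P) qv).
    by move=> i j; rewrite [X in X * _]mxE [X in _ = X * _]mxE -!mevalM QP.
  by rewrite meval_tf_poly meval_den_poly; apply: (tf_num_torus U).
apply: (unit_gram_unitary p0w _ (QQ w wT)) => i j.
by rewrite mxE.
Qed.

Lemma inner_Schur_Agler_realization :
  rational_inner_Schur_Agler F -> Givone_Roesser_unitary_realization F.
Proof.
move=> [[c cF contractive] [f fF f_inner]].
have D0 : polydisk (fun _ : 'I_d => 0 : C) by move=> k; rewrite normr0 ltr01.
have [p [Q [p0z fQ _]]] := ratmx_common_denominator (fF _ D0).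
have p0 : p != 0 := meval_neq0 p0z.
have pQ : quotient_on F p Q.
  by move=> z i j zD; apply: (ratfun_value_num p0 (fQ i j)); exact: fF.
pose N := maxn (msize p) (\max_i \max_j msize (Q i j)).
have pN : (msize p <= N)%N := leq_maxl _ _.
have QN i j : (msize (Q i j) <= N)%N.
  rewrite leq_max; apply/orP; right.
  by apply: leq_trans (leq_bigmax i); exact: leq_bigmax.
have [|_ trE] := torus_identity pN QN p0.
  move=> w wT pw; apply: (unitary_gram (W := (meval w p)^-1 *: map_mx (meval w) Q)).
    by move=> i j; rewrite mxE mulVKf.
  apply: (f_inner w) => // i j; exists (Q i j), p; split=> //.
  by rewrite !mxE mulrC.
have tr0 := trace_rows trE.
have [l lpsd lE] := Agler_certificate cF contractive N pQ.
have [V VE] := polynomial_decomposition lpsd lE tr0 pN QN.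
pose m (k : 'I_d) := #|{: bmultinom d N * 'I_n}|.
have [||A [B [C0 [D [U AB]]]]] := @lurking_realization C d n m (@polydisk R d)
  (fun k z => V k *m evalmx n N z) (fun z => meval z p) (fun z => map_mx (meval z) Q).
- by move=> z zD k; exact: zD.
- by move=> w z _ _; exact: VE.
exists m, A, B, C0, D; split=> // z zD P.
have [Pu _] := AB z zD; split=> //.
apply/matrixP => i j.
have den0 : meval z (den_poly A) != 0.
  by rewrite meval_den_poly; apply: (state_den_neq0 U) => k; exact: zD.
apply: (mulfI den0).
(* [p] is only known to be nonzero at the origin and may vanish at [z], so it is cancelled as a
   polynomial and not as a value. *)
transitivity (meval z (tf_poly A B C0 D i j)).
  apply: (ratfun_value_eq_on_polydisk (f := f i j) (F := fun z => F z i j)) => //.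
    by move=> y yD; exact: fF.
  exists p => // y yD; have [Puy QE] := AB y yD.
  exists ((D + C0 *m invmx (1%:M - structmx m y *m A) *m structmx m y *m B) i j); split.
    by have /matrixP/(_ i j) := QE; rewrite [LHS]mxE [RHS]mxE -(pQ _ _ _ yD).
  have := tf_numE B C0 D Puy; rewrite -meval_tf_poly -meval_den_poly => /matrixP/(_ i j).
  by rewrite [LHS]mxE [RHS]mxE.
have := tf_numE B C0 D Pu; rewrite -meval_tf_poly -meval_den_poly => /matrixP/(_ i j).
by rewrite [LHS]mxE [RHS]mxE.
Qed.

Lemma realization_decomposition :
  Givone_Roesser_unitary_realization F -> rational_Agler_decomposition F.
Proof.
move=> [m [A [B [C0 [D [U FE]]]]]].
pose q := den_poly A; pose Y := out_poly A B.
have qz z : polydisk z -> meval z q != 0.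
  by move=> zD; rewrite meval_den_poly; apply: (state_den_neq0 U) => k; exact: zD.
(* A zero row is appended because the height of each [theta] has to be positive, while a block of
   the state space may be empty. *)
exists (fun k => (m k + 1)%N), (fun k z =>
  col_mx ((meval z q)^-1 *: submxcol (out_num A B z) k) 0); split.
- by move=> k; rewrite addn1.
- move=> k; exists (col_mx
    (\matrix_(i, j) (tofrac (submxcol Y k i j) / tofrac q)) 0) => z zD i j.
  rewrite /ratfun_value; case: (split_ordP i) => i' ->.
    rewrite !col_mxEu; exists (submxcol Y k i' j), q; split.
    + by rewrite mxE.
    + exact: qz.
    + by rewrite [LHS]mxE mulrC meval_submxcol_out_poly.
  rewrite !col_mxEd !mxE; exists 0, 1; split.
  + by rewrite tofrac0 mul0r.
  + by rewrite meval1 oner_eq0.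
  + by rewrite meval0 mul0r.
move=> w z wD zD.
have FzE y : polydisk y -> F y = (meval y q)^-1 *: tf_num A B C0 D y.
  move=> yD; have [Pu ->] := FE y yD.
  by rewrite (tf_numE B C0 D Pu) -meval_den_poly scalerA mulVf ?qz// scale1r.
rewrite (FzE w wD) (FzE z zD) (normalized_kernel _ _ (qz w wD) (qz z zD)).
have := tf_num_kernel U w z; rewrite -!meval_den_poly -/q => ->.
rewrite scaler_sumr; apply: eq_bigr => k _.
rewrite scalerA mulrC -scalerA; congr (_ *: _).
rewrite adjmx_col_mx mul_row_col mulmx0 addr0.
by rewrite adjmxZ -scalemxAl -scalemxAr scalerA fmorphV invfM.
Qed.

End Implications.

(** * The transfer operator of a unitary colligation *)

Section RealizationCoefficients.
Variables (C : numClosedFieldType) (d m n : nat) (blk : 'I_m -> 'I_d).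
Variables (A : 'M[C]_m) (B : 'M[C]_(m, n)) (C0 : 'M[C]_(n, m)) (D : 'M[C]_n).

Lemma sum_shift_mnm (V : nmodType) N k (f : multinom d -> V) :
  \sum_(t : bmultinom d N.+1 | (0 < bmnm t k)%N) f (mnm_sub t (mnm1 k)) =
  \sum_(s : bmultinom d N) f s.
Proof.
have hP (s : bmultinom d N) : (mdeg (mnm_add s (mnm1 k)) < N.+1)%N.
  by rewrite mdegD mdeg1 addn1 ltnS bmdeg.
rewrite (reindex_omap (fun s : bmultinom d N => BMultinom (hP s))
   (fun t : bmultinom d N.+1 => insub (mnm_sub t (mnm1 k)))).
  apply: eq_big => [s|s _] /=; last by rewrite addmK.
  by rewrite mnmDE mnm1E eqxx addn1 /= addmK [X in X == _](valK s) eqxx.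
move=> t tk; have tE : mnm_add (mnm_sub t (mnm1 k)) (mnm1 k) = t.
  by rewrite submK// lep1mP -lt0n.
have tN : (mdeg (mnm_sub t (mnm1 k)) < N)%N.
  by have := bmdeg t; rewrite -{1}tE mdegD mdeg1 addn1 ltnS.
by rewrite insubT /=; congr Some; apply/val_inj.
Qed.

Lemma sum_bmultinom_widen N (f : multinom d -> C) : (forall t, 0 <= f t) ->
  \sum_(t : bmultinom d N) f t <= \sum_(t : bmultinom d N.+1) f t.
Proof.
move=> f0; have hP (s : bmultinom d N) : (mdeg s < N.+1)%N.
  exact: leq_trans (bmdeg s) (leqnSn N).
rewrite [leRHS](bigID (fun t : bmultinom d N.+1 => mdeg t < N)%N)/=.
rewrite (reindex_omap (fun s : bmultinom d N => BMultinom (hP s))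
   (fun t : bmultinom d N.+1 => insub (bmnm t)))/=.
  rewrite -[leLHS]addr0 lerD//; last exact: sumr_ge0.
  rewrite [leRHS](eq_bigl xpredT)// => s /=.
  by rewrite bmdeg/= [X in X == _](valK s) eqxx.
by move=> t tN; rewrite insubT /=; congr Some; apply/val_inj.
Qed.

Definition blk_proj k : 'M[C]_m := diag_mx (\row_i (blk i == k)%:R).

(** The degree is a separate argument because subtracting a unit multi-index is not a structural
    descent. *)
Fixpoint out_coef_rec j (t : multinom d) : 'M[C]_(m, n) :=
  if j is j'.+1 then
    \sum_(k | (0 < t k)%N) A *m (blk_proj k *m out_coef_rec j' (mnm_sub t (mnm1 k)))
  else B.

(* The coefficients of the power series of (1 - A P(z))^-1 B. *)
Definition out_coef (t : multinom d) := out_coef_rec (mdeg t) t.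

(** Coefficients of P(z) (1 - A P(z))^-1 B, which equals (1 - P(z) A)^-1 P(z) B. *)
Definition in_coef (t : multinom d) : 'M[C]_(m, n) :=
  \sum_(k | (0 < t k)%N) blk_proj k *m out_coef (mnm_sub t (mnm1 k)).

Definition tf_coef (t : multinom d) : 'M[C]_n := C0 *m in_coef t + (if t == mnm0 then D else 0).

Lemma in_coef0 : in_coef mnm0 = 0.
Proof. by rewrite /in_coef big1// => k; rewrite mnm0E. Qed.

Lemma out_coefE t : out_coef t = A *m in_coef t + (if t == mnm0 then B else 0).
Proof.
case: eqVneq => [->|t0]; first by rewrite in_coef0 mulmx0 add0r /out_coef mdeg0.
rewrite addr0 /out_coef /in_coef mulmx_sumr.
have : mdeg t != 0%N by rewrite mdeg_eq0.
case tE: (mdeg t) => [//|j] _ /=; apply: eq_bigr => k tk; congr (_ *m (_ *m _)).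
rewrite /out_coef; suff -> : mdeg (mnm_sub t (mnm1 k)) = j by [].
have tkE : mnm_add (mnm_sub t (mnm1 k)) (mnm1 k) = t.
  by rewrite submK// lep1mP -lt0n.
by have := tE; rewrite -{1}tkE mdegD mdeg1 addn1 => -[].
Qed.

Lemma blk_projE p k (X : 'M[C]_(m, p)) i j :
  (blk_proj k *m X) i j = (blk i == k)%:R * X i j.
Proof. by rewrite mul_diag_mx !mxE. Qed.

Lemma sum_blk_proj p (X : 'M[C]_(m, p)) :
  \sum_k \tr ((blk_proj k *m X)^t* *m (blk_proj k *m X)) = \tr (X^t* *m X).
Proof.
under eq_bigr do rewrite mxtr_adjM.
rewrite mxtr_adjM exchange_big; apply: eq_bigr => j _ /=.
rewrite exchange_big; apply: eq_bigr => i _ /=.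
rewrite (bigD1 (blk i))//= big1 ?addr0 => [|k ki].
  by rewrite blk_projE eqxx mul1r.
by rewrite blk_projE eq_sym (negPf ki) mul0r normr0 expr0n.
Qed.

(** Pythagoras: distinct [k] contribute to disjoint blocks of rows. *)
Lemma tr_in_coef t : \tr ((in_coef t)^t* *m in_coef t) =
  \sum_(k | (0 < t k)%N) \tr ((blk_proj k *m out_coef (mnm_sub t (mnm1 k)))^t* *m
     (blk_proj k *m out_coef (mnm_sub t (mnm1 k)))).
Proof.
rewrite -sum_blk_proj [RHS]big_mkcond; apply: eq_bigr => k _.
have PP l (X : 'M[C]_(m, n)) : blk_proj k *m (blk_proj l *m X) =
    if k == l then blk_proj k *m X else 0.
  apply/matrixP => i j; rewrite !blk_projE; case: (eqVneq k l) => [<-|kl].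
    by rewrite blk_projE mulrA -natrM mulnb andbb.
  rewrite mxE; case: (eqVneq (blk i) k) => [->|_]; last by rewrite mul0r.
  by rewrite (negPf kl) mul0r mulr0.
rewrite /in_coef mulmx_sumr (eq_bigr (fun l => if k == l then
   blk_proj k *m out_coef (mnm_sub t (mnm1 l)) else 0)); last by move=> l _; exact: PP.
rewrite -big_mkcondr /=; case: ifPn => tk.
  by rewrite (big_pred1 k)// => l; rewrite /= eq_sym; case: eqVneq => [->|]; rewrite ?tk ?andbF.
rewrite big1 ?mulmx0 ?mxtrace0// => l /andP[tl /eqP kl].
by rewrite kl tl in tk.
Qed.

Hypothesis unitaryU : block_mx A B C0 D \is unitarymx.

Lemma tr_colligation p (X : 'M[C]_(m, p)) (Y : 'M[C]_(n, p)) :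
  \tr ((A *m X + B *m Y)^t* *m (A *m X + B *m Y)) +
  \tr ((C0 *m X + D *m Y)^t* *m (C0 *m X + D *m Y)) =
  \tr (X^t* *m X) + \tr (Y^t* *m Y).
Proof.
have trD q r (P : 'M[C]_(q, p)) (Q : 'M[C]_(r, p)) : \tr (P^t* *m P) + \tr (Q^t* *m Q) =
    \tr ((col_mx P Q)^t* *m col_mx P Q) by rewrite adjmx_col_mx mul_row_col raddfD.
rewrite [LHS]trD [RHS]trD -mul_block_col adjmxM mulmxA -(mulmxA _ (_^t*)).
by rewrite unitary_block_adj// mulmx1.
Qed.

(** Energy balance by degree: the state inputs of degree at most [N] carry the energy of the state
    outputs of degree below [N], and the external input, the identity in degree 0, adds its trace
    [n]. Hence the output energy in any range of degrees is at most [n]. *)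
Lemma tf_coef_bound t i j : `|tf_coef t i j| ^+ 2 <= n%:R.
Proof.
pose a N := \sum_(t : bmultinom d N) \tr ((out_coef t)^t* *m out_coef t).
pose b N := \sum_(t : bmultinom d N) \tr ((tf_coef t)^t* *m tf_coef t).
have step N : a N.+1 + b N.+1 = a N + n%:R.
  rewrite -big_split /=.
  rewrite (eq_bigr (fun t : bmultinom d N.+1 => \tr ((in_coef t)^t* *m in_coef t) +
     (if bmnm t == mnm0 then n%:R else 0))).
    rewrite big_split /=; congr (_ + _).
      rewrite (eq_bigr _ (fun (t : bmultinom d N.+1) _ => tr_in_coef t)).
      rewrite (exchange_big_dep xpredT)//=.
      rewrite (eq_bigr _ (fun k _ => sum_shift_mnm N k
        (fun s => \tr ((blk_proj k *m out_coef s)^t* *m (blk_proj k *m out_coef s))))).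
      by rewrite exchange_big; apply: eq_bigr => s _; rewrite sum_blk_proj.
    rewrite (bigD1 (bm0 : bmultinom d N.+1))//= eqxx big1 ?addr0// => s.
    by rewrite -val_eqE /= => /negPf ->.
  move=> s _; rewrite out_coefE /tf_coef.
  (* Both summands are the external input, the identity in degree 0 and zero elsewhere, multiplied
     by [B] or [D]. *)
  have IE k (E : 'M[C]_(k, n)) : (if bmnm s == mnm0 then E else 0) =
      E *m (if bmnm s == mnm0 then 1%:M else 0 : 'M[C]_n).
    by case: ifP => _; rewrite ?mulmx1 ?mulmx0.
  rewrite (IE _ B) (IE _ D) tr_colligation; congr (_ + _).
  by case: ifP => _; rewrite ?adjmx1 ?mulmx1 ?mxtrace1 ?mulmx0 ?mxtrace0.
have tr0 p q (X : 'M[C]_(p, q)) : 0 <= \tr (X^t* *m X) := mxtr_adjM_ge0 X.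
have bn N : b N.+1 <= n%:R.
  rewrite -(lerD2l (a N)) -step lerD2r.
  by apply: (sum_bmultinom_widen _ (fun t => tr0 _ _ (out_coef t))).
have tN : (mdeg t < (mdeg t).+1)%N by [].
apply: le_trans (bn (mdeg t)); rewrite /b (bigD1 (BMultinom tN))//=.
rewrite mxtr_adjM (bigD1 j)//= (bigD1 i)//= -!addrA lerDl.
apply: addr_ge0; first by apply: sumr_ge0 => k _; exact: exprn_ge0.
apply: addr_ge0; last by apply: sumr_ge0.
by do 2!apply: sumr_ge0 => ? _; exact: exprn_ge0.
Qed.

End RealizationCoefficients.

Section TransferOperator.

(** * Matrices acting on tuples of Hilbert space vectors *)

Variables (C : numClosedFieldType) (H : normedModType C) (ip : H -> H -> C).
Hypothesis ipDl : forall x y z, ip (x + y) z = ip x z + ip y z.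
Hypothesis ipZl : forall a x y, ip (a *: x) y = a * ip x y.
Hypothesis ipC : forall x y, ip y x = (ip x y)^*.
Hypothesis ip_norm : forall x, `|x| ^+ 2 = ip x x.

Definition nsq p (x : {ffun 'I_p -> H}) : C := \sum_i `|x i| ^+ 2.

Definition act p q (M : 'M[C]_(p, q)) (x : {ffun 'I_q -> H}) : {ffun 'I_p -> H} :=
  [ffun i => \sum_j M i j *: x j].

Lemma nsq_ge0 p (x : {ffun 'I_p -> H}) : 0 <= nsq x.
Proof. by apply: sumr_ge0 => i _; exact: exprn_ge0. Qed.

Lemma nsq0 p : nsq (0 : {ffun 'I_p -> H}) = 0.
Proof. by rewrite /nsq big1// => i _; rewrite ffunE normr0 expr0n. Qed.

Lemma nsq_coord p (x : {ffun 'I_p -> H}) i : `|x i| ^+ 2 <= nsq x.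
Proof.
by rewrite /nsq (bigD1 i)//= lerDl sumr_ge0// => j _; exact: exprn_ge0.
Qed.

Lemma nsq_eq0 p (x : {ffun 'I_p -> H}) : nsq x <= 0 -> x = 0.
Proof.
move=> x0; apply/ffunP => i; rewrite ffunE; apply/eqP.
rewrite -normr_eq0 -sqrf_eq0 eq_le exprn_ge0// andbT.
exact: le_trans (nsq_coord x i) x0.
Qed.

Lemma act_is_linear p q (M : 'M[C]_(p, q)) : linear (act M).
Proof.
move=> a x y; apply/ffunP => i; rewrite !ffunE scaler_sumr -big_split /=.
by apply: eq_bigr => j _; rewrite !ffunE scalerDr !scalerA mulrC.
Qed.

HB.instance Definition _ p q (M : 'M[C]_(p, q)) :=
  GRing.isLinear.Build C {ffun 'I_q -> H} {ffun 'I_p -> H} _ (act M) (act_is_linear M).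

Lemma actD p q (M N : 'M[C]_(p, q)) x : act (M + N) x = act M x + act N x.
Proof.
apply/ffunP => i; rewrite !ffunE -big_split /=.
by apply: eq_bigr => j _; rewrite mxE scalerDl.
Qed.

Lemma act0 p q x : act (0 : 'M[C]_(p, q)) x = 0.
Proof. by apply/ffunP => i; rewrite !ffunE big1// => j _; rewrite mxE scale0r. Qed.

Lemma act_sum p q I (r : seq I) P (M : I -> 'M[C]_(p, q)) x :
  act (\sum_(i <- r | P i) M i) x = \sum_(i <- r | P i) act (M i) x.
Proof. by elim/big_rec2: _ => [|i y N _ <-]; rewrite ?act0 ?actD. Qed.

Lemma actM p q r (M : 'M[C]_(p, q)) (N : 'M[C]_(q, r)) x :
  act (M *m N) x = act M (act N x).
Proof.
apply/ffunP => i; rewrite !ffunE.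
under [RHS]eq_bigr do rewrite ffunE scaler_sumr.
rewrite exchange_big /=; apply: eq_bigr => j _.
by rewrite mxE scaler_suml; apply: eq_bigr => k _; rewrite scalerA.
Qed.

Lemma nsq_act_unitary p (U : 'M[C]_p) x : U^t* *m U = 1%:M -> nsq (act U x) = nsq x.
Proof.
move=> UU.
have ip_suml I (r : seq I) (f : I -> H) z : ip (\sum_(i <- r) f i) z = \sum_(i <- r) ip (f i) z.
  have ip0 : ip 0 z = 0 by rewrite -(scale0r 0) ipZl mul0r.
  by elim/big_rec2: _ => [|i y v _ <-].
have ip_sumr I (r : seq I) (f : I -> H) z : ip z (\sum_(i <- r) f i) = \sum_(i <- r) ip z (f i).
  by rewrite ipC ip_suml rmorph_sum; apply: eq_bigr => i _; rewrite [RHS]ipC.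
have ipZr a y z : ip y (a *: z) = a^* * ip y z by rewrite ipC ipZl rmorphM [ip y z]ipC.
have -> : nsq (act U x) = \sum_j \sum_k (U^t* *m U) k j * ip (x j) (x k).
  transitivity (\sum_i \sum_j \sum_k (U i j * (U i k)^*) * ip (x j) (x k)).
    apply: eq_bigr => i _; rewrite ip_norm ffunE ip_suml; apply: eq_bigr => j _.
    by rewrite ip_sumr; apply: eq_bigr => k _; rewrite ipZl ipZr mulrA.
  rewrite exchange_big; apply: eq_bigr => j _ /=.
  rewrite exchange_big; apply: eq_bigr => k _ /=.
  by rewrite -mulr_suml; congr (_ * _); rewrite mxE; apply: eq_bigr => i _; rewrite !mxE mulrC.
apply: eq_bigr => j _; rewrite UU (bigD1 j)//= big1 ?addr0 => [|k kj].
  by rewrite mxE eqxx mul1r ip_norm.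
by rewrite mxE (negPf kj) mul0r.
Qed.

Variables (d m n : nat) (blk : 'I_m -> 'I_d).
Variables (A : 'M[C]_m) (B : 'M[C]_(m, n)) (C0 : 'M[C]_(n, m)) (D : 'M[C]_n).
Hypothesis unitaryU : block_mx A B C0 D \is unitarymx.

Lemma nsq_colligation x y :
  nsq (act A y + act B x) + nsq (act C0 y + act D x) = nsq y + nsq x.
Proof.
pose v : {ffun 'I_(m + n) -> H} :=
  [ffun i => match fintype.split i with inl j => y j | inr j => x j end].
have vl i : v (lshift n i) = y i by rewrite ffunE (unsplitK (inl i)).
have vr i : v (rshift m i) = x i by rewrite ffunE (unsplitK (inr i)).
have nv : nsq v = nsq y + nsq x.
  by rewrite /nsq big_split_ord /=; congr (_ + _); apply: eq_bigr => i _; rewrite ?vl ?vr.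
rewrite -nv -(nsq_act_unitary v (unitary_block_adj unitaryU)).
rewrite /nsq big_split_ord /=; congr (_ + _); apply: eq_bigr => i _;
  rewrite !ffunE big_split_ord /=; congr (`| _ + _ | ^+ 2); apply: eq_bigr => j _.
- by rewrite vl block_mxEul.
- by rewrite vr block_mxEur.
- by rewrite vl block_mxEdl.
- by rewrite vr block_mxEdr.
Qed.

End TransferOperator.

(** [op_monomial] composes the powers in a fixed order; commutation moves the additional factor to
    the front. *)
Lemma op_monomial_shift (V : Type) d (T : 'I_d -> V -> V) (t t' : multiindex d) k x :
  (forall i j y, T i (T j y) = T j (T i y)) ->
  t' k = (t k).+1 -> (forall j, j != k -> t' j = t j) ->
  op_monomial T t' x = T k (op_monomial T t x).
Proof.
move=> Tcomm t'k t'j; rewrite /op_monomial.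
have : k \in index_enum 'I_d by rewrite mem_index_enum.
have : uniq (index_enum 'I_d) by rewrite index_enum_uniq.
elim: (index_enum 'I_d) => [//|j r IHr] /= /andP[jr ur]; rewrite !big_cons inE /=.
case: (eqVneq k j) => [kj _|kj /= kr].
  rewrite -kj t'k /=; congr (T k (iter _ _ _)); congr (_ x).
  apply: eq_big_seq => i ir; rewrite t'j//.
  by apply: contraNneq jr => ik; rewrite -kj -ik.
rewrite IHr// t'j; last by rewrite eq_sym.
by elim: (t j) => [//|l IHl] /=; rewrite IHl Tcomm.
Qed.

Section TransferSeries.
Variables (C : numClosedFieldType) (H : normedModType C) (d m n : nat).
Variables (blk : 'I_m -> 'I_d) (A : 'M[C]_m) (B : 'M[C]_(m, n)).
Variables (C0 : 'M[C]_(n, m)) (D : 'M[C]_n) (T : 'I_d -> {linear H -> H}).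
Hypothesis Tcomm : forall j k x, T j (T k x) = T k (T j x).

Definition opv p (t : multinom d) (x : {ffun 'I_p -> H}) : {ffun 'I_p -> H} :=
  [ffun i => op_monomial T [ffun k => t k] (x i)].

Definition opT p k (x : {ffun 'I_p -> H}) : {ffun 'I_p -> H} := [ffun i => T k (x i)].

Definition opP (y : {ffun 'I_m -> H}) : {ffun 'I_m -> H} := [ffun i => T (blk i) (y i)].

Lemma opT_is_linear p k : linear (@opT p k).
Proof. by move=> a x y; apply/ffunP => i; rewrite !ffunE linearP. Qed.

HB.instance Definition _ p k :=
  GRing.isLinear.Build C {ffun 'I_p -> H} {ffun 'I_p -> H} _ (@opT p k) (opT_is_linear k).

Lemma opP_is_linear : linear opP.
Proof. by move=> a x y; apply/ffunP => i; rewrite !ffunE linearP. Qed.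

HB.instance Definition _ :=
  GRing.isLinear.Build C {ffun 'I_m -> H} {ffun 'I_m -> H} _ opP opP_is_linear.

Lemma act_opT p q k (M : 'M[C]_(p, q)) x : act M (opT k x) = opT k (act M x).
Proof.
apply/ffunP => i; rewrite !ffunE linear_sum; apply: eq_bigr => j _.
by rewrite ffunE linearZ.
Qed.

Lemma opv_shift p k (t : multinom d) (x : {ffun 'I_p -> H}) : (0 < t k)%N ->
  opv t x = opT k (opv (mnm_sub t (mnm1 k)) x).
Proof.
move=> tk; apply/ffunP => i; rewrite !ffunE.
apply: op_monomial_shift => // [|j jk]; rewrite !ffunE mnmBE mnm1E.
  by rewrite eqxx subn1 prednK.
by rewrite eq_sym (negPf jk) subn0.
Qed.

Lemma opv0 p (x : {ffun 'I_p -> H}) : opv mnm0 x = x.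
Proof.
apply/ffunP => i; rewrite ffunE /op_monomial.
by elim/big_rec: _ => // k f _; rewrite ffunE mnm0E.
Qed.

(** Partial sum of (1 - A P(T))^-1 B x over degrees below [N]. By homogeneity it is also the N-th
    Picard iterate, started at 0, of y = A P(T) y + B x. *)
Definition partial_state N x : {ffun 'I_m -> H} :=
  \sum_(t : bmultinom d N) act (out_coef blk A B t) (opv t x).

Lemma partial_state0 x : partial_state 0 x = 0.
Proof. by rewrite /partial_state big1// => -[]. Qed.

Lemma sum_blk_opT y : \sum_k act (blk_proj C blk k) (opT k y) = opP y.
Proof.
apply/ffunP => i; rewrite sum_ffunE (bigD1 (blk i))//= big1 ?addr0 => [|k ki]; rewrite !ffunE.
  rewrite (bigD1 i)//= big1 ?addr0 => [|j ji].
    by rewrite !mxE !eqxx scale1r ffunE.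
  by rewrite !mxE eq_sym (negPf ji) scale0r.
by rewrite big1// => j _; rewrite !mxE eq_sym (negPf ki) mul0rn scale0r.
Qed.

(** For arbitrary [K] and [E], so that one computation serves the state equation with [A], [B] and
    the output with [C0], [D]. *)
Lemma sum_realization p (K : 'M[C]_(p, m)) (E : 'M[C]_(p, n)) N x :
  \sum_(t : bmultinom d N.+1)
    act (K *m in_coef blk A B t + (if bmnm t == mnm0 then E else 0)) (opv t x) =
  act K (opP (partial_state N x)) + act E x.
Proof.
rewrite (eq_bigr (fun t : bmultinom d N.+1 => act K (act (in_coef blk A B t) (opv t x)) +
   act (if bmnm t == mnm0 then E else 0) (opv t x))); last first.
  by move=> t _; rewrite actD actM.
rewrite big_split /=; congr (_ + _); last first.
  rewrite (bigD1 (bm0 : bmultinom d N.+1))//= eqxx opv0 big1 ?addr0// => t.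
  by rewrite -val_eqE /= => /negPf ->; rewrite act0.
rewrite -raddf_sum; congr (act K _).
pose f k (t : multinom d) := act (blk_proj C blk k) (opT k (act (out_coef blk A B t) (opv t x))).
rewrite (eq_bigr (fun t : bmultinom d N.+1 =>
   \sum_(k | (0 < bmnm t k)%N) f k (mnm_sub t (mnm1 k)))); last first.
  move=> t _; rewrite act_sum; apply: eq_bigr => k tk.
  by rewrite actM (opv_shift _ tk) act_opT.
rewrite (exchange_big_dep xpredT)//= -sum_blk_opT.
by apply: eq_bigr => k _; rewrite (sum_shift_mnm N k (f k)) -raddf_sum -raddf_sum.
Qed.

Lemma partial_stateS N x :
  partial_state N.+1 x = act A (opP (partial_state N x)) + act B x.
Proof.
by rewrite -sum_realization; apply: eq_bigr => t _; rewrite out_coefE.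
Qed.

End TransferSeries.

Lemma sum_bmultinom_fset (V : nmodType) d N (E : {fset multiindex d}) (f : multinom d -> V) :
  (forall t, (mabs t < N)%N -> t \in E) ->
  \sum_(t : bmultinom d N) f t = \sum_(t <- E | (mabs t < N)%N) f (mnm_of t).
Proof.
move=> EN; rewrite -[RHS]big_filter -(big_map (@mnm_of d) xpredT f).
rewrite -(big_map (@bmnm d N) xpredT f); apply: perm_big; apply: uniq_perm.
- by rewrite map_inj_uniq ?index_enum_uniq//; exact: val_inj.
- rewrite map_inj_uniq ?filter_uniq ?fset_uniq//; exact: mnm_of_inj.
move=> t; apply/mapP/mapP => [[b _ ->]|[u]].
  have bE := mnm_of_onto b; exists [ffun i => bmnm b i] => //.
  have bN : (mabs [ffun i => bmnm b i] < N)%N by rewrite -mdeg_mnm_of bE bmdeg.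
  by rewrite mem_filter bN EN.
rewrite mem_filter => /andP[uN _] ->.
have uN' : (mdeg (mnm_of u) < N)%N by rewrite mdeg_mnm_of.
by exists (BMultinom uN'); rewrite ?mem_index_enum.
Qed.

Section TransferEstimates.
Variables (C : numClosedFieldType) (H : normedModType C) (d m n : nat).
Variables (blk : 'I_m -> 'I_d) (A : 'M[C]_m) (B : 'M[C]_(m, n)).
Variables (C0 : 'M[C]_(n, m)) (D : 'M[C]_n) (T : 'I_d -> {linear H -> H}).
Hypothesis unitaryU : block_mx A B C0 D \is unitarymx.
Hypothesis colligation : forall (x : {ffun 'I_n -> H}) y,
  nsq (act A y + act B x) + nsq (act C0 y + act D x) = nsq y + nsq x.
Hypothesis Tcomm : forall j k x, T j (T k x) = T k (T j x).
Variable s : C.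
Hypotheses (s0 : 0 <= s) (s1 : s < 1).
Hypothesis Tle : forall k x, `|T k x| <= s ^+ 2 * `|x|.
Implicit Types (x : {ffun 'I_n -> H}) (y : {ffun 'I_m -> H}).

Let opP := opP blk T.
Let pstate := partial_state blk A B T.

Lemma nsq_opP_le y : nsq (opP y) <= s ^+ 4 * nsq y.
Proof.
rewrite mulr_sumr; apply: ler_sum => i _; rewrite ffunE (exprM s 2 2) -exprMn.
by rewrite ler_pXn2r ?nnegrE ?mulr_ge0 ?exprn_ge0.
Qed.

Lemma state_le y : nsq (act A y) <= nsq y.
Proof.
have := colligation 0 y; rewrite !raddf0 !addr0 nsq0 addr0 => <-.
by rewrite lerDl nsq_ge0.
Qed.

Lemma output_le y : nsq (act C0 y) <= nsq y.
Proof.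
have := colligation 0 y; rewrite !raddf0 !addr0 nsq0 addr0 => <-.
by rewrite lerDr nsq_ge0.
Qed.

Lemma norm_op_monomial t v : `|op_monomial T t v| <= s ^+ (2 * mabs t) * `|v|.
Proof.
rewrite /mabs /op_monomial; elim/big_rec2: _ => [|k f e _ IH] /=; first by rewrite mul1r.
rewrite mulnDr exprD -mulrA.
have : `|iter (t k) (T k) (f v)| <= s ^+ (2 * t k) * `|f v|.
  elim: (t k) => [|l IHl]; first by rewrite mul1r.
  rewrite mulnS exprD -mulrA iterS (le_trans (Tle _ _))// ler_wpM2l// exprn_ge0//.
by move/le_trans; apply; rewrite ler_wpM2l// exprn_ge0.
Qed.

(** Energy balance, in which P(T) y has at most s^4 times the energy of [y]. *)
Lemma solution_bound x y : y = act A (opP y) + act B x ->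
  (1 - s ^+ 4) * nsq y + nsq (act C0 (opP y) + act D x) <= nsq x.
Proof.
move=> yE; have := colligation x (opP y); rewrite -yE => E.
rewrite -(lerD2l (s ^+ 4 * nsq y)) mulrBl mul1r addrA addrCA subrr addr0 E.
by rewrite lerD2r nsq_opP_le.
Qed.

Let q0 : 0 <= s ^+ 4. Proof. exact: exprn_ge0. Qed.
Let q1 : 0 < 1 - s ^+ 4. Proof. by rewrite subr_gt0 exprn_ilt1. Qed.

Lemma partial_state_bound N x : (1 - s ^+ 4) * nsq (pstate N x) <= nsq x.
Proof.
elim: N => [|N IHN]; first by rewrite /pstate partial_state0 nsq0 mulr0 nsq_ge0.
have := colligation x (opP (pstate N x)); rewrite -partial_stateS// => E.
have : nsq (pstate N.+1 x) <= s ^+ 4 * nsq (pstate N x) + nsq x.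
  apply: (@le_trans _ _ (nsq (opP (pstate N x)) + nsq x)).
    by rewrite -E lerDl nsq_ge0.
  by rewrite lerD2r nsq_opP_le.
move/(ler_wpM2l (ltW q1))/le_trans; apply.
rewrite mulrDr mulrCA (@le_trans _ _ (s ^+ 4 * nsq x + (1 - s ^+ 4) * nsq x))//.
  by rewrite lerD2r ler_wpM2l.
by rewrite -mulrDl addrC subrK mul1r.
Qed.

(** [pstate (N + j)] and [pstate N] arise from [pstate j] and 0 by the same [N] Picard steps, each
    of which contracts the energy of differences by s^4. *)
Lemma partial_state_cauchy N j x :
  nsq (pstate (N + j) x - pstate N x) <= (s ^+ 4) ^+ N * nsq (pstate j x).
Proof.
elim: N => [|N IHN]; first by rewrite /pstate partial_state0 subr0 mul1r.
rewrite addSn /pstate !partial_stateS// opprD addrACA subrr addr0 -!raddfB.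
rewrite (le_trans (state_le _))// (le_trans (nsq_opP_le _))// [_ ^+ N.+1]exprS -mulrA.
by rewrite ler_wpM2l.
Qed.

Lemma partial_state_diff N x y : y = act A (opP y) + act B x ->
  nsq (y - pstate N x) <= (s ^+ 4) ^+ N * nsq y.
Proof.
move=> yE; elim: N => [|N IHN]; first by rewrite /pstate partial_state0 subr0 mul1r.
rewrite {1}yE /pstate partial_stateS// opprD addrACA subrr addr0 -!raddfB.
rewrite (le_trans (state_le _))// (le_trans (nsq_opP_le _))// [_ ^+ N.+1]exprS -mulrA.
by rewrite ler_wpM2l.
Qed.

(** The first summand comes from the energy bound for [y]. In the second, each of the [n] entries of
    a coefficient row is at most [n], and the last factor is the geometric sum over
    multi-indices. *)
Definition transfer_bound : C := (1 - s ^+ 4)^-1 + n%:R ^+ 2 * (1 - s)^-1 ^+ d.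

(** The low degrees in [E] add up to the output of a Picard iterate. On the others the bound s^(2
    |t|) splits into s^N, which is small, and s^|t|, which is summable; this is why the operators
    are bounded by s^2 and not by s. *)
Lemma transfer_estimate x y N (E : {fset multiindex d}) i :
  y = act A (opP y) + act B x -> nsq x <= 1 ->
  (forall t, (mabs t < N.+1)%N -> t \in E) ->
  `|\sum_(t <- E) act (tf_coef blk A B C0 D (mnm_of t)) [ffun j => op_monomial T t (x j)] i
    - (act C0 (opP y) + act D x) i| <= s ^+ N * transfer_bound.
Proof.
move=> yE x1 EN.
pose f (t : multinom d) := act (tf_coef blk A B C0 D t) (opv T t x).
have opvE t : opv T (mnm_of t) x = [ffun j => op_monomial T t (x j)].
  apply/ffunP => j; rewrite !ffunE; congr (op_monomial _ _ _).
  by apply/ffunP => k; rewrite ffunE mnm_ofE.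
have low : `|\sum_(t <- E | (mabs t < N.+1)%N) f (mnm_of t) i - (act C0 (opP y) + act D x) i|
    <= s ^+ N / (1 - s ^+ 4).
  rewrite -(@ler_pXn2r _ 2)// ?nnegrE// ?mulr_ge0 ?exprn_ge0 ?invr_ge0 ?(ltW q1)//.
  have -> : \sum_(t <- E | (mabs t < N.+1)%N) f (mnm_of t) i =
      (act C0 (opP (pstate N x)) + act D x) i.
    by rewrite -sum_ffunE -(sum_bmultinom_fset f EN) -sum_realization.
  have -> (v w : {ffun 'I_n -> H}) : v i - w i = (v - w) i by rewrite !ffunE.
  rewrite opprD addrACA subrr addr0 -!raddfB (le_trans (nsq_coord _ _))//.
  rewrite (le_trans (output_le _))// (le_trans (nsq_opP_le _))//.
  have -> : pstate N x - y = - (y - pstate N x) by rewrite opprB.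
  have -> : nsq (- (y - pstate N x)) = nsq (y - pstate N x).
    by apply: eq_bigr => j _; rewrite ffunE normrN.
  have nsqy : nsq y <= (1 - s ^+ 4)^-1.
    rewrite -[leRHS]mul1r ler_pdivlMr// mulrC (le_trans _ x1)// (le_trans _ (solution_bound yE))//.
    by rewrite lerDl nsq_ge0.
  rewrite (le_trans (ler_wpM2l q0 (partial_state_diff N yE)))// [(_ / _) ^+ 2]exprMn.
  rewrite mulrA -exprS -exprM -exprM; apply: ler_pM; rewrite ?nsq_ge0 ?exprn_ge0//.
    by rewrite ler_wiXn2l ?(ltW s1)// mulnC leq_mul.
  rewrite (le_trans nsqy)// expr2 ler_peMr// ?invr_ge0 ?(ltW q1)// invf_ge1// gerBl//.
have high : `|\sum_(t <- E | ~~ (mabs t < N.+1)%N) f (mnm_of t) i| <=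
    s ^+ N * (n%:R ^+ 2 * (1 - s)^-1 ^+ d).
  rewrite (le_trans (ler_norm_sum _ _ _))//.
  have term t : (N < mabs t)%N -> `|f (mnm_of t) i| <= s ^+ N * (n%:R ^+ 2 * s ^+ mabs t).
    move=> Nt; rewrite /f ffunE opvE (le_trans (ler_norm_sum _ _ _))//.
    have -> : s ^+ N * (n%:R ^+ 2 * s ^+ mabs t) = \sum_(j < n) (n%:R * (s ^+ N * s ^+ mabs t)).
      by rewrite sumr_const card_ord -[RHS]mulr_natr; ring.
    apply: ler_sum => j _; rewrite normrZ ffunE; apply: ler_pM => //.
      (* n <= n^2 trades the square root of [n] for [n]. *)
      rewrite -(@ler_pXn2r _ 2)// ?nnegrE// (le_trans (tf_coef_bound blk unitaryU _ _ _))//.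
      by rewrite -natrX ler_nat; case: (n) => // l; rewrite expnS expn1 leq_pmulr.
    have xj : `|x j| <= 1.
      by rewrite -(@ler_pXn2r _ 2)// ?nnegrE// expr1n (le_trans (nsq_coord _ _)).
    rewrite (le_trans (norm_op_monomial _ _))// mulnC muln2 -addnn exprD -[leRHS]mulr1.
    rewrite ler_pM ?mulr_ge0 ?exprn_ge0// ler_wpM2r ?exprn_ge0//.
    by rewrite ler_wiXn2l ?(ltW s1)// ltnW.
  apply: (@le_trans _ _ (\sum_(t <- E | ~~ (mabs t < N.+1)%N) s ^+ N * (n%:R ^+ 2 * s ^+ mabs t))).
    by apply: ler_sum => t; rewrite -leqNgt; exact: term.
  apply: (@le_trans _ _ (\sum_(t <- E) s ^+ N * (n%:R ^+ 2 * s ^+ mabs t))).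
    rewrite [leRHS](bigID (fun t => mabs t < N.+1)%N)/= lerDr sumr_ge0// => t _.
    by rewrite !mulr_ge0 ?exprn_ge0.
  rewrite -mulr_sumr -mulr_sumr ler_wpM2l ?exprn_ge0// ler_wpM2l ?exprn_ge0//.
  exact: sum_geometric_le.
rewrite /transfer_bound mulrDr.
have -> : \sum_(t <- E) act (tf_coef blk A B C0 D (mnm_of t)) [ffun j => op_monomial T t (x j)] i
    = \sum_(t <- E) f (mnm_of t) i.
  by apply: eq_bigr => t _; rewrite -opvE.
rewrite (bigID (fun t => mabs t < N.+1)%N)/= addrAC.
exact: le_trans (ler_normD _ _) (lerD low high).
Qed.

End TransferEstimates.

Section TransferScalar.
Variables (C : numClosedFieldType) (d m n : nat) (blk : 'I_m -> 'I_d).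
Variables (A : 'M[C]_m) (B : 'M[C]_(m, n)) (C0 : 'M[C]_(n, m)) (D : 'M[C]_n).
Hypothesis unitaryU : block_mx A B C0 D \is unitarymx.

Lemma nsq_colligation_scalar (x : {ffun 'I_n -> C^o}) y :
  nsq (act A y + act B x) + nsq (act C0 y + act D x) = nsq y + nsq x.
Proof.
apply: (@nsq_colligation _ C^o (fun u v => u * v^*)) => //.
- by move=> u v w; rewrite mulrDl.
- by move=> a u v; rewrite -mulrA.
- by move=> u v; rewrite [RHS]rmorphM [RHS]mulrC; congr (_ * _); exact: (esym (conjCK v)).
- by move=> u; rewrite normCK.
Qed.

Lemma op_monomial_scale (z : 'I_d -> C) (t : multiindex d) (x : C^o) :
  op_monomial (fun k => ( *:%R (z k)) : C^o -> C^o) t x = (\prod_k z k ^+ t k) *: x.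
Proof.
rewrite /op_monomial; elim/big_rec2: _ => [|k f a _ IH] /=; first by rewrite scale1r.
rewrite IH; elim: (t k) => [|l IHl] /=; first by rewrite mul1r.
by rewrite IHl exprS !scalerA mulrA.
Qed.

(** The operator estimate on the one-dimensional space, with multiplication by [z k] as k-th
    operator and a unit vector as input; [y] is then a column of (1 - A P)^-1 B. *)
Lemma scalar_transfer_estimate (s : C) (z : 'I_d -> C) N (E : {fset multiindex d}) i j :
  0 <= s -> s < 1 -> (forall k, `|z k| <= s ^+ 2) ->
  (forall t, (mabs t < N.+1)%N -> t \in E) ->
  let P := diag_mx (\row_i z (blk i)) in 1%:M - P *m A \in unitmx ->
  `|\sum_(t <- E) tf_coef blk A B C0 D (mnm_of t) i j * (\prod_k z k ^+ t k)
    - (D + C0 *m invmx (1%:M - P *m A) *m P *m B) i j| <= s ^+ N * transfer_bound d n s.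
Proof.
move=> s0 s1 zs EN P Pu; set X := invmx (1%:M - P *m A) *m P *m B.
have XE : P *m (A *m X + B) = X.
  have : (1%:M - P *m A) *m X = P *m B by rewrite /X -!mulmxA mulKVmx.
  by rewrite mulmxBl mul1mx -mulmxA mulmxDr => <-; rewrite addrC subrK.
pose T k : {linear C^o -> C^o} := ( *:%R (z k)).
pose x : {ffun 'I_n -> C^o} := [ffun k => (k == j)%:R].
pose y : {ffun 'I_m -> C^o} := [ffun k => (A *m X + B) k j].
have actx p (M : 'M[C]_(p, n)) k : act M x k = M k j.
  rewrite ffunE (bigD1 j)//= big1 ?addr0 => [|l lj]; rewrite ffunE.
    by rewrite eqxx; exact: mulr1.
  by rewrite (negPf lj) scaler0.
have Py : opP blk T y = [ffun k => X k j].
  by apply/ffunP => k; rewrite !ffunE -[in RHS]XE /P mul_diag_mx !mxE.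
have actX p (M : 'M[C]_(p, m)) k : act M (opP blk T y) k = (M *m X) k j.
  by rewrite Py ffunE mxE; apply: eq_bigr => l _; rewrite ffunE.
have yE : y = act A (opP blk T y) + act B x.
  by apply/ffunP => k; rewrite [RHS]ffunE actX actx ffunE mxE.
have x1 : nsq x <= 1.
  rewrite /nsq (bigD1 j)//= big1 ?addr0 => [|l lj]; rewrite ffunE.
    by rewrite eqxx normr1 expr1n.
  by rewrite (negPf lj) normr0 expr0n.
have Tcomm k l u : T k (T l u) = T l (T k u) by rewrite /= !scalerA mulrC.
have Tle k u : `|T k u| <= s ^+ 2 * `|u| by rewrite normrZ ler_wpM2r.
have actm t : act (tf_coef blk A B C0 D (mnm_of t)) [ffun l => op_monomial T t (x l)] i =
    tf_coef blk A B C0 D (mnm_of t) i j * (\prod_k z k ^+ t k).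
  rewrite ffunE (bigD1 j)//= big1 ?addr0 => [|l lj]; rewrite !ffunE op_monomial_scale.
    by rewrite eqxx; congr (_ * _); exact: mulr1.
  by rewrite (negPf lj) !scaler0.
have := transfer_estimate unitaryU nsq_colligation_scalar Tcomm s0 s1 Tle i yE x1 EN.
have -> : (D + C0 *m invmx (1%:M - P *m A) *m P *m B) i j = (C0 *m X) i j + D i j.
  by rewrite /X !mulmxA mxE addrC.
rewrite -(eq_bigr _ (fun t _ => actm t)) [(_ + act D x) i]ffunE actX actx => h.
exact: h.
Qed.

End TransferScalar.

(** * Solving the state equation on a Hilbert space *)

Section TransferSolution.
Variables (C : numClosedFieldType) (H : completeNormedModType C) (d m n : nat).
Variables (blk : 'I_m -> 'I_d) (A : 'M[C]_m) (B : 'M[C]_(m, n)).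
Variables (C0 : 'M[C]_(n, m)) (D : 'M[C]_n) (T : 'I_d -> {linear H -> H}).
Hypothesis colligation : forall (x : {ffun 'I_n -> H}) y,
  nsq (act A y + act B x) + nsq (act C0 y + act D x) = nsq y + nsq x.
Hypothesis Tcomm : forall j k x, T j (T k x) = T k (T j x).
Variable s : C.
Hypotheses (s0 : 0 <= s) (s1 : s < 1).
Hypothesis Tle : forall k x, `|T k x| <= s ^+ 2 * `|x|.
(** Geometric decay is an assumption here because a closed field need not be archimedean; it holds
    over [R[i]]. *)
Hypothesis s_small : forall K e : C, 0 <= K -> 0 < e -> exists N, s ^+ N * K < e.
Implicit Types (x : {ffun 'I_n -> H}) (y : {ffun 'I_m -> H}).

Let opP := opP blk T.
Let pstate := partial_state blk A B T.
Let q1 : 0 < 1 - s ^+ 4. Proof. by rewrite subr_gt0 exprn_ilt1. Qed.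

Lemma partial_state_cvg x i : cvg ((fun N => pstate N x i) @ \oo).
Proof.
apply/cauchy_cvgP/cauchy_exP => e e0.
have K0 : 0 <= nsq x / (1 - s ^+ 4) by rewrite divr_ge0 ?nsq_ge0// ltW.
have [N Ne] := s_small K0 (exprn_gt0 2 e0).
exists (pstate N x i); exists N => // M /= NM.
rewrite -ball_normE /= distrC -(subnKC NM).
have -> (v w : {ffun 'I_m -> H}) : v i - w i = (v - w) i by rewrite !ffunE.
rewrite -(@ltr_pXn2r _ 2)// ?nnegrE ?(ltW e0)//; apply: le_lt_trans Ne.
rewrite (le_trans (nsq_coord _ _))//.
rewrite (le_trans (partial_state_cauchy blk colligation Tcomm s0 Tle _ _ _))//.
rewrite ler_pM ?exprn_ge0 ?nsq_ge0//.
  by rewrite -exprM ler_wiXn2l ?(ltW s1)// leq_pmull.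
by rewrite ler_pdivlMr// mulrC (partial_state_bound blk colligation Tcomm s0 s1 Tle).
Qed.

Lemma solution_exists x : exists y, y = act A (opP y) + act B x.
Proof.
pose y : {ffun 'I_m -> H} := [ffun i => lim ((fun N => pstate N x i) @ \oo)].
have ylim i : (fun N => pstate N x i) @ \oo --> y i.
  by rewrite ffunE; exact: partial_state_cvg.
clearbody y.
have near_y (e : C) : 0 < e -> exists M, forall N, (M <= N)%N ->
    forall i, `|y i - pstate N x i| < e.
  move=> e0; have : \forall N \near \oo, forall i, `|y i - pstate N x i| < e.
    by apply: filter_forall => i; have /cvgrPdist_lt := ylim i; exact.
  by case=> M _ MP; exists M.
exists y; apply/ffunP => i; apply/eqP; rewrite -subr_eq0 -normr_eq0 eq_le normr_ge0 andbT.
apply/ler_addgt0Pl => e e0; rewrite addr0.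
(* One [e1] pays for the distance to the iterate [M.+1], and [m.+1] of them for the image of the
   distance to the iterate [M]. *)
have [e1 e10 ->] : exists2 e1, 0 < e1 & e = m.+2%:R * e1.
  by exists (e / m.+2%:R); [rewrite divr_gt0// ltr0n|rewrite mulrC divfK// pnatr_eq0].
have [M MP] := near_y e1 e10.
have h1 := MP M.+1 (leqnSn M) i.
have h2 : `|act A (opP (y - pstate M x)) i| <= m.+1%:R * e1.
  rewrite -(@ler_pXn2r _ 2)// ?nnegrE ?mulr_ge0 ?(ltW e10)//.
  rewrite (le_trans (nsq_coord _ _))// (le_trans (state_le colligation _))//.
  rewrite (le_trans (nsq_opP_le blk s0 Tle _))//.
  rewrite (@le_trans _ _ (nsq (y - pstate M x)))//.
    by rewrite ler_piMl ?nsq_ge0// exprn_ile1// ltW.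
  rewrite (@le_trans _ _ (\sum_(k < m) e1 ^+ 2))//.
    apply: ler_sum => k _; rewrite !ffunE ler_pXn2r ?nnegrE ?(ltW e10)//.
    by rewrite ltW// MP.
  rewrite sumr_const card_ord -[_ *+ m]mulr_natl exprMn ler_wpM2r ?exprn_ge0 ?(ltW e10)//.
  by rewrite -natrX ler_nat (leq_trans (leqnSn m))// leq_pmulr.
have -> : y i - (act A (opP y) + act B x) i =
    (y i - pstate M.+1 x i) - act A (opP (y - pstate M x)) i.
  rewrite /pstate partial_stateS// /opP !raddfB /=.
  rewrite -/opP -/pstate; move: (act A _) (act A _) (act B x) => a b c.
  by rewrite !ffunE -addrA -opprD; congr (_ - _); rewrite [RHS]addrC addrA subrK.
rewrite (le_trans (ler_normB _ _))// (le_trans (lerD (ltW h1) h2))//.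
by rewrite -{1}[e1]mul1r -mulrDl nat1r.
Qed.

Lemma solution_unique x y y' : y = act A (opP y) + act B x ->
  y' = act A (opP y') + act B x -> y = y'.
Proof.
move=> yE y'E; apply/eqP; rewrite -subr_eq0; apply/eqP/nsq_eq0.
have E : y - y' = act A (opP (y - y')) + act B 0.
  by rewrite raddf0 addr0 {1}yE {1}y'E opprD addrACA subrr addr0 /opP !raddfB.
have := solution_bound colligation s0 Tle E; rewrite nsq0.
move/(le_trans _) => h; rewrite -(pmulr_rle0 _ q1); apply: h.
by rewrite lerDl nsq_ge0.
Qed.

(** Uniqueness of the solution makes the choice of [y] linear in [x]. *)
Lemma transfer_operator : exists L : {linear {ffun 'I_n -> H} -> {ffun 'I_n -> H}},
  forall x, exists2 y, y = act A (opP y) + act B x & L x = act C0 (opP y) + act D x.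
Proof.
have [f fE] := choice solution_exists.
pose L0 x := act C0 (opP (f x)) + act D x.
have L0_linear : linear L0.
  move=> a x x'; rewrite /L0; have -> : f (a *: x + x') = a *: f x + f x'.
    apply: (solution_unique (fE _)).
    by rewrite /opP !linearP [in LHS]fE [in LHS](fE x') scalerDr addrACA.
  by rewrite /opP !linearP scalerDr addrACA.
pose L : {linear {ffun 'I_n -> H} -> {ffun 'I_n -> H}} :=
  HB.pack L0 (GRing.isLinear.Build _ _ _ _ L0 L0_linear).
by exists L => x; exists (f x).
Qed.

End TransferSolution.

(** The product of all 1 - a_j lies below each factor and is positive, so 1 minus this product
    serves as a maximum of the a_k, also for an empty family. *)
Lemma common_square_bound (C : numClosedFieldType) d (a : 'I_d -> C) :
  (forall k, 0 <= a k) -> (forall k, a k < 1) ->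
  exists s, [/\ 0 <= s, s < 1 & forall k, a k <= s ^+ 2].
Proof.
move=> a0 a1; pose p := \prod_k (1 - a k).
have a1' k : 0 < 1 - a k by rewrite subr_gt0.
have p0 : 0 < p by apply: prodr_gt0.
have pk k : p <= 1 - a k.
  rewrite /p (bigD1 k)//= ler_piMr ?(ltW (a1' k))// prodr_ile1// => j _.
  by rewrite ltW//= gerBl.
have p1 : p <= 1 by apply: prodr_ile1 => k _; rewrite ltW//= gerBl.
exists (sqrtC (1 - p)); rewrite sqrtC_ge0 subr_ge0; split => // [|k].
  by rewrite -[ltRHS]sqrtC1 ltr_sqrtC ?nnegrE ?subr_ge0// gtrBl.
by rewrite sqrtCK lerBrDr -lerBrDl.
Qed.

Lemma transfer_bound_ge0 (C : numClosedFieldType) d n (s : C) : 0 <= s -> s < 1 ->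
  0 <= transfer_bound d n s.
Proof.
move=> s0 s1; rewrite /transfer_bound addr_ge0 ?mulr_ge0 ?exprn_ge0 ?invr_ge0 ?subr_ge0//.
  by rewrite exprn_ile1// ltW.
exact: ltW.
Qed.

(** * The Schur-Agler property of a realization *)

Section HilbertTransfer.
Variable R : realType.
Local Notation C := R[i].

Lemma geometric_small (s K e : C) :
  0 <= s -> s < 1 -> 0 <= K -> 0 < e -> exists N, s ^+ N * K < e.
Proof.
move=> s0 s1 K0 e0.
have realE (x : C) : 0 <= x -> x = (complex.Re x)%:C%C by move=> x0; rewrite RRe_real// ger0_real.
have K1 : 0 < K + 1 by rewrite ltr_wpDl.
have r0 : 0 <= complex.Re s by rewrite -lecR -realE.
have r1 : `|complex.Re s| < 1 by rewrite ger0_norm// -ltcR -realE.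
have eK : 0 < e / (K + 1) by rewrite divr_gt0.
have eK' : 0 < complex.Re (e / (K + 1)) by rewrite -ltcR -realE// ltW.
have /cvgrPdist_lt /(_ _ eK')[N _ /(_ N (leqnn N))] := cvg_expr r1.
rewrite /= sub0r normrN ger0_norm; last exact: exprn_ge0.
rewrite -ltcR rmorphXn /= -realE// -realE ?(ltW eK)// ltr_pdivlMr// => h.
exists N; apply: le_lt_trans h; rewrite ler_wpM2l ?exprn_ge0//.
by rewrite lerDl.
Qed.

Lemma strict_contraction_bound (H : normedModType C) (f : {linear H -> H}) :
  (opnorm (fun x : H => `|x|%R) (fun x : H => `|x|%R) f < 1)%E ->
  exists r : C, [/\ 0 <= r, r < 1 & forall x, `|f x| <= r * `|x|].
Proof.
move=> f1; set o := opnorm _ _ _ in f1.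
have o0 : (0 <= o)%E.
  have : (`|0 : H| <= 1 :> C) by rewrite normr0.
  by move/(le_opnorm (fun x : H => `|x|) f); rewrite linear0 normr0.
have oE : o = (fine o)%:E by rewrite fineK// ge0_fin_numE// (lt_trans f1)// ltry.
exists (fine o)%:C%C; split.
- by rewrite ler0c -lee_fin -oE.
- by rewrite -[ltRHS](rmorph1 (real_complex R)) ltcR -lte_fin -oE.
move=> x; have [->|x0] := eqVneq x 0; first by rewrite linear0 !normr0 mulr0.
have nx : 0 < `|x| by rewrite normr_gt0.
have u1 : `|(`|x|^-1 *: x)| <= 1.
  by rewrite normrZ normfV normr_id mulVf// gt_eqF.
have := le_opnorm (fun x : H => `|x|) f u1; rewrite -/o oE lee_fin.
rewrite linearZ normrZ normfV normr_id => h.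
rewrite -ler_pdivrMr// mulrC -[leLHS]RRe_real ?lecR//.
Qed.

Variables (d n m : nat) (blk : 'I_m -> 'I_d).
Variables (A : 'M[C]_m) (B : 'M[C]_(m, n)) (C0 : 'M[C]_(n, m)) (D : 'M[C]_n).
Hypothesis unitaryU : block_mx A B C0 D \is unitarymx.

Let c (t : multiindex d) := tf_coef blk A B C0 D (mnm_of t).

Lemma power_series_transfer (F : ('I_d -> C) -> 'M[C]_n) :
  (forall z, polydisk z -> let P := diag_mx (\row_i z (blk i)) in
    1%:M - P *m A \in unitmx /\ F z = D + C0 *m invmx (1%:M - P *m A) *m P *m B) ->
  power_series_expansion c F.
Proof.
move=> FE z zD i j; have [Pu ->] := FE z zD; set G := D + _.
have [s [s0 s1 zs]] := common_square_bound (fun k => normr_ge0 (z k)) zD.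
have tf := @totally_filter (multiindex d).
apply: (@cvgrPdist_lt C C^o _ _ tf _ (G i j)).2 => e e0.
have [N Ne] := geometric_small s0 s1 (transfer_bound_ge0 d n s0 s1) e0.
have [A0 A0N] := low_degree_fset d N.+1.
exists A0 => // E A0E /=; rewrite partial_sumE distrC; apply: le_lt_trans Ne.
apply: (scalar_transfer_estimate unitaryU i j s0 s1 zs _ Pu) => t tN.
by apply: (fsubsetP A0E); exact: A0N.
Qed.

Lemma contractive_transfer (H : completeNormedModType C) (ip : {dot H for Num.conj})
    (T : 'I_d -> {linear H -> H}) :
  is_inner_product ip -> commuting_strict_contractions T ->
  exists2 L : {linear {ffun 'I_n -> H} -> {ffun 'I_n -> H}},
    op_power_series c T L & (opnorm (@l2norm R H n) (@l2norm R H n) L <= 1)%E.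
Proof.
move=> ipE [Tcomm T1].
have [r rP] := choice (fun k => strict_contraction_bound (T1 k)).
have r0 k : 0 <= r k by have [] := rP k.
have r1 k : r k < 1 by have [] := rP k.
have [s [s0 s1 rs]] := common_square_bound r0 r1.
have Tle k x : `|T k x| <= s ^+ 2 * `|x|.
  by have [_ _ /(_ x)/le_trans->//] := rP k; rewrite ler_wpM2r.
have coll (x : {ffun 'I_n -> H}) y :
    nsq (act A y + act B x) + nsq (act C0 y + act D x) = nsq y + nsq x.
  apply: (nsq_colligation (ip := fun u v => ip u v)) => //.
  - by move=> u v w; rewrite linearDl.
  - by move=> a u v; rewrite linearZl_LR.
  - by move=> u v; rewrite hermC /= mul1r.
have small K e : 0 <= K -> 0 < e -> exists N, s ^+ N * K < e by exact: geometric_small.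
have [L LE] := transfer_operator blk coll Tcomm s0 s1 Tle small.
have nsq1 (x : {ffun 'I_n -> H}) : l2norm x <= 1 -> nsq x <= 1.
  move=> x1; rewrite -[leLHS]sqrtCK -[leRHS](expr1n _ 2) ler_pXn2r ?nnegrE//.
  by rewrite sqrtC_ge0 nsq_ge0.
exists L; last first.
  apply: opnorm_le => x /nsq1 x1; rewrite rmorph1 -sqrtC1 ler_sqrtC ?nnegrE ?nsq_ge0//.
  have [y yE ->] := LE x; have := solution_bound coll s0 Tle yE.
  move/(le_trans _)/le_trans; apply=> //; rewrite lerDr mulr_ge0 ?nsq_ge0//.
  by rewrite subr_ge0 exprn_ile1// ltW.
rewrite /op_power_series.
set K := transfer_bound d n s.
have K0 : 0 <= K by exact: transfer_bound_ge0.
have nK0 : 0 <= n%:R * K by rewrite mulr_ge0.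
have near_le (e : R) : 0 < e -> \forall E \near totally,
    (opnorm (@l2norm R H n) (@l2norm R H n)
      (fun x => partial_sum (fun t => tensor_op (c t) (op_monomial T t) x) E - L x)%R <= e%:E)%E.
  move=> e0; have e0' : 0 < e%:C%C :> C by rewrite ltcR.
  have [N Ne] := geometric_small s0 s1 nK0 e0'.
  have [A0 A0N] := low_degree_fset d N.+1.
  exists A0 => // E A0E /=; apply: opnorm_le => x /nsq1 x1.
  have [y yE Ly] := LE x.
  have EN t : (mabs t < N.+1)%N -> t \in E by move=> /A0N; exact: (fsubsetP A0E).
  have est i := transfer_estimate unitaryU coll Tcomm s0 s1 Tle i yE x1 EN.
  apply: le_trans (ltW Ne).
  have sK0 : 0 <= s ^+ N * K by rewrite mulr_ge0 ?exprn_ge0.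
  have snK0 : 0 <= s ^+ N * (n%:R * K) by rewrite mulr_ge0 ?exprn_ge0.
  rewrite /l2norm -(sqrCK snK0) ler_sqrtC ?nnegrE ?exprn_ge0 ?nsq_ge0//.
  apply: (@le_trans _ _ (\sum_(i < n) (s ^+ N * K) ^+ 2)).
    apply: ler_sum => i _; rewrite ler_pXn2r ?nnegrE//.
    apply: le_trans (est i); rewrite Ly partial_sumE; set v := act C0 _ + _.
    have -> (u : {ffun 'I_n -> H}) : (u - v) i = u i - v i by rewrite !ffunE.
    rewrite sum_ffunE le_eqVlt; apply/orP; left; apply/eqP; congr (`|_ - _|); apply: eq_bigr => t _.
    by rewrite !ffunE; apply: eq_bigr => j _; rewrite ffunE.
  rewrite sumr_const card_ord -[_ *+ n]mulr_natl (mulrCA (s ^+ N)) [leRHS]exprMn ler_wpM2r ?exprn_ge0//.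
  by rewrite -natrX ler_nat; case: (n) => // l; rewrite leq_pmulr.
have op_ge0 (f : {ffun 'I_n -> H} -> {ffun 'I_n -> H}) :
    (0 <= opnorm (@l2norm R H n) (@l2norm R H n) f)%E.
  have x0 : l2norm (0 : {ffun 'I_n -> H}) <= 1.
    have -> : l2norm (0 : {ffun 'I_n -> H}) = sqrtC (nsq (0 : {ffun 'I_n -> H})) by [].
    by rewrite nsq0 sqrtC0.
  have := le_opnorm (@l2norm R H n) f x0; apply: le_trans; rewrite lee_fin -lecR.
  by rewrite RRe_real ?ger0_real// sqrtC_ge0 nsq_ge0.
have tf := @totally_filter (multiindex d).
(* Convergence to 0 in the extended reals is reduced to the reals, which requires the operator norms
   to be finite eventually. *)
apply/fine_cvgP; split.
  apply: filterS (near_le 1 ltr01) => E; rewrite ge0_fin_numE// => /le_lt_trans; apply.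
  exact: ltry.
apply/cvgrPdist_le => e e0; apply: filterS (near_le e e0) => E /= Ee.
rewrite sub0r normrN ger0_norm ?fine_ge0// -lee_fin fineK// ge0_fin_numE//.
exact: le_lt_trans Ee (ltry _).
Qed.

End HilbertTransfer.

Lemma realization_Schur_Agler (R : realType) d n (F : ('I_d -> R[i]) -> 'M[R[i]]_n) :
  Givone_Roesser_unitary_realization F -> Schur_Agler F.
Proof.
move=> [m [A [B [C0 [D [U FE]]]]]].
pose blk (i : 'I_(\sum_k m k)) := tagnat.sig1 i.
exists (fun t => tf_coef blk A B C0 D (mnm_of t)).
  apply: (power_series_transfer U) => z zD /=.
  have := FE z zD; rewrite /block_scalar_mx mxdiag_scalarE; exact.
by move=> H ip T ipE TT; exact: (contractive_transfer blk U ipE TT).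
Qed.

Theorem theorem2p1 (R : realType) (d n : nat) (hd : (0 < d)%N) (hn : (0 < n)%N)
    (F : ('I_d -> R[i]%type) -> 'M[R[i]%type]_n) :
  (rational_inner_Schur_Agler F <-> rational_Agler_decomposition F) /\
  (rational_inner_Schur_Agler F <-> Givone_Roesser_unitary_realization F).
Proof.
have inner_real : rational_inner_Schur_Agler F <-> Givone_Roesser_unitary_realization F.
  split; first exact: inner_Schur_Agler_realization.
  by move=> r; split; [exact: realization_Schur_Agler|exact: realization_rational_inner].
split=> //; rewrite inner_real.
by split; [exact: realization_decomposition|exact: decomposition_realization].
Qed.
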